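(* Let $\Phi:\mathbb{R}\to\mathbb{R}$ be a differentiable function, let $a_0,\dots,a_n\in\mathbb{R}$, and consider the generalised Hamiltonian $$H_\Phi(u_S,u_T,\theta_S) = \int_\Omega \left\{ \frac{1}{2} (|u_S|^2 + u_T^2) - \gamma_S \theta_S \right\} dV + \int_\Omega \Phi(q)\, dV + \sum_{i=0}^n a_i \int_{\partial \Omega_i } v_S \cdot ds ,$$ where $\gamma_S=(g/\theta_0)z$, $v_S = s u_S - (u_T+fx)\nabla\theta_S$ and $q=\mathrm{curl}(v_S)\cdot\hat y$. A (restricted) class of stationary solutions $(u_{Se},u_{Te},\theta_{Se})$ of the ISM equations with boundary condition $u_S\cdot n=0$ on $\partial\Omega$ is given by the critical points of $H_\Phi$. These critical points are given by the conditions $$a_i = \Phi'(q_e|_{\partial \Omega_i}), \quad i=0,\ldots,n,$$ $$u_{Se} = -\,s\,\mathrm{curl}(\Phi'(q_e)\hat y),$$ $$u_{Te} = \mathrm{curl}(\Phi'(q_e)\hat y)\cdot\nabla\theta_{Se},$$ $$\gamma_S = \mathrm{curl}(\Phi'(q_e)\hat y)\cdot(\nabla u_{Te}+f\hat x),$$ where $q_e$ is the potential vorticity $q$ evaluated at $(u_{Se},u_{Te},\theta_{Se})$. Moreover, $\Phi$ can be written in terms of the Bernoulli function $K$ of the stationary solution as $$\Phi(\lambda) = \lambda\left(\int^{\lambda}\frac{K(t)}{t^2}\,dt + C\right)$$ for a constant $C$.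
   Context: $\Omega\subset\mathbb{R}^2$ is a bounded domain with smooth boundary $\partial\Omega$, outward unit normal $n$, and coordinates $(x,z)$ (the vertical slice). $\hat x,\hat y,\hat z$ are the unit vectors of $\mathbb{R}^3$ in the $x,y,z$ directions ($\hat y$ is transverse to the slice); all fields depend only on $(x,z)$ and time; slice vector fields have only $\hat x$ and $\hat z$ components, $\nabla=(\partial_x,0,\partial_z)$ is the gradient in the slice, and $\mathrm{curl}$ is the three-dimensional curl. $\partial\Omega_0,\dots,\partial\Omega_n$ are the connected components of $\partial\Omega$; line integrals $\int_{\partial\Omega_i}v\cdot ds$ are taken along the unit tangent $n\times\hat y$. The Incompressible Slice Model (ISM) for the slice velocity $u_S$ (vector field on $\Omega$), transverse velocity $u_T$ (scalar), potential temperature $\theta_S$ (scalar) and pressure $p$ is $$\partial_t u_S + u_S\cdot\nabla u_S - f u_T\hat x = -\nabla p + \frac{g}{\theta_0}\theta_S\hat z,$$ $$\partial_t u_T + u_S\cdot\nabla u_T + f u_S\cdot\hat x = -\frac{g}{\theta_0} z s,$$ $$\partial_t\theta_S + u_S\cdot\nabla\theta_S + u_T s = 0,\qquad \nabla\cdot u_S=0,$$ with $u_S\cdot n=0$ on $\partial\Omega$. Here $g,\theta_0,f,s$ are real constants (gravity, reference temperature, Coriolis parameter, transverse variation of potential temperature). A stationary (equilibrium) solution is a time-independent solution; quantities evaluated at it carry the subscript $e$. $v_S$ is called the circulation velocity and $q$ the potential vorticity. A critical point of $H_\Phi$ is a state at which the first variation $\delta H_\Phi(\delta u_S,\delta u_T,\delta\theta_S)$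 vanishes for all variations of $(u_S,u_T,\theta_S)$. The condition $a_i=\Phi'(q_e|_{\partial\Omega_i})$ means that $\Phi'(q_e)$ equals the constant $a_i$ on $\partial\Omega_i$. All functions, including $\Phi$, are assumed smooth enough for the expressions to make sense. The Bernoulli function $K$ of a stationary solution is the real differentiable function with $$p_e + \tfrac12|u_{Se}|^2 + \tfrac12 u_{Te}^2 - \gamma_S\theta_{Se} = K(q_e).$$ The symbol $\int^\lambda \frac{K(t)}{t^2}dt$ denotes an antiderivative of $K(t)/t^2$ evaluated at $\lambda$.
   Formalization: It is assumed that θ0 ≠ 0 and that s, f, g are not all zero (if all vanish, the zero state is critical for any a_i); the pressure, hence K, is normalized by an additive constant, and C is taken separately for λ > 0 and λ < 0. *)

(* Defs.v *)
From HB Require Import structures.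
From mathcomp Require Import all_boot all_order all_algebra.
From mathcomp Require Import all_classical all_reals all_analysis.

Set Implicit Arguments.
Unset Strict Implicit.
Unset Printing Implicit Defensive.

Import Order.TTheory GRing.Theory Num.Theory.
Import numFieldNormedType.Exports.

Local Open Scope ring_scope.
Local Open Scope classical_set_scope.

(* A point or vector (a, b) of the slice R * R has a along xhat and b along
   zhat. The library norm of R * R is the max norm, hence the explicit Euclidean
   inner product and length below. *)
Definition dot (R : realType) (a b : R * R) : R := a.1 * b.1 + a.2 * b.2.

Definition elen (R : realType) (a : R * R) : R := Num.sqrt (dot a a).

Definition xhat (R : realType) : R * R := (1, 0).

Definition zhat (R : realType) : R * R := (0, 1).

Definition dx (R : realType) (F : R * R -> R) : R * R -> R := 'D_(1, 0) F.

Definition dz (R : realType) (F : R * R -> R) : R * R -> R := 'D_(0, 1) F.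

Definition grad (R : realType) (F : R * R -> R) (w : R * R) : R * R :=
  (dx F w, dz F w).

Definition div (R : realType) (v : R * R -> R * R) (w : R * R) : R :=
  dx (fun y => (v y).1) w + dz (fun y => (v y).2) w.

Definition advect (R : realType) (u : R * R) (F : R * R -> R) (w : R * R) : R :=
  dot u (grad F w).

Definition advectv (R : realType) (u : R * R) (v : R * R -> R * R) (w : R * R) :
    R * R :=
  (advect u (fun y => (v y).1) w, advect u (fun y => (v y).2) w).

(* Vectors of R^3 are ((x-component, y-component), z-component). The fields do
   not depend on y, so the y-derivatives in the three-dimensional curl vanish. *)
Definition curl3 (R : realType) (A : R * R -> R * R * R) (w : R * R) :
    R * R * R :=
  (- dz (fun y => (A y).1.2) w,
   dz (fun y => (A y).1.1) w - dx (fun y => (A y).2) w,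
   dx (fun y => (A y).1.2) w).

(* curl v . yhat, for a slice field v *)
Definition curl_dot_yhat (R : realType) (v : R * R -> R * R) (w : R * R) : R :=
  (curl3 (fun y => ((v y).1, 0, (v y).2)) w).1.2.

(* curl (psi yhat), as a slice field: its y-component is 0 *)
Definition curl_yhat (R : realType) (psi : R * R -> R) (w : R * R) : R * R :=
  let c := curl3 (fun y => (0, psi y, 0)) w in (c.1.1, c.2).

(* Functions of class C^k, by induction on k: every directional derivative of a
   differentiable function of class C^(k+1) is of class C^k. *)
Fixpoint Ck (R : realType) (k : nat) (V W : normedModType R) (F : V -> W) :
    Prop :=
  match k with
  | 0 => continuous F
  | k'.+1 => (forall x, differentiable F x) /\ (forall v, Ck k' ('D_v F))
  end.

(* c parametrizes an oriented boundary curve whose unit tangent is n x yhat,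
   with n the outward normal. As n x yhat = (- n_z, n_x), the normal is
   n = (t_z, - t_x) for the unit tangent t. *)
Definition unit_normal (R : realType) (c : R -> R * R) (t : R) : R * R :=
  (elen (c^`() t))^-1 *: ((c^`() t).2, - (c^`() t).1).

(* Omega is a bounded domain whose smooth boundary has the n + 1 connected
   components c_0(R), ..., c_n(R), each being a smooth simple closed curve given
   by a regular 1-periodic parametrization. The last condition says that Omega
   lies on one side of its boundary and that unit_normal points out of it, which
   fixes the orientation of each c_i. *)
Definition smooth_bounded_domain (R : realType) (Omega : set (R * R)) (n : nat)
    (c : 'I_n.+1 -> R -> R * R) : Prop :=
  [/\ [/\ open Omega, connected Omega & bounded_set Omega],
      closure Omega `\` Omega = \bigcup_(i in [set: 'I_n.+1]) range (c i),
      forall i, [/\ forall k, Ck k (c i),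
                    forall t, c i (t + 1) = c i t
                  & forall t, (c i)^`() t != 0],
      forall i j (t t' : R), 0 <= t < 1 -> 0 <= t' < 1 -> c i t = c j t' ->
        i = j /\ t = t'
    & forall i t, exists2 eps : R, 0 < eps & forall h : R, 0 < h < eps ->
        Omega (c i t - h *: unit_normal (c i) t) /\
        ~ Omega (c i t + h *: unit_normal (c i) t)].

Definition area_integral (R : realType) (Omega : set (R * R))
    (F : R * R -> R) : R :=
  \int[(@lebesgue_measure R \x @lebesgue_measure R)%E]_(w in Omega) F w.

Definition line_integral (R : realType) (c : R -> R * R) (v : R * R -> R * R) :
    R :=
  \int[@lebesgue_measure R]_(t in `[0, 1]) dot (v (c t)) (derive1 c t).

Record state (R : realType) := State {
  uS : R * R -> R * R ;
  uT : R * R -> R ;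
  thS : R * R -> R }.

(* Functions of class C^k on the closure of a domain are represented by
   C^k extensions to the plane. These are the smoothness classes for which the
   potential vorticity of a state is C^1. *)
Definition smooth_state (R : realType) (e : state R) : Prop :=
  [/\ Ck 2 (uS e), Ck 2 (uT e) & Ck 3 (thS e)].

Definition perturb (R : realType) (e : state R) (eps : R) (d : state R) :
    state R :=
  State (fun w => uS e w + eps *: uS d w)
        (fun w => uT e w + eps * uT d w)
        (fun w => thS e w + eps * thS d w).

Definition gammaS (R : realType) (g theta0 : R) (w : R * R) : R :=
  g / theta0 * w.2.

(* circulation velocity *)
Definition vS (R : realType) (f s : R) (e : state R) (w : R * R) : R * R :=
  s *: uS e w - (uT e w + f * w.1) *: grad (thS e) w.

(* potential vorticity *)
Definition pv (R : realType) (f s : R) (e : state R) : R * R -> R :=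
  curl_dot_yhat (vS f s e).

Definition H_Phi (R : realType) (g theta0 f s : R) (Omega : set (R * R)) (n : nat)
    (c : 'I_n.+1 -> R -> R * R) (Phi : R -> R) (a : 'I_n.+1 -> R)
    (e : state R) : R :=
  area_integral Omega (fun w => 2^-1 * (dot (uS e w) (uS e w) + uT e w ^+ 2)
                            - gammaS g theta0 w * thS e w)
  + area_integral Omega (fun w => Phi (pv f s e w))
  + \sum_(i < n.+1) a i * line_integral (c i) (vS f s e).

Definition critical_point (R : realType) (H : state R -> R) (e : state R) :
    Prop :=
  forall d, smooth_state d ->
    is_derive (0 : R) (1 : R) (fun eps => H (perturb e eps d)) (0 : R).

(* The Incompressible Slice Model, with state e t and pressure p t at time t *)
Definition ISM_solution (R : realType) (g theta0 f s : R) (Omega : set (R * R))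
    (n : nat) (c : 'I_n.+1 -> R -> R * R) (e : R -> state R)
    (p : R -> R * R -> R) : Prop :=
  [/\ forall t, smooth_state (e t) /\ Ck 1 (p t),
      forall (t : R) w, Omega w ->
        [/\ derivable (fun r : R => uS (e r) w) t 1,
            derivable (fun r : R => uT (e r) w) t 1
          & derivable (fun r : R => thS (e r) w) t 1],
      forall t w, Omega w ->
        [/\ derive1 (fun r => uS (e r) w) t + advectv (uS (e t) w) (uS (e t)) w
              - (f * uT (e t) w) *: xhat R
            = - grad (p t) w + (g / theta0 * thS (e t) w) *: zhat R,
            derive1 (fun r => uT (e r) w) t + advect (uS (e t) w) (uT (e t)) w
              + f * dot (uS (e t) w) (xhat R)
            = - (g / theta0) * w.2 * s,
            derive1 (fun r => thS (e r) w) t + advect (uS (e t) w) (thS (e t)) w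
              + uT (e t) w * s = 0
          & div (uS (e t)) w = 0]
    & forall t i r, dot (uS (e t) (c i r)) (unit_normal (c i) r) = 0].

Definition stationary_solution (R : realType) (g theta0 f s : R)
    (Omega : set (R * R)) (n : nat) (c : 'I_n.+1 -> R -> R * R) (e : state R)
    (p : R * R -> R) : Prop :=
  ISM_solution g theta0 f s Omega c (fun=> e) (fun=> p).

Definition equilibrium_conditions (R : realType) (g theta0 f s : R)
    (Omega : set (R * R)) (n : nat) (c : 'I_n.+1 -> R -> R * R) (Phi : R -> R)
    (a : 'I_n.+1 -> R) (e : state R) : Prop :=
  let q := pv f s e in
  let curlPhi' := curl_yhat (fun w => Phi^`() (q w)) in
  [/\ forall i t, a i = Phi^`() (q (c i t)),
      forall w, Omega w -> uS e w = - s *: curlPhi' w,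
      forall w, Omega w -> uT e w = dot (curlPhi' w) (grad (thS e) w)
    & forall w, Omega w ->
        gammaS g theta0 w = dot (curlPhi' w) (grad (uT e) w + f *: xhat R)].

(* The pressure p of a solution is determined up to an additive constant, and
   hence so is K. *)
Definition Bernoulli_function (R : realType) (g theta0 f s : R)
    (Omega : set (R * R)) (e : state R) (p : R * R -> R) (K : R -> R) : Prop :=
  (forall l, derivable K l 1) /\
  forall w, Omega w ->
    p w + 2^-1 * dot (uS e w) (uS e w) + 2^-1 * uT e w ^+ 2
      - gammaS g theta0 w * thS e w = K (pv f s e w).

(* Phi(l) = l (A(l) + C) for the l in L, where A is an antiderivative of
   K(t) / t^2. The integrand is singular at 0, so this is read on the half-lines
   0 < l and l < 0, each with its own constant C. *)
Definition Bernoulli_formula (R : realType) (K Phi : R -> R) (L : set R) : Prop :=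
  forall D : set R, D = [set l | 0 < l] \/ D = [set l | l < 0] ->
  forall A : R -> R,
    (forall l, D l -> is_derive l (1 : R) A (K l / l ^+ 2)) ->
  exists C : R, forall l, D l -> L l -> Phi l = l * (A l + C).

(* Main.v *)
Require Import Defs.
From HB Require Import structures.
From mathcomp Require Import all_boot all_order all_algebra.
From mathcomp Require Import all_classical all_reals all_analysis measurable_realfun.
From mathcomp Require Import ring lra.
Set Implicit Arguments.
Unset Strict Implicit.
Unset Printing Implicit Defensive.
Import Order.TTheory GRing.Theory Num.Theory.
Import numFieldNormedType.Exports.
Local Open Scope ring_scope.
Local Open Scope classical_set_scope.

(** The first variation of H_Phi at a state contains derivatives of the variation,
    through the potential vorticity and the circulation velocity v_S. With
    psi = Phi' o q and m = u_T + f x, integration by parts removes them: the variation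
    of v_S is, up to the gradient of - m dth, a field (flux1, flux2) that contains the
    variation undifferentiated, and dq = dz flux1 - dx flux2. Green's theorem turns
    the integral of psi dq into an area integral and boundary integrals of psi times
    the flux, and the latter combine with the circulation terms (the gradient drops
    out of these, the curves being closed). In the end dH_Phi is the integral over
    Omega of the residuals of the equilibrium equations times the variation, plus the
    integrals over the curves of (a_i - psi) times the flux (variation_identity,
    H_derive_euler). So the equilibrium conditions make a state critical. Conversely,
    bump functions give the equations in Omega and, on the boundary, that a_i - psi
    times the tangent or the tangential derivative of th and m is zero, with a factor
    s in the case of the tangent (fundamental_lemma, critical_weak). This is a_i = psi
    if s is nonzero; if s = 0, a curve on which it failed would lie on a straight
    line, as f or g is nonzero (psi_bdry).

    Green's theorem for a C^1 function and a domain bounded by regular curves is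
    proved by localisation. Near a boundary point one coordinate is monotone along the
    curve and Omega is one side of a graph (graph_chart), where the formula follows
    from Fubini's theorem and the fundamental theorem of calculus (green_arc_dz,
    green_arc_dx); products with plateau functions reduce the general case to this one
    (green_theorem).

    At a critical point, let K(l) = l Phi'(l) - Phi(l) and let the pressure be
    K(q) - |u_S|^2 / 2 - u_T^2 / 2 + gamma_S theta_S. As grad K(q) = q grad psi, the
    momentum equation becomes an algebraic consequence of the equilibrium equations
    and the formula for q (momentum_x, momentum_z). The transport equations are
    further such consequences; s psi is a stream function for u_S, so u_S is
    divergence free, and it is tangent to the boundary because psi is constant there.
    Any other pressure has the same gradient, hence differs by a constant on the
    connected set Omega. Finally (Phi(l) / l)' = K(l) / l^2, which is the formula for
    Phi on each half-line (quotient_derive, bernoulli_on). Another Bernoulli function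
    equals K on the interval q(Omega), so the formula holds there too. *)

(** * Functions of class C^k *)

Section CkCalculus.
Context {R : realType}.
Implicit Types V W : normedModType R.

Lemma CkW V W k (F : V -> W) : Ck k.+1 F -> Ck k F.
Proof.
elim: k F => [|k IH] F [dF DF]; first by move=> x; exact: differentiable_continuous.
by split => // v; exact/IH/DF.
Qed.

Lemma Ck_le V W k l (F : V -> W) : (l <= k)%N -> Ck k F -> Ck l F.
Proof.
elim: k => [|k IH]; first by rewrite leqn0 => /eqP ->.
by rewrite leq_eqVlt => /predU1P[->//|]; rewrite ltnS => /IH H /CkW.
Qed.

Lemma Ck_cont V W k (F : V -> W) : Ck k F -> continuous F.
Proof. exact: (@Ck_le _ _ k 0). Qed.

Lemma Ck_cst V W k (a : W) : Ck k (fun _ : V => a).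
Proof.
elim: k a => [|k IH] a; first by move=> x; exact: cvg_cst.
split=> [x|v]; first exact: differentiable_cst.
have -> : 'D_v (fun _ : V => a) = fun=> 0 by apply/funext => x; rewrite derive_cst.
exact: IH.
Qed.

Lemma CkD V W k (F G : V -> W) : Ck k F -> Ck k G -> Ck k (fun x => F x + G x).
Proof.
elim: k F G => [|k IH] F G.
  by move=> cF cG x; apply: cvgD; [exact: cF|exact: cG].
move=> [dF DF] [dG DG]; split=> [x|v]; first exact: differentiableD.
have -> : 'D_v (fun x => F x + G x) = fun x => 'D_v F x + 'D_v G x.
  by apply/funext => x; apply: deriveD; apply: diff_derivable.
by apply: IH; [exact: DF|exact: DG].
Qed.

Lemma CkZ V W k (a : R) (F : V -> W) : Ck k F -> Ck k (fun x => a *: F x).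
Proof.
elim: k F => [|k IH] F.
  by move=> cF x; apply: cvgZ; [exact: cvg_cst|exact: cF].
move=> [dF DF]; split=> [x|v]; first exact: differentiableZ.
have -> : 'D_v (fun x => a *: F x) = fun x => a *: 'D_v F x.
  by apply/funext => x; apply: deriveZ; apply: diff_derivable.
by apply: IH; exact: DF.
Qed.

Lemma CkM V k (F G : V -> R) : Ck k F -> Ck k G -> Ck k (fun x => F x * G x).
Proof.
elim: k F G => [|k IH] F G.
  by move=> cF cG x; apply: cvgM; [exact: cF|exact: cG].
move=> hF hG; have [dF DF] := hF; have [dG DG] := hG.
split=> [x|v]; first exact: differentiableM.
have -> : 'D_v (fun x => F x * G x) = fun x => F x * 'D_v G x + G x * 'D_v F x.
  by apply/funext => x; rewrite deriveM//; apply: diff_derivable.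
by apply: CkD; apply: IH; by [exact: CkW|exact: DF|exact: DG].
Qed.

Lemma CkN V k (F : V -> R) : Ck k F -> Ck k (fun x => - F x).
Proof.
move=> /(CkZ (-1)); congr Ck; apply/funext => x.
by rewrite scaleN1r.
Qed.

Lemma CkB V k (F G : V -> R) : Ck k F -> Ck k G -> Ck k (fun x => F x - G x).
Proof. by move=> hF hG; apply: CkD => //; exact: CkN. Qed.

Lemma derive_comp1 V (f : R -> R) (F : V -> R) v x :
  differentiable F x -> differentiable f (F x) ->
  'D_v (fun y => f (F y)) x = 'D_1 f (F x) * 'D_v F x.
Proof.
move=> dF df; rewrite [LHS]deriveE; last exact: differentiable_comp.
rewrite [X in X v](_ : _ = 'd f (F x) \o 'd F x); last exact: diff_comp.
rewrite /= (deriveE v dF) (deriveE (1 : R) df).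
by rewrite -[in LHS](mulr1 ('d F x v)) linearZ /= mulrC.
Qed.

Lemma Ck_comp V k (f : R -> R) (F : V -> R) :
  Ck k f -> Ck k F -> Ck k (fun x => f (F x)).
Proof.
elim: k f F => [|k IH] f F.
  by move=> cf cF x; apply: continuous_comp; [exact: cF|exact: cf].
move=> [df Df] hF; have [dF DF] := hF.
split=> [x|v]; first exact: differentiable_comp.
have -> : 'D_v (fun x => f (F x)) = fun x => 'D_1 f (F x) * 'D_v F x.
  by apply/funext => x; exact: derive_comp1.
by apply: CkM; [apply: (IH ('D_1 f) F); [exact: Df|exact: CkW]|exact: DF].
Qed.

Lemma derive_pair V W1 W2 (F : V -> W1) (G : V -> W2) v x :
  differentiable F x -> differentiable G x ->
  'D_v (fun y => (F y, G y)) x = ('D_v F x, 'D_v G x).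
Proof.
move=> dF dG; rewrite !deriveE//; last exact: differentiable_pair.
by rewrite [X in X v](_ : _ = fun y => ('d F x y, 'd G x y)) //; exact: diff_pair.
Qed.

Lemma Ck_pair V W1 W2 k (F : V -> W1) (G : V -> W2) :
  Ck k F -> Ck k G -> Ck k (fun x => (F x, G x)).
Proof.
elim: k F G => [|k IH] F G.
  by move=> cF cG x; apply: cvg_pair; [exact: cF|exact: cG].
move=> [dF DF] [dG DG]; split=> [x|v]; first exact: differentiable_pair.
have -> : 'D_v (fun x => (F x, G x)) = fun x => ('D_v F x, 'D_v G x).
  by apply/funext => x; exact: derive_pair.
by apply: IH; [exact: DF|exact: DG].
Qed.

Lemma differentiable_fst W1 W2 (x : W1 * W2) : differentiable (fst : W1 * W2 -> W1) x.
Proof. by apply: linear_differentiable => y; exact: cvg_fst. Qed.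

Lemma differentiable_snd W1 W2 (x : W1 * W2) : differentiable (snd : W1 * W2 -> W2) x.
Proof. by apply: linear_differentiable => y; exact: cvg_snd. Qed.

Lemma derive_fstc V W1 W2 (F : V -> W1 * W2) v x : differentiable F x ->
  'D_v (fun y => (F y).1) x = ('D_v F x).1.
Proof.
move=> dF; rewrite [LHS]deriveE; last first.
  by apply: differentiable_comp => //; exact: differentiable_fst.
rewrite [X in X v](_ : _ = 'd (fst : W1 * W2 -> W1) (F x) \o 'd F x); last first.
  by apply: diff_comp => //; exact: differentiable_fst.
rewrite /= (deriveE v dF).
have /(congr1 (fun h => h ('d F x v))) // : 'd (fst : W1 * W2 -> W1) (F x) = fst :> (W1 * W2 -> W1).
by apply: diff_lin => y; exact: cvg_fst.
Qed.

Lemma derive_sndc V W1 W2 (F : V -> W1 * W2) v x : differentiable F x ->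
  'D_v (fun y => (F y).2) x = ('D_v F x).2.
Proof.
move=> dF; rewrite [LHS]deriveE; last first.
  by apply: differentiable_comp => //; exact: differentiable_snd.
rewrite [X in X v](_ : _ = 'd (snd : W1 * W2 -> W2) (F x) \o 'd F x); last first.
  by apply: diff_comp => //; exact: differentiable_snd.
rewrite /= (deriveE v dF).
have /(congr1 (fun h => h ('d F x v))) // : 'd (snd : W1 * W2 -> W2) (F x) = snd :> (W1 * W2 -> W2).
by apply: diff_lin => y; exact: cvg_snd.
Qed.

Lemma Ck_fstc V W1 W2 k (F : V -> W1 * W2) : Ck k F -> Ck k (fun x => (F x).1).
Proof.
elim: k F => [|k IH] F.
  by move=> cF x; apply: (continuous_comp (cF x)); exact: cvg_fst.
move=> [dF DF]; split=> [x|v].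
  by apply: differentiable_comp => //; exact: differentiable_fst.
have -> : 'D_v (fun x => (F x).1) = fun x => ('D_v F x).1.
  by apply/funext => x; exact: derive_fstc.
by apply: IH; exact: DF.
Qed.

Lemma Ck_sndc V W1 W2 k (F : V -> W1 * W2) : Ck k F -> Ck k (fun x => (F x).2).
Proof.
elim: k F => [|k IH] F.
  by move=> cF x; apply: (continuous_comp (cF x)); exact: cvg_snd.
move=> [dF DF]; split=> [x|v].
  by apply: differentiable_comp => //; exact: differentiable_snd.
have -> : 'D_v (fun x => (F x).2) = fun x => ('D_v F x).2.
  by apply/funext => x; exact: derive_sndc.
by apply: IH; exact: DF.
Qed.

Lemma Ck_id V k : Ck k (fun x : V => x).
Proof.
case: k => [|k]; first by move=> x; exact: cvg_id.
split=> [x|v]; first exact: ex_diff.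
have -> : 'D_v (fun x : V => x) = fun=> v by apply/funext => x; rewrite derive_id.
exact: Ck_cst.
Qed.

Lemma Ck_x k : Ck k (fun w : R * R => w.1).
Proof. exact/Ck_fstc/Ck_id. Qed.

Lemma Ck_z k : Ck k (fun w : R * R => w.2).
Proof. exact/Ck_sndc/Ck_id. Qed.

Lemma derive_dxdz (F : R * R -> R) v w : differentiable F w ->
  'D_v F w = v.1 * dx F w + v.2 * dz F w.
Proof.
move=> dF; rewrite /dx /dz !deriveE//.
have -> : v = v.1 *: ((1, 0) : R * R) + v.2 *: ((0, 1) : R * R).
  case: v => a b /=; congr (_, _); rewrite /GRing.scale /=.
    by rewrite [_ *: 1]mulr1 [_ *: 0]mulr0 addr0.
  by rewrite [_ *: 1]mulr1 [_ *: 0]mulr0 add0r.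
by rewrite linearD !linearZ /= /GRing.scale /= !(mulr1,mulr0,addr0,add0r).
Qed.

Lemma is_derive_curve (F : R * R -> R) (c : R -> R * R) t :
  differentiable F (c t) -> differentiable c t ->
  is_derive t (1 : R) (fun r => F (c r))
    (dx F (c t) * (c^`() t).1 + dz F (c t) * (c^`() t).2).
Proof.
move=> dF dc; have dFc : differentiable (fun r => F (c r)) t by exact: differentiable_comp.
apply: DeriveDef; first exact: diff_derivable.
rewrite deriveE// [X in X 1](_ : _ = 'd F (c t) \o 'd c t); last exact: diff_comp.
rewrite /= -[X in 'd F (c t) X](deriveE (1 : R) dc) -(deriveE _ dF) derive_dxdz//.
by rewrite derive1E mulrC [in X in _ + X]mulrC.
Qed.

Lemma Ck1_derivable k (f : R -> R) t : Ck k.+1 f -> derivable f t 1.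
Proof. by move=> [df _]; exact: diff_derivable. Qed.

Lemma Ck_derive1 V k (f : R -> V) : Ck k.+1 f -> Ck k f^`().
Proof.
move=> [_ Df]; have -> : f^`() = 'D_1 f by apply/funext => t; rewrite derive1E.
exact: Df.
Qed.

Lemma Ck_dx k (F : R * R -> R) : Ck k.+1 F -> Ck k (dx F).
Proof. by move=> [_]; exact. Qed.

Lemma Ck_dz k (F : R * R -> R) : Ck k.+1 F -> Ck k (dz F).
Proof. by move=> [_]; exact. Qed.

Lemma is_derive_z (F : R * R -> R) x z : differentiable F (x, z) ->
  is_derive z (1 : R) (fun y => F (x, y)) (dz F (x, z)).
Proof.
move=> dF; have h : differentiable (fun z : R => (x, z)) z :=
  (Ck_pair (Ck_cst R 1 x) (Ck_id R 1)).1 z.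
have := is_derive_curve dF h; rewrite derive1E derive_pair; last 2 first.
- exact: (Ck_cst R 1 x).1.
- exact: (Ck_id R 1).1.
by rewrite derive_cst derive_id /= mulr0 mulr1 add0r.
Qed.

Lemma is_derive_x (F : R * R -> R) x z : differentiable F (x, z) ->
  is_derive x (1 : R) (fun y => F (y, z)) (dx F (x, z)).
Proof.
move=> dF; have h : differentiable (fun x : R => (x, z)) x :=
  (Ck_pair (Ck_id R 1) (Ck_cst R 1 z)).1 x.
have := is_derive_curve dF h; rewrite derive1E derive_pair; last 2 first.
- exact: (Ck_id R 1).1.
- exact: (Ck_cst R 1 z).1.
by rewrite derive_cst derive_id /= mulr0 mulr1 addr0.
Qed.

End CkCalculus.

(** * Integrals over intervals *)

Section OneDim.
Context {R : realType}.
Notation mu := (@lebesgue_measure R).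
Implicit Types (f g P : R -> R) (a b t x : R).

Lemma cont_within f (A : set R) : continuous f -> {within A, continuous f}.
Proof. by move=> cf; apply: continuous_subspaceT. Qed.

Lemma itv_integrable f a b : continuous f -> mu.-integrable `[a, b] (EFin \o f).
Proof.
move=> cf; apply: continuous_compact_integrable; first exact: segment_compact.
exact: cont_within.
Qed.

Lemma is_derive_cont P f : (forall x, is_derive x (1 : R) P (f x)) -> continuous P.
Proof.
move=> dP x; apply: differentiable_continuous; apply/derivable1_diffP.
exact: ex_derive.
Qed.

Lemma FTC2 f P a b : a <= b -> continuous f -> (forall x, is_derive x (1 : R) P (f x)) ->
  \int[mu]_(x in `[a, b]) f x = P b - P a.
Proof.
rewrite le_eqVlt => /predU1P[-> _ _|ab cf dP].
  by rewrite set_itv1 Rintegral_set1 subrr.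
rewrite /Rintegral (@continuous_FTC2 _ f P)//.
- exact: cont_within.
- have cP := is_derive_cont dP.
  split => [x _||]; first exact: ex_derive.
  + by apply: cvg_at_right_filter; exact: cP.
  + by apply: cvg_at_left_filter; exact: cP.
- by move=> x _; rewrite derive1E; apply: derive_val.
Qed.

(** The integral from a base point a is known to have derivative f only at the
    points x > a. Near x, the two-sided integral from 0 differs by a constant from
    the integral from a base point to the left of both x and 0. *)
Lemma primitive f : continuous f -> exists P, forall x, is_derive x (1 : R) P (f x).
Proof.
move=> cf; pose J (a x : R) := \int[mu]_(t in `[a, x]) f t.
have JD a x : a < x -> is_derive x (1 : R) (J a) (f x).
  move=> ax; have xu : x < x + 1 by rewrite ltrDl.
  have [dJ J'] := continuous_FTC1_closed xu (itv_integrable a (x + 1) cf) ax (cf x).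
  by apply: DeriveDef; rewrite -?derive1E.
have Jadd a b x : a <= b -> b <= x -> J a x = J a b + J b x.
  move=> ab bx; apply/eqP; rewrite addrC -subr_eq; apply/eqP.
  rewrite /J Rintegral_itvB ?bnd_simp//; last exact: itv_integrable.
  rewrite Rintegral_itv_obnd_cbnd//.
  apply: integrableS (itv_integrable b x cf) => //.
  by apply: subset_itv; rewrite bnd_simp.
exists (fun x => if 0 <= x then J 0 x else - J x 0) => x.
have xN : - (`|x| + 1) < x.
  by rewrite ltrNl; apply: (le_lt_trans (y := `|x|)); rewrite ?ltrDl// -normrN ler_norm.
have N0 : - (`|x| + 1) <= 0 by rewrite oppr_le0 addr_ge0.
have HD : is_derive x (1 : R)
    (fun y => J (- (`|x| + 1)) y - J (- (`|x| + 1)) 0) (f x).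
  have -> : f x = f x - 0 by rewrite subr0.
  by apply: is_deriveB; exact: JD.
apply: near_eq_is_derive HD.
near=> y.
have yN : - (`|x| + 1) < y by near: y; exact: lt_nbhsr.
case: ifPn => [y0|]; first by rewrite (Jadd _ 0 y)// addrC addKr.
rewrite -ltNge => y0; rewrite (Jadd _ y 0)//; try exact: ltW.
by move: (J _ y) (J y 0) => A B; ring.
Unshelve. all: by end_near. Qed.

Lemma Rintegral_itvD f g a b : continuous f -> continuous g ->
  \int[mu]_(x in `[a, b]) (f x + g x) =
  \int[mu]_(x in `[a, b]) f x + \int[mu]_(x in `[a, b]) g x.
Proof. by move=> cf cg; rewrite RintegralD//; exact: itv_integrable. Qed.

Lemma Rintegral_itvZ f r a b : continuous f ->
  \int[mu]_(x in `[a, b]) (r * f x) = r * \int[mu]_(x in `[a, b]) f x.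
Proof. by move=> cf; rewrite RintegralZl//; exact: itv_integrable. Qed.

Lemma eq_Rintegral_increment f g (F G : R -> R) a b a' b' : a <= b -> a' <= b' ->
  continuous f -> continuous g ->
  (forall x, is_derive x (1 : R) F (f x)) ->
  (forall x, is_derive x (1 : R) G (g x)) ->
  F b - F a = G b' - G a' ->
  \int[mu]_(x in `[a, b]) f x = \int[mu]_(x in `[a', b']) g x.
Proof.
by move=> ab ab' cf cg dF dG e; rewrite (FTC2 ab cf dF) (FTC2 ab' cg dG).
Qed.

Lemma is_derive_compP P g (c c1 : R -> R) t : (forall x, is_derive x (1 : R) P (g x)) ->
  is_derive t (1 : R) c (c1 t) -> is_derive t (1 : R) (fun r => P (c r)) (g (c t) * c1 t).
Proof.
by move=> dP dc; exact: (@is_derive1_comp _ P c t (g (c t)) (c1 t)).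
Qed.

Lemma Rintegral_subst P g (c c1 : R -> R) a b : a <= b -> continuous g ->
  (forall x, is_derive x (1 : R) P (g x)) ->
  (forall t, is_derive t (1 : R) c (c1 t)) -> continuous c1 ->
  \int[mu]_(t in `[a, b]) (g (c t) * c1 t) = P (c b) - P (c a).
Proof.
move=> ab cg dP dc cc1; apply: (@FTC2 (fun t => g (c t) * c1 t) (fun t => P (c t))) => // x.
  have cc : continuous c := is_derive_cont dc.
  apply: cvgM; last exact: cc1.
  by apply: (continuous_comp (cc x)); exact: cg.
Qed.

(** The increment P (t + 1) - P t of a primitive P has derivative zero. *)
Lemma periodic_integral f t0 : continuous f -> (forall t, f (t + 1) = f t) ->
  \int[mu]_(t in `[0, 1]) f t = \int[mu]_(t in `[t0, t0 + 1]) f t.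
Proof.
move=> cf pf; have [P dP] := primitive cf.
rewrite (FTC2 _ cf dP)// (FTC2 _ cf dP) ?lerDl//.
pose D t := P (t + 1) - P t.
have dD t : is_derive t (1 : R) D 0.
  rewrite -(subrr (f t)) -{1}pf; apply: is_deriveB; rewrite -[f _]mulr1.
  apply: (is_derive_compP (c1 := fun=> 1) dP).
  exact: is_derive_shift.
by have := is_derive_0_is_cst 0 t0 dD; rewrite /D add0r.
Qed.

Lemma cont_box_bound (F : R * R -> R) (N : R) : continuous F ->
  exists2 C, 0 <= C & forall w, `|w.1| <= N -> `|w.2| <= N -> `|F w| <= C.
Proof.
move=> cF; have kB : compact (`[- N, N] `*` `[- N, N] : set (R * R)).
  by apply: compact_setX; exact: segment_compact.
have /compact_bounded[M [_ HM]] : compact (F @` (`[- N, N] `*` `[- N, N])).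
  by apply: continuous_compact => //; exact: continuous_subspaceT.
exists (`|M| + 1) => [|w w1 w2]; first by rewrite addr_ge0.
apply: (HM (`|M| + 1)); first by rewrite (le_lt_trans (ler_norm M))// ltrDl.
by exists w => //; split; rewrite /= in_itv /= -ler_norml.
Qed.

(** Differentiation under the integral sign with a constant dominating function,
    which is integrable because B has finite measure. *)
Lemma is_derive_integral d (Y : measurableType d) (nu : {measure set Y -> \bar R})
    (h h1 : R -> Y -> R) (B : set Y) (C a b x : R) : measurable B -> (nu B < +oo)%E ->
  a < x < b ->
  (forall t, nu.-integrable B (EFin \o h t)) ->
  (forall t y, B y -> is_derive t (1 : R) (h ^~ y) (h1 t y)) ->
  (forall t y, a < t < b -> B y -> `|h1 t y| <= C) ->
  is_derive x (1 : R) (fun t => \int[nu]_(y in B) h t y) (\int[nu]_(y in B) h1 x y).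
Proof.
move=> mB fB axb ih dh Ch.
have Ix : `]a, b[%classic x by rewrite /= in_itv.
have dh' t y : `]a, b[%classic t -> B y -> derivable (h ^~ y) t 1.
  by move=> _ By; have [] := dh t y By.
have C0 (y : Y) : 0 <= `|C| by [].
have iC : nu.-integrable B (EFin \o (fun=> `|C|)).
  by apply: measurable_bounded_integrable => //; exact: bounded_cst.
have Ch' t y : `]a, b[%classic t -> B y -> `|partial1of2 h t y| <= `|C|.
  rewrite /= in_itv /= => It By; rewrite partial1of2E.
  have := dh t y By => ? ; rewrite derive_val.
  by apply: (le_trans (Ch _ _ It By)); exact: ler_norm.
apply: DeriveDef.
  exact: (derivable_under_integral mB Ix (fun t _ => ih t) dh' C0 iC Ch').
rewrite -derive1E (differentiation_under_integral mB Ix (fun t _ => ih t) dh' C0 iC Ch').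
apply: eq_Rintegral => y /[1!inE] By; rewrite partial1of2E.
by have := dh x y By => ?; rewrite derive_val.
Qed.

Lemma is_derive_affine (a b x : R) : is_derive x (1 : R) (fun y => a + b * y) b.
Proof.
have H := is_deriveD (is_derive_cst a x 1) (is_deriveZ b (is_derive_id x 1)).
by apply: is_derive_eq H _; rewrite add0r [_ *: _]mulr1.
Qed.

End OneDim.

(** * Area integrals over bounded open sets *)

Section PlaneMeasure.
Context {R : realType}.
Notation mu := (@lebesgue_measure R).
Notation mu2 := (@lebesgue_measure R \x @lebesgue_measure R)%E.

Definition box (p : R * R) (r : R) : set (R * R) :=
  [set w | `|w.1 - p.1| < r /\ `|w.2 - p.2| < r].

Lemma boxE p r : box p r = `]p.1 - r, p.1 + r[ `*` `]p.2 - r, p.2 + r[.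
Proof.
apply/seteqP; split=> -[x z] /=; rewrite /box /= !in_itv /= !ltr_distl => -[h1 h2].
  by split.
by split.
Qed.

Lemma open_box (U : set (R * R)) p : open U -> U p -> exists2 r, 0 < r & box p r `<=` U.
Proof.
move=> oU Up; have : nbhs p U by exact: open_nbhs_nbhs.
move=> /nbhs_ballP[r /= r0 H]; exists r => // -[x z] [/= hx hz].
by apply: H; split; rewrite /ball /= distrC.
Qed.

Lemma box_open p r : open (box p r).
Proof.
rewrite boxE; apply: openI.
  apply: (@open_comp _ _ (fst : R * R -> R)); last exact: interval_open.
  by move=> w _; exact: cvg_fst.
apply: (@open_comp _ _ (snd : R * R -> R)); last exact: interval_open.
by move=> w _; exact: cvg_snd.
Qed.

Lemma box_measurable p r : measurable (box p r).
Proof. by rewrite boxE; apply: measurableX; exact: measurable_itv. Qed.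

(** Product measurability is generated by rectangles, so an open set has to be
    written as a countable union of them: the boxes that it contains with rational
    centres and radii 1 / (k + 1). *)
Lemma open_measurable2 (U : set (R * R)) : open U -> measurable U.
Proof.
move=> oU.
pose B (u : option (rat * rat * nat)) : set (R * R) :=
  if u is Some (q1, q2, k) then box (ratr q1, ratr q2) k.+1%:R^-1 else set0.
have -> : U = \bigcup_(i in [set i | B (unpickle i) `<=` U]) B (unpickle i).
  apply/seteqP; split=> [p Up|p [i /= BU Bp]]; last exact: BU.
  have [r r0 rU] := open_box oU Up.
  have [k kr] : exists k : nat, k.+1%:R^-1 < r / 2.
    have r2 : 0 < r / 2 by rewrite divr_gt0.
    have [k _ /(_ k (leqnn k)) /= kr] := near_infty_natSinv_lt (PosNum r2).
    by exists k.
  have k0 : (0 : R) < k.+1%:R^-1 by rewrite invr_gt0.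
  have rats (x : R) : exists q : rat, `|ratr q - x| < k.+1%:R^-1.
    have [|q hq] := @rat_in_itvoo R (x - k.+1%:R^-1) (x + k.+1%:R^-1).
      by rewrite ltrD2l gtrN.
    by exists q; rewrite ltr_distl; move: hq; rewrite in_itv.
  have [q1 hq1] := rats p.1; have [q2 hq2] := rats p.2.
  have uE : unpickle (pickle (q1, q2, k)) = Some (q1, q2, k) := pickleK _.
  exists (pickle (q1, q2, k)); last by rewrite uE; split; rewrite distrC.
  rewrite /mkset uE => w [/= hw1 hw2]; apply: rU; split.
    rewrite (splitr r); apply: le_lt_trans (ler_distD (ratr q1) _ _) _.
    by apply: ltrD; [exact: lt_trans kr|exact: lt_trans kr].
  rewrite (splitr r); apply: le_lt_trans (ler_distD (ratr q2) _ _) _.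
  by apply: ltrD; [exact: lt_trans kr|exact: lt_trans kr].
apply: bigcup_measurable => i _.
case: (unpickle i) => [[[q1 q2] k]|]; last exact: measurable0.
exact: (@box_measurable (ratr q1, ratr q2) k.+1%:R^-1).
Qed.

Lemma cont2_measurable (F : R * R -> R) : continuous F -> measurable_fun setT F.
Proof.
move=> /continuousP cF; apply: (measurability _ (RGenOpens.measurableE R)).
move=> _ [_ [a [b ->] <-]]; rewrite setTI; apply: open_measurable2.
exact/cF/interval_open.
Qed.

Lemma box_measure p r : 0 < r -> mu2 (box p r) = (4 * r ^+ 2)%:E.
Proof.
move=> r0; rewrite boxE product_measure1E//=.
rewrite !lebesgue_measure_itv /= !lte_fin.
have h (x : R) : x - r < x + r by rewrite ltrD2l gtrN.
rewrite !h -!EFinB -EFinM; congr EFin; ring.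
Qed.

Variables (Omega : set (R * R)) (N : R).
Hypothesis oO : open Omega.
Hypothesis bO : Omega `<=` box 0 N.

Let mO : measurable Omega. Proof. exact: open_measurable2. Qed.

Lemma area_fin : (mu2 Omega < +oo)%E.
Proof.
have [N0|N0] := ltP 0 N.
  apply: (@le_lt_trans _ _ (mu2 (box 0 N))).
    by apply: le_measure => //; rewrite ?inE//; exact: box_measurable.
  by rewrite box_measure// ltry.
have -> : Omega = set0; last by rewrite measure0.
apply/seteqP; split=> // w /bO [+ _] => /(le_lt_trans (normr_ge0 _)).
by rewrite ltNge N0.
Qed.

Lemma area_bound (F : R * R -> R) : continuous F ->
  exists2 C, 0 <= C & forall w, Omega w -> `|F w| <= C.
Proof.
move=> /(@cont_box_bound _ _ N)[C C0 HC]; exists C => // w /bO [w1 w2].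
by apply: HC; apply: ltW; [move: w1|move: w2]; rewrite subr0.
Qed.

Lemma area_integrable (F : R * R -> R) : continuous F ->
  mu2.-integrable Omega (EFin \o F).
Proof.
move=> cF; apply: measurable_bounded_integrable => //; first exact: area_fin.
  by apply: measurable_funTS; exact: cont2_measurable.
have [C C0 HC] := area_bound cF.
exists C; split; first exact: ger0_real.
by move=> M CM w Ow; apply: (le_trans (HC w Ow)); exact: ltW.
Qed.

Lemma areaD (F G : R * R -> R) : continuous F -> continuous G ->
  area_integral Omega (fun w => F w + G w) = area_integral Omega F + area_integral Omega G.
Proof.
by move=> cF cG; rewrite /area_integral RintegralD//; exact: area_integrable.
Qed.

Lemma areaZ (F : R * R -> R) r : continuous F ->
  area_integral Omega (fun w => r * F w) = r * area_integral Omega F.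
Proof.
by move=> cF; rewrite /area_integral RintegralZl//; exact: area_integrable.
Qed.

Lemma eq_area (F G : R * R -> R) : (forall w, Omega w -> F w = G w) ->
  area_integral Omega F = area_integral Omega G.
Proof. by move=> FG; apply: eq_Rintegral => w /[1!inE]; exact: FG. Qed.

Lemma area_gt0 (F : R * R -> R) p : continuous F -> (forall w, Omega w -> 0 <= F w) ->
  Omega p -> 0 < F p -> 0 < area_integral Omega F.
Proof.
move=> cF F0 Op Fp.
have Fp2 : 0 < F p / 2 by rewrite divr_gt0.
have oU : open [set w | Omega w /\ F p / 2 < F w].
  apply: openI => //; have /continuousP := cF => /(_ `]F p / 2, +oo[).
  rewrite preimage_itvoy; apply; exact: interval_open.
have [|r r0 rU] := open_box oU (_ : _ p).
  by split => //=; rewrite ltr_pdivrMr// ltr_pMr// ltr1n.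
have bm := box_measurable p r.
have : ((F p / 2)%:E * mu2 (box p r) <= \int[mu2]_(w in Omega) (F w)%:E)%E.
  rewrite -integral_cst//.
  apply: (@le_trans _ _ (\int[mu2]_(w in box p r) (F w)%:E)%E).
    apply: ge0_le_integral => //.
    - by move=> w _; rewrite lee_fin ltW.
    - by apply/measurable_EFinP; apply: measurable_funTS; exact: cont2_measurable.
    - by move=> w /rU[_ /= /ltW]; rewrite lee_fin.
  apply: ge0_subset_integral => //.
  - by apply/measurable_EFinP; apply: measurable_funTS; exact: cont2_measurable.
  - by move=> w /rU[].
rewrite box_measure// -EFinM /area_integral /Rintegral.
have /integral_fune_fin_num : mu2.-integrable Omega (EFin \o F) by exact: area_integrable.
move=> /(_ mO) /fineK <-; rewrite lee_fin /=; apply: lt_le_trans.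
by rewrite !mulr_gt0// exprn_gt0.
Qed.

Lemma is_derive_area (h h1 : R -> R * R -> R) (C a b x : R) : a < x < b ->
  (forall t, continuous (h t)) ->
  (forall t w, Omega w -> is_derive t (1 : R) (h ^~ w) (h1 t w)) ->
  (forall t w, a < t < b -> Omega w -> `|h1 t w| <= C) ->
  is_derive x (1 : R) (fun t => area_integral Omega (h t)) (area_integral Omega (h1 x)).
Proof.
move=> axb ch dh Ch; exact: (@is_derive_integral R _ _ mu2 h h1 Omega C a b x mO area_fin axb
  (fun t => area_integrable (ch t)) dh Ch).
Qed.

Variable F : R * R -> R.
Hypothesis cF : continuous F.

(* Extension by zero, as product integrals are iterated over whole lines. *)
Let f := F \_ Omega.

Let mf : measurable_fun setT f.
Proof.
apply/(measurable_restrictT F) => //.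
by apply: measurable_funTS; exact: cont2_measurable.
Qed.

Let f_int : mu2.-integrable setT (EFin \o f).
Proof.
rewrite /f -restrict_EFin; apply/integrable_restrict => //.
by rewrite setTI; exact: area_integrable.
Qed.

Let f_bound : exists2 C, 0 <= C & forall w, `|f w| <= C.
Proof.
have [C C0 HC] := area_bound cF; exists C => // w; rewrite /f patchE.
by case: ifPn => [/[1!inE]/HC//|_]; rewrite normr0.
Qed.

Let f_supp w : N <= `|w.1| \/ N <= `|w.2| -> f w = 0.
Proof.
move=> H; rewrite /f patchE; case: ifPn => // /[1!inE] /bO [/=].
by rewrite !subr0 !ltNge; case: H => ->.
Qed.

Let slice_int (g : R -> R) : measurable_fun setT g ->
  (exists2 C, 0 <= C & forall x, `|g x| <= C) -> (forall x, N <= `|x| -> g x = 0) ->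
  mu.-integrable setT (EFin \o g).
Proof.
move=> mg [C C0 HC] gN.
have -> : g = g \_ (`[- N, N]).
  apply/funext => x; rewrite patchE; case: ifPn => //.
  rewrite notin_setE /= in_itv /= -ler_norml => /negP; rewrite -ltNge => /ltW; exact: gN.
rewrite -restrict_EFin; apply/integrable_restrict => //.
rewrite setTI; apply: measurable_bounded_integrable => //.
- rewrite /= lebesgue_measure_itv /= lte_fin; case: ifPn => _; exact: ltry.
- exact: measurable_funTS.
- exists C; split; first exact: ger0_real.
  by move=> M CM x _; apply: (le_trans (HC x)); exact: ltW.
Qed.

Let slice1 x : mu.-integrable setT (EFin \o (fun z => f (x, z))).
Proof.
apply: slice_int.
- exact: (measurableT_comp mf (measurable_pair1 x)).
- by have [C C0 HC] := f_bound; exists C.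
- by move=> z Nz; apply: f_supp; right.
Qed.

Let slice2 z : mu.-integrable setT (EFin \o (fun x => f (x, z))).
Proof.
apply: slice_int.
- exact: (measurableT_comp mf (measurable_pair2 z)).
- by have [C C0 HC] := f_bound; exists C.
- by move=> x Nx; apply: f_supp; left.
Qed.

Lemma area_fubini_xz :
  area_integral Omega F = \int[mu]_x \int[mu]_z (F \_ Omega) (x, z).
Proof.
rewrite /area_integral Rintegral_mkcond -/f /Rintegral -integral12_prod_meas1//.
congr fine; apply: eq_integral => x _; rewrite /fubini_F fineK//.
by apply: integral_fune_fin_num => //; exact: slice1.
Qed.

Lemma area_fubini_zx :
  area_integral Omega F = \int[mu]_z \int[mu]_x (F \_ Omega) (x, z).
Proof.
rewrite /area_integral Rintegral_mkcond -/f /Rintegral -integral21_prod_meas1//.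
congr fine; apply: eq_integral => z _; rewrite /fubini_G fineK//.
by apply: integral_fune_fin_num => //; exact: slice2.
Qed.

End PlaneMeasure.

(** * One-sided graph charts at boundary points *)

Section Chart.
Context {R : realType}.

Lemma cont_delta (f : R -> R) t0 e : continuous f -> 0 < e ->
  exists2 d, 0 < d & forall t, `|t - t0| <= d -> `|f t - f t0| < e.
Proof.
move=> cf e0; have /cvgrPdist_lt/(_ _ e0)/nbhs_ballP[d /= d0 H] := cf t0.
exists (d / 2); first by rewrite divr_gt0.
move=> t td; rewrite distrC; apply: H; rewrite /ball /= distrC.
by apply: (le_lt_trans td); rewrite ltr_pdivrMr// ltr_pMr// ltr1n.
Qed.

Lemma not_between (tau a b y : R) : tau = 1 \/ tau = -1 -> 0 < tau * (a - y) ->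
  0 < tau * (b - y) -> Num.min a b <= y <= Num.max a b -> False.
Proof.
rewrite ge_min le_max => -[] -> pa pb /andP[/orP[?|?] /orP[?|?]]; lra.
Qed.

Lemma between_dist (a b y p r : R) : `|a - p| < r -> `|b - p| < r ->
  Num.min a b <= y <= Num.max a b -> `|y - p| < r.
Proof.
rewrite ge_min le_max !ltr_distl => /andP[? ?] /andP[? ?] /andP[y1 y2].
by apply/andP; split; case/orP: y1 => ?; case/orP: y2 => ?; lra.
Qed.

Lemma between_scaled (sg a b y l u : R) : sg = 1 \/ sg = -1 ->
  l <= sg * a <= u -> l <= sg * b <= u ->
  Num.min a b <= y <= Num.max a b -> l <= sg * y <= u.
Proof.
rewrite ge_min le_max => -[] -> /andP[? ?] /andP[? ?] /andP[/orP[?|?] /orP[?|?]];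
  apply/andP; split; lra.
Qed.

Lemma dist_ends (t0 d da : R) : 0 < d -> d <= da ->
  [/\ `|t0 - d - t0| <= da, `|t0 + d - t0| <= da & `|t0 - t0| <= da].
Proof. by move=> ? ?; rewrite !ler_distl; split; apply/andP; split; lra. Qed.

(** No order is fixed between a and b, because the points compared below may lie on
    either side of t0. *)
Lemma mvt_sym (f df : R -> R) (a b d t0 : R) : (forall t, is_derive t (1 : R) f (df t)) ->
  `|a - t0| <= d -> `|b - t0| <= d ->
  exists2 x, `|x - t0| <= d & f b - f a = df x * (b - a).
Proof.
move=> dF; wlog ab : a b / a <= b => [wl ha hb|ha hb].
  have [ab|/ltW ba] := leP a b; first exact: wl.
  have [x hx e] := wl _ _ ba hb ha; exists x => //.
  by rewrite -(opprB (f a)) e; ring.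
have [x xab e] := MVT_segment ab (fun x _ => dF x) (cont_within (is_derive_cont dF)).
exists x => //; move: xab ha hb; rewrite in_itv /= !ler_distl => /andP[? ?] /andP[? ?] /andP[? ?].
by apply/andP; split; lra.
Qed.

(** The sign sg lets one statement serve curves that run in either direction along
    the axis. *)
Lemma ivt_sym (f df : R -> R) (sg t0 d x : R) : 0 < d ->
  (forall t, is_derive t (1 : R) f (df t)) ->
  sg * f (t0 - d) <= sg * x <= sg * f (t0 + d) -> sg != 0 ->
  exists2 t, `|t - t0| <= d & f t = x.
Proof.
move=> d0 dF h sg0.
have ab : t0 - d <= t0 + d by lra.
have [|t /[!in_itv]/= tab ft] := IVT ab (cont_within (is_derive_cont dF)) (v := x).
  have [sp|sn] : 0 < sg \/ sg < 0 by case: (ltgtP sg 0) sg0 => // ? _; [right|left].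
    move: h; rewrite !(ler_pM2l sp) => /andP[h1 h2].
    by rewrite ge_min h1 le_max h2 orbT.
  move: h; rewrite !(ler_nM2l sn) => /andP[h1 h2].
  by rewrite ge_min h2 orbT le_max h1.
by exists t => //; rewrite ler_distl.
Qed.

(** Off the boundary, Omega and its closure cut out the same part of A, which is
    therefore both open and closed in A. *)
Lemma connected_sub (Omega A : set (R * R)) : open Omega -> connected A ->
  (forall w, A w -> ~ (closure Omega `\` Omega) w) -> (A `&` Omega) !=set0 -> A `<=` Omega.
Proof.
move=> oO cA AB A0.
suff -> : A = A `&` Omega by exact: subIsetr.
apply/esym; apply: cA A0 _ _; first by exists Omega.
exists (closure Omega); first exact: closed_closure.
apply/seteqP; split=> w [Aw Ow]; first by split => //; exact: subset_closure.
split=> //; apply: contrapT => nO; exact: (AB w Aw).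
Qed.

Lemma vseg_connected (x a b : R) : connected [set w : R * R | w.1 = x /\ a <= w.2 <= b].
Proof.
have -> : [set w : R * R | w.1 = x /\ a <= w.2 <= b] = (fun z => (x, z)) @` `[a, b].
  apply/seteqP; split=> [[y z] /= [-> h]|w [z /=]].
    by exists z => //=; rewrite in_itv.
  by rewrite in_itv /= => h <-.
apply: connected_continuous_connected; first exact: segment_connected.
apply: continuous_subspaceT.
exact: (Ck_pair (Ck_cst R 0 x) (Ck_id R 0)).
Qed.

Lemma hseg_connected (z a b : R) : connected [set w : R * R | w.2 = z /\ a <= w.1 <= b].
Proof.
have -> : [set w : R * R | w.2 = z /\ a <= w.1 <= b] = (fun x => (x, z)) @` `[a, b].
  apply/seteqP; split=> [[x y] /= [-> h]|w [x /=]].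
    by exists x => //=; rewrite in_itv.
  by rewrite in_itv /= => h <-.
apply: connected_continuous_connected; first exact: segment_connected.
apply: continuous_subspaceT.
exact: (Ck_pair (Ck_id R 0) (Ck_cst R 0 z)).
Qed.

Variables (Omega : set (R * R)) (g1 g2 d1 d2 : R -> R) (t0 : R).
Hypothesis oO : open Omega.
Hypothesis dg1 : forall t, is_derive t (1 : R) g1 (d1 t).
Hypothesis dg2 : forall t, is_derive t (1 : R) g2 (d2 t).
Hypothesis cd1 : continuous d1.
Hypothesis cd2 : continuous d2.
Let p : R * R := (g1 t0, g2 t0).
Hypothesis isol : forall d, 0 < d -> exists2 r, 0 < r &
  forall w, box p r w -> (closure Omega `\` Omega) w ->
    exists2 t, `|t - t0| < d & w = (g1 t, g2 t).
Hypothesis side : exists2 e, 0 < e & forall h, 0 < h < e ->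
  Omega (g1 t0 - h * d2 t0, g2 t0 + h * d1 t0) /\
  ~ Omega (g1 t0 + h * d2 t0, g2 t0 - h * d1 t0).
Hypothesis onB : forall t, (closure Omega `\` Omega) (g1 t, g2 t).
Hypothesis d10 : d1 t0 != 0.

Let seg_v x a b : (forall z, a <= z <= b -> ~ (closure Omega `\` Omega) (x, z)) ->
  forall z z', a <= z <= b -> a <= z' <= b -> Omega (x, z) -> Omega (x, z').
Proof.
move=> H z z' hz hz' Oz.
apply: (connected_sub oO (@vseg_connected x a b)) => // [[y u] /= [-> hu]|].
  exact: H.
by exists (x, z).
Qed.

Let seg_h z a b : (forall x, a <= x <= b -> ~ (closure Omega `\` Omega) (x, z)) ->
  forall x x', a <= x <= b -> a <= x' <= b -> Omega (x, z) -> Omega (x', z).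
Proof.
move=> H x x' hx hx' Ox.
apply: (connected_sub oO (@hseg_connected z a b)) => // [[y u] /= [-> hu]|].
  exact: H.
by exists (x, z).
Qed.

(** Where the curve is not vertical, its first coordinate is strictly monotone near
    t0, so the boundary inside a small box is a graph over the x-axis. The part of
    the box above the graph is connected by segments that avoid the boundary, and so
    is the part below; each lies entirely in Omega or entirely outside. The
    behaviour of Omega on the normal at t0 decides which is which: Omega is on the
    left of the curve, hence above the graph when the curve runs to the right (sg =
    1) and below it otherwise. *)
Lemma graph_chart : exists sg d rho, [/\ sg = 1 \/ sg = -1, 0 < d & 0 < rho] /\
  [/\ forall t, `|t - t0| <= d -> 0 < sg * d1 t,
      forall t, `|t - t0| <= d -> `|g2 t - g2 t0| < rho
    & forall t z, `|t - t0| <= d -> `|z - g2 t0| < rho ->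
        Omega (g1 t, z) <-> 0 < sg * (z - g2 t)].
Proof.
have [sg sg1 sgd] : exists2 sg : R, sg = 1 \/ sg = -1 & 0 < sg * d1 t0.
  case: (ltgtP (d1 t0) 0) d10 => // h _.
    by exists (-1); [right|rewrite mulN1r oppr_gt0].
  by exists 1; [left|rewrite mul1r].
have sg0 : sg != 0 by case: sg1 => ->; rewrite ?oppr_eq0 oner_neq0.
have sgsg : sg * sg = 1 by case: sg1 => ->; ring.
(* Even with its components taken at two different parameters, as the mean value
   theorem will do, the tangent has a positive product with the tangent at t0. *)
have [da da0 Ha] : exists2 d, 0 < d & forall t t', `|t - t0| <= d -> `|t' - t0| <= d ->
    0 < sg * d1 t /\ 0 < d1 t0 * d1 t + d2 t0 * d2 t'.
  have D1 : 0 < d1 t0 ^+ 2 by rewrite exprn_even_gt0.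
  pose e := d1 t0 ^+ 2 / (`|d1 t0| + `|d2 t0| + 1) / 2.
  have S0 : 0 < `|d1 t0| + `|d2 t0| + 1 by rewrite ltr_wpDl ?addr_ge0.
  have e0 : 0 < e by rewrite !divr_gt0.
  have [u1 u10 hu1] := cont_delta t0 cd1 e0; have [u2 u20 hu2] := cont_delta t0 cd2 e0.
  exists (Num.min u1 u2); first by rewrite lt_min u10.
  move=> t t'; rewrite !le_min => /andP[/hu1 t1 _] /andP[_ /hu2 t2].
  have eS : e * (`|d1 t0| + `|d2 t0| + 1) = d1 t0 ^+ 2 / 2.
    rewrite /e mulrAC mulfVK//; exact: lt0r_neq0.
  have k1 : `|d1 t0 * (d1 t - d1 t0)| <= `|d1 t0| * e by rewrite normrM ler_wpM2l// ltW.
  have k2 : `|d2 t0 * (d2 t' - d2 t0)| <= `|d2 t0| * e by rewrite normrM ler_wpM2l// ltW.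
  have eh : (`|d1 t0| + `|d2 t0|) * e <= d1 t0 ^+ 2 / 2.
    by rewrite -eS mulrC ler_pM2l// lerDl.
  have P1 : 0 < d1 t0 * d1 t + d2 t0 * d2 t'.
    have := lerNnormlW k1; have := lerNnormlW k2.
    have := sqr_ge0 (d2 t0); move: eh D1; rewrite mulrDl.
    have -> : d1 t0 * d1 t + d2 t0 * d2 t' = d1 t0 ^+ 2 + d2 t0 ^+ 2 +
      d1 t0 * (d1 t - d1 t0) + d2 t0 * (d2 t' - d2 t0) by ring.
    lra.
  split=> //.
  have P2 : 0 < d1 t0 * d1 t.
    have := lerNnormlW k1; have : 0 <= `|d2 t0| * e by rewrite mulr_ge0// ltW.
    move: eh D1; rewrite mulrDl.
    have -> : d1 t0 * d1 t = d1 t0 ^+ 2 + d1 t0 * (d1 t - d1 t0) by ring.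
    lra.
  have : 0 < (sg * d1 t0) * (sg * d1 t).
    by rewrite mulrACA sgsg mul1r.
  by rewrite pmulr_rgt0.
have mono t t' : `|t - t0| <= da -> `|t' - t0| <= da -> t < t' -> sg * g1 t < sg * g1 t'.
  move=> ht ht' tt'; have [x hx e] := mvt_sym dg1 ht ht'.
  rewrite -subr_gt0 -mulrBr e mulrA mulr_gt0 ?subr_gt0//.
  by have [] := Ha x x hx hx.
have inj t t' : `|t - t0| <= da -> `|t' - t0| <= da -> g1 t = g1 t' -> t = t'.
  move=> ht ht' e; case: (ltgtP t t') => // h.
    by have := mono _ _ ht ht' h; rewrite e ltxx.
  by have := mono _ _ ht' ht h; rewrite e ltxx.
have [r r0 Hr] := isol da0.
have r2 : 0 < r / 2 by rewrite divr_gt0.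
have [u1 u10 hu1] := cont_delta t0 (is_derive_cont dg1) r2.
have [u2 u20 hu2] := cont_delta t0 (is_derive_cont dg2) r2.
pose d := Num.min da (Num.min u1 u2).
have d0 : 0 < d by rewrite !lt_min da0 u10.
have dP t : `|t - t0| <= d ->
    [/\ `|t - t0| <= da, `|g1 t - g1 t0| < r / 2 & `|g2 t - g2 t0| < r / 2].
  by rewrite !le_min => /and3P[h1 h2 h3]; split => //; [exact: hu1|exact: hu2].
have r2r : r / 2 < r by lra.
(* Inside the box, the boundary meets the vertical line through a point of the arc
   only at that point. *)
have bd t z : `|t - t0| <= d -> `|z - g2 t0| < r ->
    (closure Omega `\` Omega) (g1 t, z) -> z = g2 t.
  move=> /dP[ta t1 t2] zr B.
  have [|t' t'd [e1 ->]] := Hr _ _ B; first by split => //=; exact: lt_trans r2r.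
  by rewrite (inj _ _ ta (ltW t'd) e1).
have hda : d <= da by rewrite /d ge_min lexx.
have [e1 e2 e3] := dist_ends t0 d0 hda.
have m1 v : `|v - t0| <= d -> sg * g1 (t0 - d) <= sg * g1 v <= sg * g1 (t0 + d).
  move=> hv; have [hva _ _] := dP v hv.
  move: hv; rewrite ler_distl => /andP[hv1 hv2]; apply/andP; split.
    move: hv1; rewrite le_eqVlt => /predU1P[->//|h1]; apply/ltW; exact: mono.
  move: hv2; rewrite le_eqVlt => /predU1P[->//|h1]; apply/ltW; exact: mono.
(* Two points on the same side tau of the graph are joined by a vertical, a
   horizontal and a vertical segment. The horizontal one is at height zs, inside the
   box but beyond the arc, which stays within r / 2 of g2 t0. *)
have up (tau : R) t z t' z' : tau = 1 \/ tau = -1 ->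
    `|t - t0| <= d -> `|t' - t0| <= d -> `|z - g2 t0| < r -> `|z' - g2 t0| < r ->
    0 < tau * (z - g2 t) -> 0 < tau * (z' - g2 t') -> Omega (g1 t, z) -> Omega (g1 t', z').
  move=> tau1 ht ht' hz hz' pz pz' O1.
  pose zs := g2 t0 + tau * (r * 3 / 4).
  have hs u : `|u - t0| <= d -> 0 < tau * (zs - g2 u).
    move=> /dP[_ _]; rewrite ltr_distl => /andP[h1 h2].
    by rewrite /zs; case: tau1 => ->; lra.
  have zsr : `|zs - g2 t0| < r.
    by rewrite /zs ltr_distl; case: tau1 => ->; apply/andP; split; lra.
  have vm u a b : `|u - t0| <= d -> `|a - g2 t0| < r -> `|b - g2 t0| < r ->
      0 < tau * (a - g2 u) -> 0 < tau * (b - g2 u) -> Omega (g1 u, a) -> Omega (g1 u, b).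
    move=> hu ha hb pa pb.
    apply: (@seg_v (g1 u) (Num.min a b) (Num.max a b)).
    - move=> y yab /(bd _ _ hu (between_dist ha hb yab)) e.
      by move: yab; rewrite e; exact: not_between tau1 pa pb.
    - by rewrite ge_min lexx le_max lexx.
    - by rewrite ge_min lexx orbT le_max lexx orbT.
  have O2 := vm _ _ _ ht hz zsr pz (hs _ ht) O1.
  suff O3 : Omega (g1 t', zs) by exact: (vm _ _ _ ht' zsr hz' (hs _ ht') pz' O3).
  apply: (@seg_h zs (Num.min (g1 t) (g1 t')) (Num.max (g1 t) (g1 t'))) O2.
  - move=> x xtt.
    have [|u hu <-] := @ivt_sym g1 d1 sg t0 d x d0 dg1 _ sg0.
      exact: (between_scaled sg1 (m1 t ht) (m1 t' ht') xtt).
    move=> /(bd _ _ hu zsr) e; have := hs u hu; rewrite e subrr mulr0 ltxx //.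
  - by rewrite ge_min lexx le_max lexx.
  - by rewrite ge_min lexx orbT le_max lexx orbT.
(* A small step h along (- d2 t0, d1 t0) leads above or below the graph according to
   the sign of h * sg. *)
have nrm : exists2 e, 0 < e & forall h, `|h| < e -> h != 0 ->
    exists2 t, `|t - t0| <= d & [/\ g1 t = g1 t0 - h * d2 t0,
      `|g2 t0 + h * d1 t0 - g2 t0| < r & 0 < (h * sg) * (g2 t0 + h * d1 t0 - g2 t)].
  have n1 : 0 < sg * g1 t0 - sg * g1 (t0 - d) by rewrite subr_gt0 mono// gtrBl.
  have n2 : 0 < sg * g1 (t0 + d) - sg * g1 t0 by rewrite subr_gt0 mono// ltrDl.
  pose m := Num.min (Num.min (sg * g1 t0 - sg * g1 (t0 - d)) (sg * g1 (t0 + d) - sg * g1 t0)) r.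
  have m0 : 0 < m by rewrite !lt_min n1 n2.
  have S0 : 0 < `|d1 t0| + `|d2 t0| + 1 by rewrite ltr_wpDl ?addr_ge0.
  exists (m / (`|d1 t0| + `|d2 t0| + 1)); first by rewrite divr_gt0.
  move=> h; rewrite ltr_pdivlMr// => hm h0.
  have hd1 : `|h * d1 t0| < m.
    rewrite normrM; apply: le_lt_trans hm; rewrite ler_wpM2l//.
    have := normr_ge0 (d2 t0); lra.
  have hd2 : `|h * d2 t0| < m.
    rewrite normrM; apply: le_lt_trans hm; rewrite ler_wpM2l//.
    have := normr_ge0 (d1 t0); lra.
  have sh : `|sg * (h * d2 t0)| < m.
    by rewrite normrM; case: sg1 => ->; rewrite ?normrN normr1 mul1r.
  have [|t ht e] := @ivt_sym g1 d1 sg t0 d (g1 t0 - h * d2 t0) d0 dg1 _ sg0.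
    move: sh; rewrite !lt_min => /andP[/andP[]].
    rewrite !ltr_norml mulrBr => /andP[? ?] /andP[? ?] _.
    by apply/andP; split; lra.
  exists t => //; split => //.
    by rewrite addrAC subrr add0r; move: hd1; rewrite !lt_min => /andP[].
  have [ta _ _] := dP t ht.
  have [x hx ex] := mvt_sym dg1 e3 ta.
  have [y hy ey] := mvt_sym dg2 e3 ta.
  have [sx P] := Ha x y hx hy.
  have k1 : d1 x * (t - t0) = - (h * d2 t0) by rewrite -ex e; ring.
  have k2 : g2 t = g2 t0 + d2 y * (t - t0) by rewrite -ey; ring.
  have : 0 < h ^+ 2 * (d1 t0 * d1 x + d2 t0 * d2 y) by rewrite mulr_gt0// exprn_even_gt0.
  have -> : h ^+ 2 * (d1 t0 * d1 x + d2 t0 * d2 y) =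
      (sg * d1 x) * (h * sg * (g2 t0 + h * d1 t0 - g2 t)) + (1 - sg * sg) *
        (d1 x * h * (g2 t0 + h * d1 t0 - g2 t)).
    rewrite sgsg subrr mul0r addr0 k2.
    have -> : sg * d1 x * (h * sg * (g2 t0 + h * d1 t0 - (g2 t0 + d2 y * (t - t0)))) =
      (sg * sg) * (h ^+ 2 * (d1 t0 * d1 x) - h * d2 y * (d1 x * (t - t0))) by ring.
    rewrite sgsg k1; ring.
  by rewrite sgsg subrr mul0r addr0 (pmulr_rgt0 _ sx).
have [ea ea0 He1] := nrm; have [eb eb0 He2] := side.
pose h := Num.min ea eb / 2.
have me : 0 < Num.min ea eb by rewrite lt_min ea0.
have h0 : 0 < h by rewrite divr_gt0.
have hm : h < Num.min ea eb by rewrite ltr_pdivrMr// ltr_pMr// ltr1n.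
have [h1 h2] : h < ea /\ h < eb by move: hm; rewrite lt_min => /andP[].
have [|t ht [et rt pt]] := He1 h _ (lt0r_neq0 h0); first by rewrite gtr0_norm.
have [||t' ht' [et' rt' pt']] := He1 (- h); first by rewrite normrN gtr0_norm.
  by rewrite oppr_eq0 lt0r_neq0.
have [|Oin Oout] := He2 h; first by rewrite h0.
exists sg, d, r; split=> //; split.
- by move=> u /dP[ua _ _]; have [] := Ha u u ua ua.
- by move=> u /dP[_ _ ur]; exact: lt_trans r2r.
have sgN : - sg = 1 \/ - sg = -1 by case: sg1 => ->; [right|left; rewrite opprK].
move=> u z hu hz; split=> [Ou|pz].
  rewrite ltNge; apply/negP => le0.
  have zn : sg * (z - g2 u) != 0.
    rewrite mulf_neq0// subr_eq0; apply/eqP => zE.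
    by have [_] := onB u; rewrite -zE.
  have pz : 0 < - sg * (z - g2 u) by rewrite mulNr oppr_gt0 lt_neqAle zn.
  apply: Oout.
  have -> : g1 t0 + h * d2 t0 = g1 t' by rewrite et'; ring.
  have -> : g2 t0 - h * d1 t0 = g2 t0 + - h * d1 t0 by ring.
  apply: (up (- sg) u z t' _ sgN hu ht' hz rt' pz _ Ou).
  by move: pt'; rewrite mulNr -mulrN -mulrA pmulr_rgt0.
apply: (up sg t _ u z sg1 ht hu rt hz _ pz).
  by move: pt; rewrite -mulrA pmulr_rgt0.
by rewrite et.
Qed.
End Chart.

(** * Green's formula for functions supported near a boundary point *)

Section Support.
Context {R : realType}.

Definition supported (F : R * R -> R) p r := forall w, ~ box p r w -> F w = 0.

Lemma supported_le F p r r' : r <= r' -> supported F p r -> supported F p r'.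
Proof.
move=> rr' sF w nw; apply: sF => -[h1 h2]; apply: nw.
by split; exact: lt_le_trans rr'.
Qed.

(** The derivative is known to vanish only where F vanishes on a whole
    neighbourhood, which costs an enlargement of the box. *)
Lemma supported_derive (F : R * R -> R) p r r' v : r < r' -> supported F p r ->
  supported ('D_v F) p r'.
Proof.
move=> rr' sF w nw.
rewrite (@near_eq_derive _ _ _ F (fun=> 0)) ?derive_cst//.
have oC : open (~` [set w : R * R | `|w.1 - p.1| <= r /\ `|w.2 - p.2| <= r]).
  apply: closed_openC.
  have -> : [set w : R * R | `|w.1 - p.1| <= r /\ `|w.2 - p.2| <= r] =
      fst @^-1` `[p.1 - r, p.1 + r] `&` snd @^-1` `[p.2 - r, p.2 + r].
    by apply/seteqP; split=> u /=; rewrite !in_itv /= !ler_distl.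
  apply: closedI.
    apply: (@preimage_closed _ _ (fst : R * R -> R)); last exact: interval_closed.
    by move=> u _; exact: cvg_fst.
  apply: (@preimage_closed _ _ (snd : R * R -> R)); last exact: interval_closed.
  by move=> u _; exact: cvg_snd.
have wC : (~` [set w : R * R | `|w.1 - p.1| <= r /\ `|w.2 - p.2| <= r]) w.
  by move=> [h1 h2]; apply: nw; split; exact: le_lt_trans rr'.
have := open_nbhs_nbhs (conj oC wC); apply: filterS => u nu.
by apply: sF => -[h1 h2]; apply: nu; split; exact: ltW.
Qed.

End Support.

Section ParamIntegral.
Context {R : realType}.
Notation mu := (@lebesgue_measure R).

Lemma cont_slice (H : R * R -> R) t : continuous H -> continuous (fun z => H (t, z)).
Proof.
move=> cH z; have c1 := Ck_pair (Ck_cst R 0 t) (Ck_id R 0).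
by apply: (continuous_comp (c1 z)); exact: cH.
Qed.

Lemma cont_slice2 (H : R * R -> R) z : continuous H -> continuous (fun t => H (t, z)).
Proof.
move=> cH t; have c1 := Ck_pair (Ck_id R 0) (Ck_cst R 0 z).
by apply: (continuous_comp (c1 t)); exact: cH.
Qed.

Lemma param_bound (H : R * R -> R) (M t : R) : continuous H ->
  exists C, forall t' z, t - 1 < t' < t + 1 -> `[0, M]%classic z -> `|H (t', z)| <= C.
Proof.
move=> cH; have [C C0 HC] := cont_box_bound (`|t| + 1 + `|M|) cH.
exists C => t' z /andP[h1 h2]; rewrite /= in_itv /= => /andP[z0 zM]; apply: HC => /=.
  apply: (@le_trans _ _ (`|t| + 1)); last by rewrite lerDl.
  rewrite ler_norml; have := ler_norm t; have := lerNnormlW (lexx `|t|).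
  by move=> ? ?; apply/andP; split; lra.
rewrite ger0_norm//; apply: (le_trans zM); apply: (le_trans (ler_norm _)).
by rewrite lerDr addr_ge0.
Qed.

Lemma param_cont (H : R * R -> R) (M : R) : continuous H ->
  continuous (fun t => \int[mu]_(z in `[0, M]) H (t, z)).
Proof.
move=> cH t; have [C HC] := param_bound M t cH.
apply: (@continuity_under_integral R _ _ mu (fun t z => H (t, z)) `[0, M]%classic
  _ (t - 1) (t + 1) _ _ (fun=> C)) => //.
- by move=> x _; apply: itv_integrable; exact: cont_slice.
- by apply: aeW => y _ x _; exact: cont_slice2.
- by apply: (@itv_integrable _ (fun=> C)) => x; exact: cvg_cst.
- move=> x /=; rewrite in_itv /= => Ix; apply: aeW => y Iy; exact: HC.
- by rewrite inE /= in_itv /=; apply/andP; split; lra.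
Qed.

Lemma param_derive (H H1 : R * R -> R) (M t : R) : continuous H -> continuous H1 ->
  (forall t z, is_derive t (1 : R) (fun t => H (t, z)) (H1 (t, z))) ->
  is_derive t (1 : R) (fun t => \int[mu]_(z in `[0, M]) H (t, z))
    (\int[mu]_(z in `[0, M]) H1 (t, z)).
Proof.
move=> cH cH1 dH; have [C HC] := param_bound M t cH1.
apply: (@is_derive_integral R _ _ mu (fun t z => H (t, z)) (fun t z => H1 (t, z))
  `[0, M]%classic C (t - 1) (t + 1) t) => //.
- rewrite /= lebesgue_measure_itv /= lte_fin; case: ifPn => _; rewrite ?ltry//.
- by apply/andP; split; lra.
- by move=> x; apply: itv_integrable; exact: cont_slice.
Qed.

End ParamIntegral.

Section LocalGreen.
Context {R : realType}.
Notation mu := (@lebesgue_measure R).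

Variables (Omega : set (R * R)) (N : R) (g1 g2 d1 d2 : R -> R) (t0 sg d rho : R).
Hypothesis oO : open Omega.
Hypothesis bO : Omega `<=` box 0 N.
Hypothesis dg1 : forall t, is_derive t (1 : R) g1 (d1 t).
Hypothesis dg2 : forall t, is_derive t (1 : R) g2 (d2 t).
Hypothesis cd1 : continuous d1.
Hypothesis cd2 : continuous d2.
Hypothesis sg1 : sg = 1 \/ sg = -1.
Hypothesis d0 : 0 < d.
Hypothesis rho0 : 0 < rho.
Hypothesis sgd : forall t, `|t - t0| <= d -> 0 < sg * d1 t.
Hypothesis g2rho : forall t, `|t - t0| <= d -> `|g2 t - g2 t0| < rho.
Hypothesis OE : forall t z, `|t - t0| <= d -> `|z - g2 t0| < rho ->
  Omega (g1 t, z) <-> 0 < sg * (z - g2 t).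

Let cg1 : continuous g1 := is_derive_cont dg1.
Let cg2 : continuous g2 := is_derive_cont dg2.
Let p : R * R := (g1 t0, g2 t0).

Let sg0 : sg != 0. Proof. by case: sg1 => ->; rewrite ?oppr_eq0 oner_neq0. Qed.
Let sgsg : sg * sg = 1. Proof. by case: sg1 => ->; ring. Qed.

Let mono t t' : `|t - t0| <= d -> `|t' - t0| <= d -> t < t' -> sg * g1 t < sg * g1 t'.
Proof.
move=> ht ht' tt'; have [x hx e] := mvt_sym dg1 ht ht'.
by rewrite -subr_gt0 -mulrBr e mulrA mulr_gt0 ?subr_gt0// sgd.
Qed.

Let ends : [/\ `|t0 - d - t0| <= d, `|t0 + d - t0| <= d & `|t0 - t0| <= d].
Proof. exact: dist_ends. Qed.

(** The arc crosses a box of this radius over its whole width, so a function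
    supported in the box vanishes at the ends of the arc and on the vertical lines
    through them. *)
Lemma graph_radius : exists2 r, 0 < r & r <= rho /\
  forall x, `|x - g1 t0| <= r -> sg * g1 (t0 - d) < sg * x < sg * g1 (t0 + d).
Proof.
have [e1 e2 e3] := ends.
have n1 : 0 < sg * g1 t0 - sg * g1 (t0 - d) by rewrite subr_gt0 mono// gtrBl.
have n2 : 0 < sg * g1 (t0 + d) - sg * g1 t0 by rewrite subr_gt0 mono// ltrDl.
pose m := Num.min (Num.min (sg * g1 t0 - sg * g1 (t0 - d)) (sg * g1 (t0 + d) - sg * g1 t0)) rho.
have m0 : 0 < m by rewrite !lt_min n1 n2.
have mh : m / 2 < m by rewrite ltr_pdivrMr// ltr_pMr// ltr1n.
exists (m / 2); first by rewrite divr_gt0.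
split; first by apply: (le_trans (ltW mh)); rewrite /m ge_min lexx orbT.
move=> x /le_lt_trans /(_ mh) hx.
have : `|sg * (x - g1 t0)| < m.
  by rewrite normrM; case: sg1 => ->; rewrite ?normrN normr1 mul1r.
rewrite !lt_min => /andP[/andP[]]; rewrite mulrBr !ltr_norml.
by move=> /andP[? ?] /andP[? ?] _; apply/andP; split; lra.
Qed.

Variable r : R.
Hypothesis r0 : 0 < r.
Hypothesis rrho : r <= rho.
Hypothesis rP : forall x, `|x - g1 t0| <= r -> sg * g1 (t0 - d) < sg * x < sg * g1 (t0 + d).

Lemma arc_param x : `|x - g1 t0| <= r -> exists2 t, `|t - t0| < d & g1 t = x.
Proof.
move=> /rP /andP[h1 h2].
have [|t ht e] := @ivt_sym _ g1 d1 sg t0 d x d0 dg1 _ sg0; first by rewrite !ltW.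
exists t => //; rewrite lt_neqAle ht andbT; apply/eqP => td.
have [tm|tp] : t = t0 - d \/ t = t0 + d.
  move/eqP: td; rewrite eqr_norml => /andP[/orP[]/eqP h _]; [right|left]; lra.
- by move: h1; rewrite -e tm ltxx.
- by move: h2; rewrite -e tp ltxx.
Qed.

(** The substitution x = g1 t. The monotone function g1 maps the parameter interval
    onto an interval containing the support of I, with the orientation sg. The
    continuity of I, needed for a primitive, comes from that of S by inverting g1. *)
Lemma arc_subst (I S : R -> R) : continuous S ->
  (forall t, `|t - t0| <= d -> I (g1 t) = S t) ->
  (forall x, r <= `|x - g1 t0| -> I x = 0) ->
  \int[mu]_x I x = sg * \int[mu]_(t in `[t0 - d, t0 + d]) (S t * d1 t).
Proof.
move=> cS IS I0.
have cI : continuous I.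
  move=> x; have [xr|rx] := leP (`|x - g1 t0|) r; last first.
    have : \forall y \near x, I y = 0.
      near=> y; apply: I0; apply: ltW; near: y.
      have cn : (fun y => `|y - g1 t0|) y @[y --> x] --> `|x - g1 t0|.
        by apply: cvg_norm; apply: cvgB; [exact: cvg_id|exact: cvg_cst].
      by move/cvgr_gt : cn; exact.
    move=> near0; rewrite /continuous_at (I0 x (ltW rx)).
    apply/cvgrPdist_lt => e e0; apply: filterS near0 => y ->.
    by rewrite subrr normr0.
  have [t td ex] := arc_param xr.
  apply/cvgrPdist_lt => e e0.
  have [de de0 He] := cont_delta t cS e0.
  pose dl := Num.min de (d - `|t - t0|).
  have dl0 : 0 < dl by rewrite lt_min de0 subr_gt0.
  have dlt u : `|u - t| <= dl -> `|u - t0| <= d.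
    rewrite le_min => /andP[_ h]; apply: (le_trans (ler_distD t _ _)).
    by rewrite -lerBrDr.
  have [u1 u2 u3] := dist_ends t dl0 (lexx dl).
  have m1 : sg * g1 (t - dl) < sg * x by rewrite -ex mono ?dlt// gtrBl.
  have m2 : sg * x < sg * g1 (t + dl) by rewrite -ex mono ?dlt// ltrDl.
  have csg : (fun y => sg * y) y @[y --> x] --> sg * x.
    by apply: cvgM; [exact: cvg_cst|exact: cvg_id].
  have n1 : \forall y \near x, sg * g1 (t - dl) < sg * y by move/cvgr_gt : csg; exact.
  have n2 : \forall y \near x, sg * y < sg * g1 (t + dl) by move/cvgr_lt : csg; exact.
  near=> y.
  have ys : sg * g1 (t - dl) <= sg * y <= sg * g1 (t + dl).
    by apply/andP; split; apply: ltW; near: y.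
  have [u hu <-] := ivt_sym dl0 dg1 ys sg0.
  rewrite -ex !IS ?dlt ?u3// distrC; apply: He.
  by move: hu; rewrite le_min => /andP[].
have [Q dQ] := primitive cI.
have ab : t0 - d <= t0 + d by apply: (@le_trans _ _ t0); rewrite ?gerBl ?lerDl ltW.
transitivity (sg * \int[mu]_(t in `[t0 - d, t0 + d]) (I (g1 t) * d1 t)); last first.
  congr (_ * _); apply: eq_Rintegral => t /[1!inE] /=.
  by rewrite in_itv /= => h; rewrite IS// ler_distl.
rewrite (Rintegral_subst ab cI dQ dg1 cd1).
have [e1 e2 e3] := ends.
have lem a b : a <= b -> (forall x, I x != 0 -> a <= x <= b) -> \int[mu]_x I x = Q b - Q a.
  move=> le H; rewrite -(FTC2 le cI dQ) [RHS]Rintegral_mkcond; apply: eq_Rintegral => x _.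
  rewrite patchE; case: ifPn => //; rewrite notin_setE /= in_itv /= => nx.
  by apply/eqP; apply: contrapT => /negP Ix; exact/nx/H.
have supp x : I x != 0 -> sg * g1 (t0 - d) < sg * x < sg * g1 (t0 + d).
  move=> Ix; apply: rP; rewrite leNgt; apply/negP => /ltW /I0 e.
  by rewrite e eqxx in Ix.
have mab : sg * g1 (t0 - d) < sg * g1 (t0 + d) by apply: mono => //; apply: (@lt_trans _ _ t0); rewrite ?gtrBl ?ltrDl.
case: sg1 => sE; move: supp mab; rewrite sE ?mul1r ?mulN1r ?ltrN2 => supp mab.
  apply: lem => [|x /supp]; first exact: ltW.
  by rewrite mul1r => /andP[h1 h2]; rewrite !ltW.
rewrite (lem (g1 (t0 + d)) (g1 (t0 - d))) ?opprB//; first exact: ltW.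
by move=> x /supp; rewrite !mulN1r !ltrN2 => /andP[h1 h2]; rewrite !ltW.
Unshelve. all: by end_near. Qed.

Let M := 2 * rho.

(** The shear (t, z) |-> (g1 t, g2 t + sg * z) sends the half-plane z > 0 to the
    side of the arc occupied by Omega; fiber integrates along its vertical lines, up
    to a height that no point of the support exceeds. *)
Definition fiber (G : R * R -> R) t := \int[mu]_(z in `[0, M]) G (g1 t, g2 t + sg * z).

Let cshear : continuous (fun w : R * R => (g1 w.1, g2 w.1 + sg * w.2)).
Proof.
apply: (@Ck_pair _ _ _ _ 0 (fun w : R * R => g1 w.1) (fun w : R * R => g2 w.1 + sg * w.2)).
  apply: (@Ck_comp _ _ 0 g1) => //; exact: Ck_x.
apply: (@CkD _ _ _ 0 (fun w : R * R => g2 w.1) (fun w : R * R => sg * w.2)).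
  apply: (@Ck_comp _ _ 0 g2) => //; exact: Ck_x.
by apply: (@CkM _ _ 0 (fun=> sg)); [exact: Ck_cst|exact: Ck_z].
Qed.

Let cshearF (G : R * R -> R) : continuous G ->
  continuous (fun w : R * R => G (g1 w.1, g2 w.1 + sg * w.2)).
Proof.
move=> cG w; apply: (@continuous_comp _ _ _ _ G w); first exact: cshear.
exact: cG.
Qed.

Lemma fiber_cont G : continuous G -> continuous (fiber G).
Proof. by move=> cG; exact: (@param_cont R _ M (cshearF cG)). Qed.

(** On the vertical line through g1 t, the points of Omega near the arc form the
    half-line that starts at the curve in the direction sg. *)
Lemma fiberE G t : continuous G -> supported G p r -> `|t - t0| <= d ->
  \int[mu]_z (G \_ Omega) (g1 t, z) = fiber G t.
Proof.
move=> cG sG td.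
have cGt := @cont_slice R G (g1 t) cG.
have [P dP] := primitive cGt.
have M0 : 0 <= M by rewrite mulr_ge0 ?ltW.
have dsP z : is_derive z (1 : R) (fun z => sg * P (g2 t + sg * z)) (G (g1 t, g2 t + sg * z)).
  have -> : G (g1 t, g2 t + sg * z) = sg * (G (g1 t, g2 t + sg * z) * sg).
    by rewrite mulrCA sgsg mulr1.
  apply: is_deriveZ; apply: (is_derive_compP (c1 := fun=> sg) dP).
  exact: is_derive_affine.
have cz : continuous (fun z => G (g1 t, g2 t + sg * z)).
  exact: (@cont_slice R _ t (cshearF cG)).
rewrite /fiber (FTC2 M0 cz dsP) mulr0 addr0 -mulrBr.
have /andP[h1 h2] : g2 t0 - rho < g2 t < g2 t0 + rho by rewrite -ltr_distl g2rho.
have G0 z : rho <= `|z - g2 t0| -> G (g1 t, z) = 0.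
  by move=> zr; apply: sG => -[_ /=]; rewrite ltNge (le_trans rrho zr).
have lem (J : set R) a b : a <= b ->
    \int[mu]_(z in J) G (g1 t, z) = \int[mu]_(z in `[a, b]) G (g1 t, z) ->
    (forall z, `|z - g2 t0| < rho -> 0 < sg * (z - g2 t) <-> J z) ->
    \int[mu]_z (G \_ Omega) (g1 t, z) = P b - P a.
  move=> ab HJ H; rewrite -(FTC2 ab cGt dP) -HJ [RHS]Rintegral_mkcond.
  apply: eq_Rintegral => z _; rewrite !patchE.
  have [zr|/G0 ->] := ltP (`|z - g2 t0|) rho; last by rewrite !if_same.
  congr (if _ then _ else _); apply/idP/idP; rewrite !inE.
    by move=> /(OE td zr) h; exact/(H z zr).
  by move=> /(H z zr) h; exact/(OE td zr).
have cGi a b : mu.-integrable `[a, b] (EFin \o (fun z => G (g1 t, z))) by exact: itv_integrable.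
case: sg1 => sE.
  rewrite sE !mul1r; apply: (lem `]g2 t, g2 t + M]%classic) => [||z].
  - by rewrite lerDl.
  - apply: Rintegral_itv_obnd_cbnd; apply: integrableS (cGi (g2 t) (g2 t + M)) => //.
    by apply: subset_itv; rewrite bnd_simp.
  rewrite ltr_distl sE mul1r /= in_itv /= /M => /andP[? ?]; split=> [?|/andP[? _]]; last lra.
  by apply/andP; split; lra.
rewrite sE !mulN1r opprB; apply: (lem `[g2 t - M, g2 t[%classic) => [||z].
- by rewrite gerBl.
- apply: Rintegral_itv_bndo_bndc; apply: integrableS (cGi (g2 t - M) (g2 t)) => //.
  by apply: subset_itv; rewrite bnd_simp.
rewrite ltr_distl sE mulN1r /= in_itv /= /M => /andP[? ?]; split=> [?|/andP[_ ?]]; last lra.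
by apply/andP; split; lra.
Qed.

Lemma area_arc G : continuous G -> supported G p r ->
  area_integral Omega G = sg * \int[mu]_(t in `[t0 - d, t0 + d]) (fiber G t * d1 t).
Proof.
move=> cG sG; rewrite (area_fubini_xz oO bO cG).
apply: arc_subst; first exact: fiber_cont.
  by move=> t td; exact: fiberE.
move=> x rx; rewrite (_ : (fun z => _) = fun=> 0) ?Rintegral_cst ?mul0r//.
apply/funext => z; rewrite patchE; case: ifPn => // _; apply: sG => -[/=].
by rewrite ltNge rx.
Qed.

Section Field.
Variable F : R * R -> R.
Hypothesis F1 : Ck 1 F.
Variable r' : R.
Hypothesis r'r : r' < r.
Hypothesis sF : supported F p r'.

Let sFr : supported F p r. Proof. exact: supported_le (ltW r'r) sF. Qed.
Let cF : continuous F. Proof. exact: Ck_cont F1. Qed.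
Let cFx : continuous (dx F). Proof. exact: (Ck_dx F1). Qed.
Let cFz : continuous (dz F). Proof. exact: (Ck_dz F1). Qed.
Let sFx : supported (dx F) p r. Proof. exact: supported_derive r'r sF. Qed.
Let sFz : supported (dz F) p r. Proof. exact: supported_derive r'r sF. Qed.

Let fF (f1 f2 e1 e2 : R -> R) x : is_derive x (1 : R) f1 (e1 x) ->
  is_derive x (1 : R) f2 (e2 x) ->
  is_derive x (1 : R) (fun y => F (f1 y, f2 y))
    (dx F (f1 x, f2 x) * e1 x + dz F (f1 x, f2 x) * e2 x).
Proof.
move=> D1 D2.
have h1 : differentiable f1 x by apply/derivable1_diffP; case: D1.
have h2 : differentiable f2 x by apply/derivable1_diffP; case: D2.
have h : differentiable (fun y => (f1 y, f2 y)) x by exact: differentiable_pair.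
have := @is_derive_curve _ F (fun y => (f1 y, f2 y)) x (F1.1 _) h.
rewrite derive1E derive_pair//=.
by move: D1 D2 => [_ ->] [_ ->].
Qed.

Lemma fiber_dz t : `|t - t0| <= d -> fiber (dz F) t = - sg * F (g1 t, g2 t).
Proof.
move=> td.
have dsF z : is_derive z (1 : R) (fun z => sg * F (g1 t, g2 t + sg * z))
    (dz F (g1 t, g2 t + sg * z)).
  have -> : dz F (g1 t, g2 t + sg * z) = sg * (dx F (g1 t, g2 t + sg * z) * 0 +
      dz F (g1 t, g2 t + sg * z) * sg).
    by rewrite mulr0 add0r mulrCA sgsg mulr1.
  apply: is_deriveZ.
  apply: (@fF (fun=> g1 t) (fun z => g2 t + sg * z) (fun=> 0) (fun=> sg)).
  exact: is_derive_affine.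
have M0 : 0 <= M by rewrite mulr_ge0 ?ltW.
have cz : continuous (fun z => dz F (g1 t, g2 t + sg * z)).
  exact: (@cont_slice R _ t (cshearF cFz)).
rewrite /fiber (FTC2 M0 cz dsF) mulr0 addr0 (sFr (w := (_, g2 t + sg * M))).
  by rewrite mulr0 sub0r mulNr.
move=> -[_ /=] hz; have {}hz := lt_le_trans hz rrho; have := g2rho td.
move: hz rho0; rewrite /M !ltr_distl => /andP[za zb] ? /andP[? ?].
by case: sg1 => sE; rewrite sE in za zb; lra.
Qed.

Lemma green_arc_dz : area_integral Omega (dz F) =
  - \int[mu]_(t in `[t0 - d, t0 + d]) (F (g1 t, g2 t) * d1 t).
Proof.
have cFg : continuous (fun t => F (g1 t, g2 t) * d1 t).
  move=> t; apply: cvgM; last exact: cd1.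
  apply: (@continuous_comp _ _ _ (fun t => (g1 t, g2 t)) F t); last exact: cF.
  exact: (@Ck_pair _ _ _ _ 0 g1 g2 cg1 cg2).
have e : \int[mu]_(t in `[t0 - d, t0 + d]) (fiber (dz F) t * d1 t) =
    - sg * \int[mu]_(t in `[t0 - d, t0 + d]) (F (g1 t, g2 t) * d1 t).
  rewrite -Rintegral_itvZ//; apply: eq_Rintegral => t /[1!inE] /=.
  by rewrite in_itv /= -ler_distl => td; rewrite fiber_dz// mulrA.
by rewrite area_arc// e mulrA mulrN sgsg mulN1r.
Qed.

(** Since F vanishes at both ends of the arc, the derivative of its fibre integral
    along the arc integrates to zero. By the chain rule this derivative is d1 times
    the fibre integral of dx F, which yields the area, plus d2 times that of dz F,
    which is a boundary value of F. *)
Lemma green_arc_dx : area_integral Omega (dx F) =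
  \int[mu]_(t in `[t0 - d, t0 + d]) (F (g1 t, g2 t) * d2 t).
Proof.
have cFg : continuous (fun t => F (g1 t, g2 t) * d2 t).
  move=> t; apply: cvgM; last exact: cd2.
  apply: (@continuous_comp _ _ _ (fun t => (g1 t, g2 t)) F t); last exact: cF.
  exact: (@Ck_pair _ _ _ _ 0 g1 g2 cg1 cg2).
have cfx : continuous (fun t => fiber (dx F) t * d1 t).
  by move=> t; apply: cvgM; [exact: fiber_cont|exact: cd1].
have cfz : continuous (fun t => fiber (dz F) t * d2 t).
  by move=> t; apply: cvgM; [exact: fiber_cont|exact: cd2].
have ab : t0 - d <= t0 + d by apply: (@le_trans _ _ t0); rewrite ?gerBl ?lerDl ltW.
have dN t : is_derive t (1 : R) (fiber F) (fiber (dx F) t * d1 t + fiber (dz F) t * d2 t).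
  pose H1 (w : R * R) := d1 w.1 * dx F (g1 w.1, g2 w.1 + sg * w.2) +
    d2 w.1 * dz F (g1 w.1, g2 w.1 + sg * w.2).
  have cd (e : R -> R) : continuous e -> continuous (fun w : R * R => e w.1).
    by move=> ce; apply: (@Ck_comp _ _ 0 e) => //; exact: Ck_x.
  have cH1 : continuous H1.
    apply: (@CkD _ _ _ 0 (fun w : R * R => d1 w.1 * dx F (g1 w.1, g2 w.1 + sg * w.2))
      (fun w : R * R => d2 w.1 * dz F (g1 w.1, g2 w.1 + sg * w.2))).
      by apply: (@CkM _ _ 0 (fun w : R * R => d1 w.1)); [exact: cd|exact: cshearF].
    by apply: (@CkM _ _ 0 (fun w : R * R => d2 w.1)); [exact: cd|exact: cshearF].
  have dH u z : is_derive u (1 : R) (fun u => F (g1 u, g2 u + sg * z)) (H1 (u, z)).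
    rewrite /H1 /= (mulrC (d1 u)) (mulrC (d2 u)).
    apply: (@fF g1 (fun u => g2 u + sg * z) d1 d2) => //.
    have h := is_deriveD (dg2 u) (@is_derive_cst R R R (sg * z) u 1).
    by apply: is_derive_eq h _; rewrite addr0.
  have := param_derive M t (cshearF cF) cH1 dH.
  rewrite /H1 /=; congr is_derive.
  rewrite Rintegral_itvD.
  - rewrite !Rintegral_itvZ; first by congr (_ + _); exact: mulrC.
      exact: (@cont_slice R _ t (cshearF cFz)).
    exact: (@cont_slice R _ t (cshearF cFx)).
  - apply: (@CkZ _ _ _ 0 (d1 t) (fun z => dx F (g1 t, g2 t + sg * z))).
    exact: (@cont_slice R _ t (cshearF cFx)).
  - apply: (@CkZ _ _ _ 0 (d2 t) (fun z => dz F (g1 t, g2 t + sg * z))).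
    exact: (@cont_slice R _ t (cshearF cFz)).
have fend x : r <= `|g1 x - g1 t0| -> fiber F x = 0.
  move=> rx; rewrite /fiber (_ : (fun z => _) = fun=> 0).
    by rewrite Rintegral_cst ?mul0r//; exact: measurable_itv.
  by apply/funext => z; apply: sFr => -[/=]; rewrite ltNge rx.
have rend x : x = t0 - d \/ x = t0 + d -> r <= `|g1 x - g1 t0|.
  move=> xE; rewrite leNgt; apply/negP => /ltW /rP /andP[].
  by case: xE => ->; rewrite ltxx.
have cfxz : continuous (fun t => fiber (dx F) t * d1 t + fiber (dz F) t * d2 t).
  by move=> t; apply: cvgD; [exact: cfx|exact: cfz].
have := FTC2 ab cfxz dN.
rewrite !fend ?subrr; [|by apply: rend; left|by apply: rend; right].
rewrite Rintegral_itvD// => /eqP; rewrite addr_eq0 => /eqP e.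
rewrite area_arc// e -mulN1r -Rintegral_itvZ// -Rintegral_itvZ//; last first.
  by apply: (@CkZ _ _ _ 0 (-1)).
apply: eq_Rintegral => t /[1!inE] /=; rewrite in_itv /= -ler_distl => td.
rewrite fiber_dz//.
have -> : sg * (-1 * (- sg * F (g1 t, g2 t) * d2 t)) = (sg * sg) * (F (g1 t, g2 t) * d2 t) by ring.
by rewrite sgsg mul1r.
Qed.

End Field.
End LocalGreen.

(** * Bump functions of finite smoothness *)

Section Bumps.
Context {R : realType}.

Lemma Ck_of_derive k (f f' : R -> R) : (forall x, is_derive x (1 : R) f (f' x)) ->
  Ck k f' -> Ck k.+1 f.
Proof.
move=> df cf'; have dff x : differentiable f x.
  by apply/derivable1_diffP; case: (df x).
split=> // v; have -> : 'D_v f = fun x => v * f' x.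
  apply/funext => x; rewrite (deriveE v (dff x)).
  have -> : v = v *: (1 : R) by rewrite [_ *: _]mulr1.
  rewrite linearZ /= -(deriveE (1 : R) (dff x)) [_ *: (1 : R)]mulr1.
  by have [_ ->] := df x.
by apply: (@CkM _ _ k (fun=> v)) => //; exact: Ck_cst.
Qed.

(** The n-th power of the positive part. It is of class C^(n-1) only, which is
    enough because the test functions below need finitely many derivatives. *)
Definition ppow n (x : R) := Num.max x 0 ^+ n.

Lemma ppow_ge0 n x : 0 <= ppow n x.
Proof. by rewrite exprn_ge0// le_max lexx orbT. Qed.

Lemma ppow_eq0 n x : x <= 0 -> ppow n.+1 x = 0.
Proof. by move=> x0; rewrite /ppow max_r// expr0n. Qed.

Lemma ppow_pos n x : 0 <= x -> ppow n x = x ^+ n.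
Proof. by move=> x0; rewrite /ppow max_l. Qed.

Lemma ppow_cont n : continuous (ppow n).
Proof.
elim: n => [|n IH]; first by move=> x; rewrite /ppow; exact: cvg_cst.
have -> : ppow n.+1 = fun x => Num.max x 0 * ppow n x.
  by apply/funext => x; rewrite /ppow exprS.
apply: (@CkM R R 0 (fun x => Num.max x 0) (ppow n)) => //.
have -> : (fun x : R => Num.max x 0) = fun x => (x + `|x|) / 2.
  apply/funext => y; have [y0|y0] := leP 0 y.
    by rewrite ger0_norm//; lra.
  by rewrite ltr0_norm//; lra.
apply: (@CkM R R 0 (fun x => x + `|x|) (fun=> 2^-1)); last exact: Ck_cst.
by move=> y; apply: cvgD; [exact: cvg_id|exact: norm_continuous].
Qed.

Lemma ppow_derive n x : is_derive x (1 : R) (ppow n.+2) (n.+2%:R * ppow n.+1 x).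
Proof.
have [x0|x0|x0] := ltgtP x 0.
- rewrite ppow_eq0 ?ltW// mulr0.
  have H := @is_derive_cst R R R 0 x 1.
  apply: near_eq_is_derive H.
  near=> y; rewrite ppow_eq0//; apply/ltW; near: y; exact: lt_nbhsl.
- rewrite ppow_pos ?ltW//.
  have H2 : is_derive x (1 : R) (fun y : R => y ^+ n.+2) (n.+2%:R * x ^+ n.+1).
    apply: DeriveDef; first exact: exprn_derivable.
    by rewrite exp_derive /= [_ *: _]mulr1.
  apply: near_eq_is_derive H2.
  near=> y; rewrite ppow_pos//; apply/ltW; near: y; exact: lt_nbhsr.
(* At 0 the difference quotient of ppow n.+2 is ppow n.+1. *)
rewrite x0; apply/is_derive1_caratheodory; exists (ppow n.+1); split.
- move=> z; rewrite (ppow_eq0 _ (lexx 0)) !subr0.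
  have [z0|/ltW z0] := leP 0 z; first by rewrite !ppow_pos// exprSr.
  by rewrite !ppow_eq0// mul0r.
- exact: ppow_cont.
- by rewrite (ppow_eq0 _ (lexx 0)) mulr0.
Unshelve. all: by end_near. Qed.

Lemma ppow_Ck k : Ck k (ppow k.+1).
Proof.
elim: k => [|k IH]; first exact: ppow_cont.
apply: Ck_of_derive (ppow_derive k) _.
by apply: (@CkM _ _ k (fun=> k.+2%:R)) => //; exact: Ck_cst.
Qed.

Definition paraboloid (p : R * R) (r : R) (w : R * R) :=
  r ^+ 2 - ((w.1 - p.1) * (w.1 - p.1) + (w.2 - p.2) * (w.2 - p.2)).

Lemma paraboloid_Ck k p r : Ck k (paraboloid p r).
Proof.
apply: (@CkB _ _ k (fun=> r ^+ 2)); first exact: Ck_cst.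
apply: (@CkD _ _ _ k (fun w : R * R => (w.1 - p.1) * (w.1 - p.1))
  (fun w : R * R => (w.2 - p.2) * (w.2 - p.2))).
  apply: (@CkM _ _ k (fun w : R * R => w.1 - p.1) (fun w : R * R => w.1 - p.1));
  by apply: (@CkB _ _ k (fun w : R * R => w.1) (fun=> p.1)); [exact: Ck_x|exact: Ck_cst].
apply: (@CkM _ _ k (fun w : R * R => w.2 - p.2) (fun w : R * R => w.2 - p.2));
by apply: (@CkB _ _ k (fun w : R * R => w.2) (fun=> p.2)); [exact: Ck_z|exact: Ck_cst].
Qed.

Lemma paraboloid_le0 p r w : 0 < r -> ~ box p r w -> paraboloid p r w <= 0.
Proof.
move=> r0 nw; rewrite /paraboloid -!expr2 -(real_normK (num_real (w.1 - p.1))).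
rewrite -(real_normK (num_real (w.2 - p.2))).
have n1 := normr_ge0 (w.1 - p.1); have n2 := normr_ge0 (w.2 - p.2).
have [h1|h1] := ltP `|w.1 - p.1| r; last by nra.
have [h2|h2] := ltP `|w.2 - p.2| r; last by nra.
by case: nw.
Qed.

Lemma paraboloid_ge p r w : 0 < r -> box p (r / 2) w -> r ^+ 2 / 2 <= paraboloid p r w.
Proof.
move=> r0 [] /ltW h1 /ltW h2; rewrite /paraboloid -!expr2.
rewrite -(real_normK (num_real (w.1 - p.1))) -(real_normK (num_real (w.2 - p.2))).
have n1 := normr_ge0 (w.1 - p.1); have n2 := normr_ge0 (w.2 - p.2).
nra.
Qed.

Definition hump k p r w := ppow k.+1 (paraboloid p r w).

Lemma hump_Ck k p r : Ck k (hump k p r).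
Proof. apply: (@Ck_comp _ _ k (ppow k.+1)); [exact: ppow_Ck|exact: paraboloid_Ck]. Qed.

Lemma hump_ge0 k p r w : 0 <= hump k p r w.
Proof. exact: ppow_ge0. Qed.

Lemma hump_center k p r : 0 < r -> 0 < hump k p r p.
Proof.
move=> r0; rewrite /hump /paraboloid !subrr mulr0 addr0 subr0 ppow_pos ?exprn_ge0 ?ltW//.
by rewrite !exprn_gt0.
Qed.

Lemma hump_supp k p r : 0 < r -> supported (hump k p r) p r.
Proof. by move=> r0 w nw; rewrite /hump ppow_eq0// paraboloid_le0. Qed.

(** The factor (2 / r ^ 2) ^ 2 brings the hump up to 1 at least on the box of half
    the size, where the outer ppow then vanishes. *)
Definition plateau (p : R * R) (r : R) (w : R * R) :=
  1 - ppow 2 (1 - (2 / r ^+ 2) ^+ 2 * hump 1 p r w).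

Lemma plateau_Ck1 p r : Ck 1 (plateau p r).
Proof.
apply: (@CkB _ _ 1 (fun=> 1)); first exact: Ck_cst.
apply: (@Ck_comp _ _ 1 (ppow 2)); first exact: ppow_Ck.
apply: (@CkB _ _ 1 (fun=> 1)); first exact: Ck_cst.
by apply: (@CkM _ _ 1 (fun=> (2 / r ^+ 2) ^+ 2)); [exact: Ck_cst|exact: hump_Ck].
Qed.

Lemma plateau_supp p r : 0 < r -> supported (plateau p r) p r.
Proof.
by move=> r0 w nw; rewrite /plateau (hump_supp 1 r0 nw) mulr0 subr0 ppow_pos// expr1n subrr.
Qed.

Lemma plateau1 p r w : 0 < r -> box p (r / 2) w -> plateau p r w = 1.
Proof.
move=> r0 bw; rewrite /plateau ppow_eq0 ?subr0// subr_le0.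
have h := paraboloid_ge r0 bw.
have r2 : 0 < r ^+ 2 by rewrite exprn_gt0.
have q0 : 0 <= r ^+ 2 / 2 by rewrite divr_ge0 // ltW.
rewrite /hump ppow_pos; last exact: le_trans h.
rewrite [leLHS](_ : _ = (2 / r ^+ 2) ^+ 2 * (r ^+ 2 / 2) ^+ 2); last first.
  by rewrite -exprMn mulrA divfK ?divff ?expr1n// gt_eqF.
by rewrite ler_wpM2l ?sqr_ge0// lerXn2r// ?nnegrE// (le_trans q0).
Qed.

End Bumps.

(** * Local Green's formula over either axis *)

Section GraphGreen.
Context {R : realType}.
Notation mu := (@lebesgue_measure R).

(** The bound d <= 1 / 4 keeps the arc within half a period, so that an integral
    over one period covers it exactly once. *)
Lemma graph_green (Omega : set (R * R)) (N : R) (g1 g2 d1 d2 : R -> R) (t0 : R) :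
  open Omega -> Omega `<=` box 0 N ->
  (forall t, is_derive t (1 : R) g1 (d1 t)) -> (forall t, is_derive t (1 : R) g2 (d2 t)) ->
  continuous d1 -> continuous d2 ->
  (forall d, 0 < d -> exists2 r, 0 < r & forall w, box (g1 t0, g2 t0) r w ->
    (closure Omega `\` Omega) w -> exists2 t, `|t - t0| < d & w = (g1 t, g2 t)) ->
  (exists2 e, 0 < e & forall h, 0 < h < e ->
    Omega (g1 t0 - h * d2 t0, g2 t0 + h * d1 t0) /\
    ~ Omega (g1 t0 + h * d2 t0, g2 t0 - h * d1 t0)) ->
  (forall t, (closure Omega `\` Omega) (g1 t, g2 t)) -> d1 t0 != 0 ->
  exists r d, [/\ 0 < r, 0 < d & d <= 4^-1] /\
    forall F : R * R -> R, Ck 1 F -> supported F (g1 t0, g2 t0) r ->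
      area_integral Omega (dz F) =
        - (\int[mu]_(t in `[t0 - d, t0 + d]) (F (g1 t, g2 t) * d1 t)) /\
      area_integral Omega (dx F) =
        \int[mu]_(t in `[t0 - d, t0 + d]) (F (g1 t, g2 t) * d2 t).
Proof.
move=> oO bO dg1 dg2 cd1 cd2 isol side onB d10.
have [sg [d [rho [[sg1 d0 rho0] [H1 H2 H3]]]]] :=
  graph_chart oO dg1 dg2 cd1 cd2 isol side onB d10.
pose d' := Num.min d 4^-1.
have d'0 : 0 < d' by rewrite lt_min d0 /= invr_gt0 ltr0n.
have dd t : `|t - t0| <= d' -> `|t - t0| <= d by rewrite le_min => /andP[].
have H1' t (h : `|t - t0| <= d') := H1 t (dd t h).
have H2' t (h : `|t - t0| <= d') := H2 t (dd t h).
have H3' t z (h : `|t - t0| <= d') := H3 t z (dd t h).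
have [r r0 [rrho rP]] := graph_radius dg1 sg1 d'0 rho0 H1'.
have r2 : 0 < r / 2 by rewrite divr_gt0.
have r2r : r / 2 < r by rewrite ltr_pdivrMr// ltr_pMr// ltr1n.
exists (r / 2), d'; split; first by split=> //; rewrite /d' ge_min lexx orbT.
move=> F F1 sF; split.
  exact: (green_arc_dz oO bO dg1 dg2 cd1 sg1 d'0 rho0 H1' H2' H3' rrho rP F1 r2r sF).
exact: (green_arc_dx oO bO dg1 dg2 cd1 cd2 sg1 d'0 rho0 H1' H2' H3' rrho rP F1 r2r sF).
Qed.

Definition swap (w : R * R) : R * R := (w.2, w.1).

Lemma swap_Ck k : Ck k swap.
Proof. by apply: (@Ck_pair _ _ _ _ k snd fst); [exact: Ck_z|exact: Ck_x]. Qed.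

Lemma closure_swap (A : set (R * R)) w : closure A w -> closure (swap @^-1` A) (swap w).
Proof.
move=> cA B nB.
have : nbhs w (swap @^-1` B) by apply: (@swap_Ck 0).
by move=> /cA [u [Au Bu]]; exists (swap u); split => //=; case: u Au {Bu}.
Qed.

Lemma derive_comp2 (V : normedModType R) (F : R * R -> R) (h : V -> R * R) v x :
  differentiable F (h x) -> differentiable h x ->
  'D_v (fun y => F (h y)) x = ('D_v h x).1 * dx F (h x) + ('D_v h x).2 * dz F (h x).
Proof.
move=> dF dh; rewrite [LHS]deriveE; last exact: differentiable_comp.
rewrite [X in X v](_ : _ = 'd F (h x) \o 'd h x); last exact: diff_comp.
by rewrite /= -(deriveE _ dF) derive_dxdz// (deriveE v dh).
Qed.

Lemma derive_swap v w : 'D_v swap w = swap v.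
Proof.
rewrite derive_pair; [|exact: differentiable_snd|exact: differentiable_fst].
rewrite (@derive_sndc _ _ _ _ id); last exact: ex_diff.
rewrite (@derive_fstc _ _ _ _ id); last exact: ex_diff.
by rewrite derive_id.
Qed.

Lemma area_swap (Omega : set (R * R)) (N : R) (F : R * R -> R) : open Omega ->
  Omega `<=` box 0 N -> continuous F ->
  area_integral (swap @^-1` Omega) (fun w => F (swap w)) = area_integral Omega F.
Proof.
move=> oO bO cF.
have oO' : open (swap @^-1` Omega) by apply: open_comp => // w _; exact: (@swap_Ck 0).
have bO' : swap @^-1` Omega `<=` box 0 N by move=> w /= /bO [].
have cF' : continuous (fun w => F (swap w)).
  move=> w; apply: (@continuous_comp _ _ _ swap F w); first exact: (@swap_Ck 0).
  exact: cF.
rewrite (area_fubini_xz oO' bO' cF') (area_fubini_zx oO bO cF).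
by apply: eq_Rintegral => x _; apply: eq_Rintegral => z _; rewrite !patchE.
Qed.

Lemma Rintegral_oppr (h : R -> R) t0 d : 0 < d -> continuous h ->
  \int[mu]_(u in `[- t0 - d, - t0 + d]) h (- u) = \int[mu]_(t in `[t0 - d, t0 + d]) h t.
Proof.
move=> d0 ch; have [P dP] := primitive ch.
have ab x : x - d <= x + d by apply: (@le_trans _ _ x); rewrite ?gerBl ?lerDl ltW.
have dN x : is_derive x (1 : R) (fun u : R => - u) (-1).
  have H := is_derive_affine 0 (-1) x.
  by move: H; congr is_derive; apply/funext => u; rewrite add0r mulN1r.
have chN : continuous (fun u : R => h (- u)).
  move=> u; apply: (@continuous_comp _ _ _ (fun u : R => - u) h u); last exact: ch.
  exact: (is_derive_cont dN).
apply: (@eq_Rintegral_increment _ _ _ (fun u => - P (- u)) P) => //.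
- move=> x; rewrite -[h _]opprK; apply: is_deriveN; rewrite -mulrN1.
  exact: (is_derive_compP (c1 := fun=> -1) dP).
- by rewrite !opprD !opprK; ring.
Qed.

(** At a vertical tangent the two coordinates are exchanged. This reflection
    reverses orientation, so the curve is run backwards to keep Omega on its left. *)
Lemma graph_green_swap (Omega : set (R * R)) (N : R) (g1 g2 d1 d2 : R -> R) (t0 : R) :
  open Omega -> Omega `<=` box 0 N ->
  (forall t, is_derive t (1 : R) g1 (d1 t)) -> (forall t, is_derive t (1 : R) g2 (d2 t)) ->
  continuous d1 -> continuous d2 ->
  (forall d, 0 < d -> exists2 r, 0 < r & forall w, box (g1 t0, g2 t0) r w ->
    (closure Omega `\` Omega) w -> exists2 t, `|t - t0| < d & w = (g1 t, g2 t)) ->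
  (exists2 e, 0 < e & forall h, 0 < h < e ->
    Omega (g1 t0 - h * d2 t0, g2 t0 + h * d1 t0) /\
    ~ Omega (g1 t0 + h * d2 t0, g2 t0 - h * d1 t0)) ->
  (forall t, (closure Omega `\` Omega) (g1 t, g2 t)) -> d2 t0 != 0 ->
  exists r d, [/\ 0 < r, 0 < d & d <= 4^-1] /\
    forall F : R * R -> R, Ck 1 F -> supported F (g1 t0, g2 t0) r ->
      area_integral Omega (dz F) =
        - (\int[mu]_(t in `[t0 - d, t0 + d]) (F (g1 t, g2 t) * d1 t)) /\
      area_integral Omega (dx F) =
        \int[mu]_(t in `[t0 - d, t0 + d]) (F (g1 t, g2 t) * d2 t).
Proof.
move=> oO bO dg1 dg2 cd1 cd2 isol side onB d20.
have swapK (A : set (R * R)) : swap @^-1` (swap @^-1` A) = A.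
  by apply/seteqP; split=> -[x z].
have clE w : (closure (swap @^-1` Omega) `\` (swap @^-1` Omega)) w <->
    (closure Omega `\` Omega) (swap w).
  split=> -[h1 h2]; split => //; last first.
    by have := closure_swap h1; case: w h1 h2.
  by have := closure_swap h1; rewrite swapK.
have oO' : open (swap @^-1` Omega) by apply: open_comp => // w _; exact: (@swap_Ck 0).
have bO' : swap @^-1` Omega `<=` box 0 N by move=> w /= /bO [].
have dN x : is_derive x (1 : R) (fun u : R => - u) (-1).
  have H := is_derive_affine 0 (-1) x.
  by move: H; congr is_derive; apply/funext => u; rewrite add0r mulN1r.
have drev (g d : R -> R) : (forall t, is_derive t (1 : R) g (d t)) ->
    forall t, is_derive t (1 : R) (fun u => g (- u)) (- d (- t)).
  by move=> dg t; rewrite -mulrN1; exact: (is_derive_compP (c1 := fun=> -1) dg).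
have crev (d : R -> R) : continuous d -> continuous (fun u => - d (- u)).
  move=> cd; apply: (@CkN _ _ 0 (fun u => d (- u))) => u.
  apply: (@continuous_comp _ _ _ (fun u : R => - u) d u); last exact: cd.
  exact: (is_derive_cont dN).
have [||||r [d [[r0 d0 d4] H]]] := @graph_green (swap @^-1` Omega) N (fun u => g2 (- u))
  (fun u => g1 (- u)) (fun u => - d2 (- u)) (fun u => - d1 (- u)) (- t0) oO' bO'
  (drev _ _ dg2) (drev _ _ dg1) (crev _ cd2) (crev _ cd1).
- move=> d d0; have [r r0 Hr] := isol d d0; exists r => // -[x z]; rewrite !opprK => -[/= h1 h2].
  move=> /clE /= hB; have [|t td [e1 e2]] := Hr _ _ hB; first by split.
  exists (- t); first by rewrite addrC distrC.
  by rewrite !opprK e1 e2.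
- have [e e0 He] := side; exists e => // h /He [h1 h2]; rewrite /= /swap /= !opprK.
  rewrite !mulrN !opprK; split; first by rewrite [X in Omega (_, X)]addrC in h1 *; move: h1; rewrite addrC.
  by [].
- by move=> t; apply/clE; exact: onB.
- by rewrite opprK oppr_eq0.
exists r, d; split => // F F1 sF.
have F1' : Ck 1 (fun w => F (swap w)).
  split=> [w|v]; first by apply: differentiable_comp; [exact: (swap_Ck 1).1|exact: F1.1].
  have -> : 'D_v (fun w => F (swap w)) = fun w => v.2 * dx F (swap w) + v.1 * dz F (swap w).
    apply/funext => w; rewrite derive_comp2; [|exact: F1.1|exact: (swap_Ck 1).1].
    by rewrite derive_swap.
  have cc (G : R * R -> R) a : continuous G -> continuous (fun w => a * G (swap w)).
    move=> cG; apply: (@CkM _ _ 0 (fun=> a) (fun w => G (swap w))); first exact: Ck_cst.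
    move=> w; apply: (@continuous_comp _ _ _ swap G w); [exact: (@swap_Ck 0)|exact: cG].
  apply: (@CkD _ _ _ 0 (fun w => v.2 * dx F (swap w)) (fun w => v.1 * dz F (swap w))).
    exact: cc (Ck_dx F1).
  exact: cc (Ck_dz F1).
have [] := H _ F1'.
  move=> [x z] nw; apply: sF => -[/= h1 h2]; apply: nw; split => /=; rewrite opprK //.
have dzE : dz (fun w => F (swap w)) = fun w => dx F (swap w).
  apply/funext => w; rewrite /dz derive_comp2; [|exact: F1.1|exact: (swap_Ck 1).1].
  by rewrite derive_swap /= mul1r mul0r addr0.
have dxE : dx (fun w => F (swap w)) = fun w => dz F (swap w).
  apply/funext => w; rewrite {1}/dx derive_comp2; [|exact: F1.1|exact: (swap_Ck 1).1].
  by rewrite derive_swap /= mul1r mul0r add0r.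
rewrite dzE dxE (area_swap oO bO (Ck_dx F1)) (area_swap oO bO (Ck_dz F1)) /swap /=.
have cFg (e : R -> R) : continuous e -> continuous (fun t => F (g1 t, g2 t) * e t).
  move=> ce t; apply: cvgM; last exact: ce.
  apply: (@continuous_comp _ _ _ (fun t => (g1 t, g2 t)) F t); last exact: (Ck_cont F1).
  by apply: (@Ck_pair _ _ _ _ 0 g1 g2); exact: is_derive_cont.
have iE (e : R -> R) : continuous e ->
    \int[mu]_(t in `[- t0 - d, - t0 + d]) (F (g1 (- t), g2 (- t)) * - e (- t)) =
    - \int[mu]_(t in `[t0 - d, t0 + d]) (F (g1 t, g2 t) * e t).
  move=> ce; have := Rintegral_oppr t0 d0 (cFg (fun t => - e t) _).
  move=> -> ; last exact: (@CkN _ _ 0).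
  rewrite -[RHS]mulN1r -[RHS](@Rintegral_itvZ _ (fun t => F (g1 t, g2 t) * e t)).
    by apply: eq_Rintegral => t _; rewrite mulrN mulN1r.
  exact: cFg.
by rewrite !iE// opprK => -> ->.
Qed.

End GraphGreen.

(** * Boundary curves of a domain *)

Section Domain.
Context {R : realType}.
Notation mu := (@lebesgue_measure R).
Variables (Omega : set (R * R)) (n : nat) (c : 'I_n.+1 -> R -> R * R).
Hypothesis hO : smooth_bounded_domain Omega c.

Lemma dom_open : open Omega.
Proof. by have [[? _ _] _ _ _ _] := hO. Qed.

Lemma dom_connected : connected Omega.
Proof. by have [[_ ? _] _ _ _ _] := hO. Qed.

Lemma dom_box : exists2 N, 0 < N & Omega `<=` box 0 N.
Proof.
have [[_ _ [M [_ HM]]] _ _ _ _] := hO.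
exists (`|M| + 2); first by rewrite ltr_wpDl.
move=> w Ow; have M1 : M < `|M| + 1 by rewrite (le_lt_trans (ler_norm M))// ltrDl.
have /= := HM (`|M| + 1) M1 w Ow; rewrite prod_normE /= ge_max => /andP[h1 h2].
by split; rewrite /= subr0; lra.
Qed.

Lemma bdryP w : (closure Omega `\` Omega) w <-> exists i t, w = c i t.
Proof.
have [_ -> _ _ _] := hO; split; first by move=> [i _ [t _ <-]]; exists i, t.
by move=> [i [t ->]]; exists i => //; exists t.
Qed.

Definition c1' i t := ((c i)^`() t).1.
Definition c2' i t := ((c i)^`() t).2.

Lemma curve_Ck i k : Ck k (c i).
Proof. by have [_ _ /(_ i)[]] := hO. Qed.

Lemma curve_diff i t : differentiable (c i) t.
Proof. exact: (curve_Ck i 1).1. Qed.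

Lemma curve_cont i : continuous (c i).
Proof. exact: (Ck_cont (curve_Ck i 0)). Qed.

Lemma curve_per i t : c i (t + 1) = c i t.
Proof. by have [_ _ /(_ i)[]] := hO. Qed.

Lemma curve_reg i t : (c i)^`() t != 0.
Proof. by have [_ _ /(_ i)[]] := hO. Qed.

Lemma curve_d1 i t : is_derive t (1 : R) (fun t => (c i t).1) (c1' i t).
Proof.
apply: DeriveDef; last by rewrite derive_fstc ?/c1' ?derive1E//; exact: curve_diff.
apply: diff_derivable; apply: differentiable_comp; first exact: curve_diff.
exact: differentiable_fst.
Qed.

Lemma curve_d2 i t : is_derive t (1 : R) (fun t => (c i t).2) (c2' i t).
Proof.
apply: DeriveDef; last by rewrite derive_sndc ?/c2' ?derive1E//; exact: curve_diff.
apply: diff_derivable; apply: differentiable_comp; first exact: curve_diff.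
exact: differentiable_snd.
Qed.

Lemma curve_cd1 i : continuous (c1' i).
Proof. by apply: (@Ck_fstc _ _ _ _ 0); exact: (Ck_derive1 (curve_Ck i 1)). Qed.

Lemma curve_cd2 i : continuous (c2' i).
Proof. by apply: (@Ck_sndc _ _ _ _ 0); exact: (Ck_derive1 (curve_Ck i 1)). Qed.

Lemma curve_perz i t (m : int) : c i (t + m%:~R) = c i t.
Proof.
have pn (k : nat) x : c i (x + k%:R) = c i x.
  elim: k => [|k IH]; first by rewrite addr0.
  by rewrite -natr1 addrA curve_per.
case: m => k; first exact: pn.
by rewrite NegzE mulrNz -[in RHS](subrK k.+1%:R t) -pmulrn pn.
Qed.

Lemma derive_per (f d : R -> R) : (forall t, is_derive t (1 : R) f (d t)) ->
  (forall t, f (t + 1) = f t) -> forall t, d (t + 1) = d t.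
Proof.
move=> df pf t.
have h : is_derive t (1 : R) (fun y => f (y + 1)) (d (t + 1) * 1).
  by apply: (is_derive_compP (c1 := fun=> 1) df); exact: is_derive_shift.
have {}h : is_derive t (1 : R) f (d (t + 1)).
  by move: h; rewrite mulr1; congr is_derive; apply/funext => y.
by have [_ <-] := h; have [_ <-] := df t.
Qed.

Lemma curve_perd1 i t : c1' i (t + 1) = c1' i t.
Proof. by apply: (derive_per (curve_d1 i)) => u; rewrite curve_per. Qed.

Lemma curve_perd2 i t : c2' i (t + 1) = c2' i t.
Proof. by apply: (derive_per (curve_d2 i)) => u; rewrite curve_per. Qed.

Lemma curve_inj i j t t' : c i t = c j t' -> i = j /\ exists m : int, t' + m%:~R = t.
Proof.
have fl (x : R) : exists m : int, 0 <= x - m%:~R < 1.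
  exists (Num.floor x); have /andP[h1 h2] := floor_itv x.
  by rewrite subr_ge0 h1 /= ltrBlDr addrC; move: h2; rewrite intrD.
have [m /[dup] hm /andP[m0 m1]] := fl t; have [m' /[dup] hm' /andP[m'0 m'1]] := fl t'.
have [_ _ _ inj _] := hO.
rewrite -(subrK m%:~R t) -(subrK m'%:~R t') !curve_perz => /inj [//|//|-> e].
split=> //; exists (m - m'); rewrite e rmorphB /=; ring.
Qed.

(** The boundary without a short arc around c i t0 is a finite union of compact
    sets, hence closed, and by injectivity it does not contain c i t0. *)
Lemma isolation i t0 d : 0 < d -> exists2 r, 0 < r &
  forall j t, box (c i t0) r (c j t) -> j = i /\ exists m : int, `|t + m%:~R - t0| < d.
Proof.
move=> d0.
pose K j : set (R * R) := c j @` (`[t0 - 2^-1, t0 + 2^-1] `&`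
  [set t | j = i -> d <= `|t - t0|]).
have clK : closed (\bigcup_(j in [set: 'I_n.+1]) K j).
  apply: closed_bigcup => [|j _]; first exact: finite_finset.
  apply: compact_closed; first exact: norm_hausdorff.
  apply: continuous_compact; first by apply: continuous_subspaceT; exact: curve_cont.
  apply: compact_closedI; first exact: segment_compact.
  have [ji|ji] := eqVneq j i; last first.
    have -> : [set t | j = i -> d <= `|t - t0|] = setT.
      by apply/seteqP; split=> // t _ /= /eqP; rewrite (negbTE ji).
    exact: closedT.
  have -> : [set t | j = i -> d <= `|t - t0|] = (fun t => `|t - t0|) @^-1` `[d, +oo[.
    apply/seteqP; split=> t /=; rewrite in_itv /= andbT; first exact.
    by [].
  apply: preimage_closed; last exact: interval_closed.
  move=> t _; apply: (@continuous_comp _ _ _ (fun t => t - t0) (fun x => `|x|) t).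
    exact: (@CkB R R 0 id (fun=> t0) (Ck_id R 0) (Ck_cst R 0 t0)).
  exact: norm_continuous.
have np : (~` \bigcup_(j in [set: 'I_n.+1]) K j) (c i t0).
  move=> [j _ [t [/= /[!in_itv] /= /andP[h1 h2] h3] e]].
  have [ij [m em]] := curve_inj (esym e).
  have md : d <= `|t - t0| by apply: h3.
  have : `|m%:~R : R| = `|t - t0| by rewrite -em opprD addrA subrr add0r normrN.
  have t12 : `|t - t0| <= 2^-1 by rewrite ler_distl h1.
  move=> e1; have : (0 : R) < `|m%:~R : R| < 1.
    rewrite e1; apply/andP; split; first exact: lt_le_trans d0 md.
    by apply: (le_lt_trans t12); rewrite invf_lt1 ?ltr1n// ltr0n.
  by rewrite -intr_norm ltr0z ltrz1; case: (m) => [[|?]|?].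
have [r r0 Hr] := open_box (closed_openC clK) np.
exists r => // j t bt.
have [m /andP[m1 m2]] : exists m : int, t0 - 2^-1 <= t + m%:~R <= t0 + 2^-1.
  exists (- Num.floor (t - (t0 - 2^-1))); rewrite mulrNz.
  have /andP := floor_itv (t - (t0 - 2^-1)); rewrite intrD => -[h1 h2].
  by apply/andP; split; lra.
have : ~ K j (c j t) by move=> Kj; apply: (Hr _ bt); exists j.
move=> nK; have [ji|ji] := eqVneq j i; last first.
  case: nK; exists (t + m%:~R); last exact: curve_perz.
  by split=> [|/= /eqP]; rewrite ?(negbTE ji) //= in_itv /= m1.
split=> //; exists m; rewrite ltNge; apply/negP => dm.
case: nK; exists (t + m%:~R); last exact: curve_perz.
by split=> //=; rewrite in_itv /= m1.
Qed.

(** The length of the tangent is absorbed into the step h. *)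
Lemma curve_side i t0 : exists2 e, 0 < e & forall h, 0 < h < e ->
  Omega ((c i t0).1 - h * c2' i t0, (c i t0).2 + h * c1' i t0) /\
  ~ Omega ((c i t0).1 + h * c2' i t0, (c i t0).2 - h * c1' i t0).
Proof.
have [_ _ _ _ /(_ i t0)[e e0 He]] := hO.
pose len := elen ((c i)^`() t0).
have len0 : 0 < len.
  rewrite /len /elen sqrtr_gt0 /dot; have := curve_reg i t0.
  case: ((c i)^`() t0) => a b ab /=; rewrite -!expr2 lt0r addr_ge0 ?sqr_ge0// andbT.
  apply: contra ab; rewrite paddr_eq0 ?sqr_ge0// !sqrf_eq0 => /andP[/eqP -> /eqP ->].
  by [].
exists (e / len); first by rewrite divr_gt0.
move=> h /andP[h0 he]; have [|] := He (h * len).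
  by rewrite mulr_gt0//= -ltr_pdivlMr.
rewrite /unit_normal -/len scalerA mulfK ?gt_eqF// /c1' /c2'.
case: (c i t0) => x z; case: ((c i)^`() t0) => a b /=.
have -> : (x, z) - h *: (b, - a) = (x - h * b, z + h * a).
  by congr pair; rewrite /= [h *: - a]mulrN opprK.
have -> : (x, z) + h *: (b, - a) = (x + h * b, z - h * a).
  by congr pair; rewrite /= [h *: - a]mulrN.
by [].
Qed.

(** Both components of the divergence theorem for F: with the outward normal n, the
    vector n dS is (c2', - c1') dt. *)
Definition green (F : R * R -> R) :=
  area_integral Omega (dz F) = - (\sum_i \int[mu]_(t in `[0, 1]) (F (c i t) * c1' i t)) /\
  area_integral Omega (dx F) = \sum_i \int[mu]_(t in `[0, 1]) (F (c i t) * c2' i t).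

Lemma curveF_cont (F : R * R -> R) (e : 'I_n.+1 -> R -> R) i : continuous F ->
  continuous (e i) -> continuous (fun t => F (c i t) * e i t).
Proof.
move=> cF ce; apply: (@CkM R R 0 (fun t => F (c i t)) (e i)) => //.
move=> t; apply: (@continuous_comp _ _ _ (c i) F t); last exact: cF.
exact: curve_cont.
Qed.

(** All of the boundary outside the short arc lies outside the support of F, and by
    periodicity the integral over [0, 1] is one over the period centred at t0, which
    contains the arc. *)
Lemma bdry_local i t0 d r (F : R * R -> R) (e : 'I_n.+1 -> R -> R) : d <= 4^-1 ->
  (forall j t, box (c i t0) r (c j t) -> j = i /\ exists m : int, `|t + m%:~R - t0| < d) ->
  continuous F -> supported F (c i t0) r -> (forall j, continuous (e j)) ->
  (forall j t, e j (t + 1) = e j t) ->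
  \sum_j \int[mu]_(t in `[0, 1]) (F (c j t) * e j t) =
  \int[mu]_(t in `[t0 - d, t0 + d]) (F (c i t) * e i t).
Proof.
move=> d4 iso cF sF ce pe; have d12 : d < 2^-1 by lra.
rewrite (bigD1 i)//= big1 ?addr0 => [|j ji]; last first.
  rewrite (_ : (fun t => _) = fun=> 0) ?Rintegral_cst ?mul0r//.
  apply/funext => t; rewrite sF ?mul0r// => /iso[/eqP].
  by rewrite (negbTE ji).
rewrite (@periodic_integral _ (fun t => F (c i t) * e i t) (t0 - 2^-1)); last 2 first.
- exact: curveF_cont.
- by move=> t; rewrite curve_per pe.
rewrite [LHS]Rintegral_mkcond [RHS]Rintegral_mkcond; apply: eq_Rintegral => t _; rewrite !patchE.
have -> : t0 - 2^-1 + 1 = t0 + 2^-1 by lra.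
have [td|dt] := ltP `|t - t0| d.
  rewrite !mem_set //= in_itv /= -ler_distl; first exact: ltW.
  by rewrite ltW// (lt_trans td).
case: ifPn => [/[1!inE] /= /[!in_itv] /= tI|_]; last first.
  case: ifPn => // /[1!inE] /= /[!in_itv] /= td.
  have td' : `|t - t0| = d by apply/eqP; rewrite eq_le dt andbT ler_distl.
  rewrite sF ?mul0r// => /iso[_ [m hm]]; have m0 : m = 0.
    have : `|m%:~R : R| < 1.
      have -> : (m%:~R : R) = (t + m%:~R - t0) - (t - t0) by ring.
      by apply: (le_lt_trans (ler_normB _ _)); rewrite td'; lra.
    by rewrite -intr_norm ltrz1; case: m {hm} => [[|k]|k].
  by move: hm; rewrite m0 addr0 td' ltxx.
have F0 : F (c i t) = 0.
  apply: sF => /iso[_ [m hm]]; have m0 : m = 0.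
    have : `|m%:~R : R| < 1.
      have -> : (m%:~R : R) = (t + m%:~R - t0) - (t - t0) by ring.
      apply: (le_lt_trans (ler_normB _ _)).
      by move: tI; rewrite -ler_distl; lra.
    by rewrite -intr_norm ltrz1; case: m {hm} => [[|k]|k].
  by move: hm; rewrite m0 addr0 ltNge dt.
by rewrite F0 mul0r if_same.
Qed.

(** A regular curve is a graph over one of the two axes near each of its points. *)
Lemma green_bdry i t0 : exists2 r, 0 < r & forall F : R * R -> R, Ck 1 F ->
  supported F (c i t0) r -> green F.
Proof.
have [N N0 bO] := dom_box.
have isol d : 0 < d -> exists2 r, 0 < r & forall w, box ((c i t0).1, (c i t0).2) r w ->
    (closure Omega `\` Omega) w -> exists2 t, `|t - t0| < d & w = ((c i t).1, (c i t).2).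
  move=> d0; have [r r0 Hr] := isolation i t0 d0; exists r => // w bw /bdryP[j [t e]].
  have bw' : box (c i t0) r (c j t) by rewrite -e; case: (c i t0) bw.
  have [ji [m hm]] := Hr j t bw'.
  by exists (t + m%:~R) => //; rewrite curve_perz -surjective_pairing -ji.
have onB t : (closure Omega `\` Omega) ((c i t).1, (c i t).2).
  by apply/bdryP; exists i, t; case: (c i t).
have [r [d [[r0 d0 d4] H]]] : exists r d, [/\ 0 < r, 0 < d & d <= 4^-1] /\
    forall F : R * R -> R, Ck 1 F -> supported F ((c i t0).1, (c i t0).2) r ->
      area_integral Omega (dz F) =
        - (\int[mu]_(t in `[t0 - d, t0 + d]) (F ((c i t).1, (c i t).2) * c1' i t)) /\
      area_integral Omega (dx F) =
        \int[mu]_(t in `[t0 - d, t0 + d]) (F ((c i t).1, (c i t).2) * c2' i t).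
  have [e1|e1] := eqVneq (c1' i t0) 0; last first.
    exact: (graph_green dom_open bO (@curve_d1 i) (@curve_d2 i) (@curve_cd1 i) (@curve_cd2 i)
      isol (curve_side i t0) onB e1).
  have e2 : c2' i t0 != 0.
    apply: contra (curve_reg i t0) => /eqP e2; move: e1 e2; rewrite /c1' /c2'.
    by case: ((c i)^`() t0) => a b /= -> ->.
  exact: (graph_green_swap dom_open bO (@curve_d1 i) (@curve_d2 i) (@curve_cd1 i) (@curve_cd2 i)
    isol (curve_side i t0) onB e2).
have [r' r'0 Hr'] := isolation i t0 d0.
exists (Num.min r r'); first by rewrite lt_min r0.
move=> F F1 sF; have cF := Ck_cont F1.
have sFr' : supported F (c i t0) r' by apply: supported_le sF; rewrite ge_min lexx orbT.
have [|h1 h2] := H F F1.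
  by rewrite -surjective_pairing; apply: supported_le sF; rewrite ge_min lexx.
have cp (e : 'I_n.+1 -> R -> R) : \int[mu]_(t in `[t0 - d, t0 + d]) (F ((c i t).1, (c i t).2) * e i t)
    = \int[mu]_(t in `[t0 - d, t0 + d]) (F (c i t) * e i t).
  by apply: eq_Rintegral => t _; rewrite -surjective_pairing.
rewrite /green h1 h2 !cp; split.
  by rewrite (bdry_local d4 Hr' cF sFr' curve_cd1 curve_perd1).
by rewrite (bdry_local d4 Hr' cF sFr' curve_cd2 curve_perd2).
Qed.

End Domain.

(** * Green's theorem *)

Section Green.
Context {R : realType}.
Notation mu := (@lebesgue_measure R).
Variables (Omega : set (R * R)) (n : nat) (c : 'I_n.+1 -> R -> R * R).
Hypothesis hO : smooth_bounded_domain Omega c.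

Let oO := dom_open hO.
Let N := sval (cid2 (dom_box hO)).
Let bO : Omega `<=` box 0 N. Proof. by rewrite /N; case: cid2. Qed.

Lemma full_line (h H : R -> R) p r : 0 < r -> continuous h ->
  (forall x, is_derive x (1 : R) H (h x)) -> (forall x, r <= `|x - p| -> H x = 0) ->
  (forall x, r <= `|x - p| -> h x = 0) -> \int[mu]_x h x = 0.
Proof.
move=> r0 ch dH H0 h0.
have ab : p - r <= p + r by apply: (@le_trans _ _ p); rewrite ?gerBl ?lerDl ltW.
have := FTC2 ab ch dH; rewrite !H0 ?subrr; last 2 first.
- by rewrite addrC addKr normrN gtr0_norm.
- by rewrite addrC addKr gtr0_norm.
move=> <-; rewrite [RHS]Rintegral_mkcond; apply: eq_Rintegral => x _.
rewrite patchE; case: ifPn => //; rewrite notin_setE /= in_itv /= -ler_distl => /negP.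
by rewrite -ltNge => /ltW; exact: h0.
Qed.

(** The boundary terms vanish because the support stays inside Omega, and the area
    terms because they are integrals of derivatives over full lines. *)
Lemma green_interior p : Omega p -> exists2 r, 0 < r & forall F : R * R -> R, Ck 1 F ->
  supported F p r -> green Omega c F.
Proof.
move=> Op; have [r r0 rO] := open_box oO Op.
have r2 : 0 < r / 2 by rewrite divr_gt0.
have r2r : r / 2 < r by rewrite ltr_pdivrMr// ltr_pMr// ltr1n.
exists (r / 2) => // F F1 sF; have sFr := supported_le (ltW r2r) sF.
have dF := F1.1.
have nc i t : F (c i t) = 0.
  apply: sFr => /rO; have [_] : (closure Omega `\` Omega) (c i t) by apply/(bdryP hO); exists i, t.
  by [].
have out (G : R * R -> R) w : supported G p r -> (G \_ Omega) w = G w.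
  move=> sG; rewrite patchE; case: ifPn => // wO; rewrite sG// => /rO.
  by move: wO; rewrite notin_setE.
have sx : supported (dx F) p r := supported_derive _ r2r sF.
have sz : supported (dz F) p r := supported_derive _ r2r sF.
have b0 (e : 'I_n.+1 -> R -> R) : \sum_i \int[mu]_(t in `[0, 1]) (F (c i t) * e i t) = 0.
  rewrite big1// => i _; rewrite (_ : (fun t => _) = fun=> 0).
    by rewrite Rintegral_cst ?mul0r//; exact: measurable_itv.
  by apply/funext => t; rewrite nc mul0r.
have Dz x z : is_derive z (1 : R) (fun z => F (x, z)) (dz F (x, z)).
  exact: is_derive_z.
have Dx x z : is_derive x (1 : R) (fun x => F (x, z)) (dx F (x, z)).
  exact: is_derive_x.
rewrite /green !b0 oppr0; split.
  rewrite (area_fubini_xz oO bO (Ck_dz F1)) (_ : (fun x => _) = fun=> 0).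
    by rewrite Rintegral_cst// mul0r.
  apply/funext => x; under eq_Rintegral do rewrite out//.
  apply: (full_line (p := p.2) r0 (cont_slice (Ck_dz F1)) (Dz x)) => z rz.
    by apply: sFr => -[_ /=]; rewrite ltNge rz.
  by apply: sz => -[_ /=]; rewrite ltNge rz.
rewrite (area_fubini_zx oO bO (Ck_dx F1)) (_ : (fun z => _) = fun=> 0).
  by rewrite Rintegral_cst// mul0r.
apply/funext => z; under eq_Rintegral do rewrite out//.
apply: (full_line (p := p.1) r0 (cont_slice2 (Ck_dx F1)) (Dx ^~ z)) => x rx.
  by apply: sFr => -[/=]; rewrite ltNge rx.
by apply: sx => -[/=]; rewrite ltNge rx.
Qed.

Lemma green_local p : closure Omega p -> exists2 r, 0 < r & forall F : R * R -> R, Ck 1 F ->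
  supported F p r -> green Omega c F.
Proof.
move=> cp; have [Op|nO] := pselect (Omega p); first exact: green_interior.
have /(bdryP hO)[i [t ->]] : (closure Omega `\` Omega) p by [].
exact: (green_bdry hO).
Qed.

Lemma derive_add (F G : R * R -> R) v : Ck 1 F -> Ck 1 G ->
  'D_v (fun w => F w + G w) = fun w => 'D_v F w + 'D_v G w.
Proof.
move=> F1 G1; apply/funext => w; apply: deriveD; apply: diff_derivable;
by [exact: F1.1|exact: G1.1].
Qed.

Lemma greenD (F G : R * R -> R) : Ck 1 F -> Ck 1 G -> green Omega c F -> green Omega c G ->
  green Omega c (fun w => F w + G w).
Proof.
move=> F1 G1 [f1 f2] [g1 g2].
have cF := Ck_cont F1; have cG := Ck_cont G1.
have bD (e : 'I_n.+1 -> R -> R) : (forall i, continuous (e i)) ->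
    \sum_i \int[mu]_(t in `[0, 1]) ((F (c i t) + G (c i t)) * e i t) =
    \sum_i \int[mu]_(t in `[0, 1]) (F (c i t) * e i t) +
    \sum_i \int[mu]_(t in `[0, 1]) (G (c i t) * e i t).
  move=> ce; rewrite -big_split; apply: eq_bigr => i _ /=.
  rewrite -Rintegral_itvD; last 2 first.
  - exact: (curveF_cont hO).
  - exact: (curveF_cont hO).
  by apply: eq_Rintegral => t _; rewrite mulrDl.
split.
  rewrite /dz derive_add// (areaD oO bO (Ck_dz F1) (Ck_dz G1)) f1 g1.
  by rewrite (bD (c1' c) (curve_cd1 hO)) opprD.
rewrite /dx derive_add// (areaD oO bO (Ck_dx F1) (Ck_dx G1)) f2 g2.
by rewrite (bD (c2' c) (curve_cd2 hO)).
Qed.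

Lemma green_vanish (F : R * R -> R) (U : set (R * R)) : open U -> closure Omega `<=` U ->
  (forall w, U w -> F w = 0) -> green Omega c F.
Proof.
move=> oU sU F0.
have D0 v w : Omega w -> 'D_v F w = 0.
  move=> Ow; rewrite (@near_eq_derive _ _ _ F (fun=> 0)) ?derive_cst//.
  have Uw : U w by apply: sU; exact: subset_closure.
  by have := open_nbhs_nbhs (conj oU Uw); apply: filterS => u; exact: F0.
have b0 (e : 'I_n.+1 -> R -> R) : \sum_i \int[mu]_(t in `[0, 1]) (F (c i t) * e i t) = 0.
  rewrite big1// => i _; rewrite (_ : (fun t => _) = fun=> 0).
    by rewrite Rintegral_cst ?mul0r//; exact: measurable_itv.
  apply/funext => t; rewrite F0 ?mul0r//; apply: sU.
  by have [] : (closure Omega `\` Omega) (c i t) by apply/(bdryP hO); exists i, t.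
have a0 (G : R * R -> R) : (forall w, Omega w -> G w = 0) -> area_integral Omega G = 0.
  move=> G0; rewrite (eq_area (G := fun w => 0 * 0))//; last by move=> w /G0 ->; rewrite mul0r.
  by rewrite (areaZ oO bO (F := fun=> 0)) ?mul0r// => w; exact: cvg_cst.
by rewrite /green !b0 oppr0; split; apply: a0 => w; exact: D0.
Qed.

Lemma closure_compact : compact (closure Omega).
Proof.
have kB : compact (`[- N, N] `*` `[- N, N] : set (R * R)).
  by apply: compact_setX; exact: segment_compact.
apply: (subclosed_compact _ kB); first exact: closed_closure.
have <- : closure (`[- N, N] `*` `[- N, N]) = (`[- N, N] `*` `[- N, N] : set (R * R)).
  by apply/esym/closure_id; apply: compact_closed => //; exact: norm_hausdorff.
apply: closureS => w /bO [/= h1 h2]; split; rewrite /= in_itv /= -ler_norml ltW//.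
  by move: h1; rewrite subr0.
by move: h2; rewrite subr0.
Qed.

(** The covering property is derived from compactness in pointed spaces, hence the
    choice of an origin. *)
Lemma plane_compact_cover (A : set (R * R)) : compact A -> cover_compact A.
Proof.
pose P := HB.pack_for ptopologicalType (R * R)%type
  (isPointed.Build (R * R)%type (0, 0)).
have -> // : compact A = cover_compact A.
exact: (congr1 (fun Q => Q A) (@compact_cover P)).
Qed.

(** Finitely many boxes of half the local radius cover the closure of Omega.
    Splitting F as F * plateau + F * (1 - plateau) at each of their centres in turn
    removes pieces for which the formula is local; what remains after the last one
    vanishes on the whole cover. *)
Theorem green_theorem (F : R * R -> R) : Ck 1 F -> green Omega c F.
Proof.
pose rad p := if pselect (closure Omega p) is left h then sval (cid2 (green_local h)) else 1.
have rad0 p : 0 < rad p by rewrite /rad; case: pselect => // h; case: cid2.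
have radP p (G : R * R -> R) : closure Omega p -> Ck 1 G -> supported G p (rad p) ->
    green Omega c G.
  by rewrite /rad; case: pselect => // h _; case: cid2 => /= r r0; exact.
pose chi p w : R := 1 - plateau p (rad p) w.
have chiC p : Ck 1 (chi p).
  by apply: (@CkB _ _ 1 (fun=> 1)); [exact: Ck_cst|exact: plateau_Ck1].
have step (s : seq (R * R)) : (forall p, p \in s -> closure Omega p) ->
    forall G : R * R -> R, Ck 1 G -> green Omega c (fun w => G w * \prod_(p <- s) chi p w) ->
    green Omega c G.
  elim: s => [_ G G1|p s IH sO G G1 HG].
    by congr green; apply/funext => w; rewrite big_nil mulr1.
  have sO' q : q \in s -> closure Omega q by move=> qs; apply: sO; rewrite inE qs orbT.
  have pO : closure Omega p by apply: sO; rewrite inE eqxx.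
  have C1 : Ck 1 (fun w => G w * plateau p (rad p) w).
    by apply: CkM; [exact: G1|exact: plateau_Ck1].
  have C2 : Ck 1 (fun w => G w * chi p w) by apply: CkM; [exact: G1|exact: chiC].
  have -> : G = fun w => G w * plateau p (rad p) w + G w * chi p w.
    by apply/funext => w; rewrite /chi; ring.
  apply: greenD => //.
    apply: (radP p) => // w nw; rewrite (plateau_supp (rad0 p) nw) mulr0 //.
  apply: IH => //; move: HG; congr green; apply/funext => w.
  by rewrite big_cons mulrA.
have := plane_compact_cover closure_compact.
move=> /(_ (R * R)%type (closure Omega) (fun p => box p (rad p / 2))) [].
- by move=> p _; exact: box_open.
- move=> p cp; exists p => //; split; rewrite subrr normr0 divr_gt0//.
move=> D DO cD F1; apply: (step (finmap.enum_fset D)) => //.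
  by move=> p pD; have := DO p pD; rewrite inE.
apply: (green_vanish _ cD).
  by apply: bigcup_open => p _; exact: box_open.
move=> w [p /= pD bw].
rewrite (big_rem p)//= /chi (plateau1 (rad0 p) bw) subrr mul0r mulr0 //.
Qed.

End Green.

(** * Symmetry of second derivatives *)

Section Schwarz.
Context {R : realType}.

Lemma dist_self (x d : R) : 0 < d -> `|x - x| <= d /\ `|x + d - x| <= d.
Proof. by move=> d0; rewrite subrr normr0 addrC addKr gtr0_norm// ltW. Qed.

Lemma not_close_two (a b q : R) : `|q - a| < `|a - b| / 2 -> `|q - b| < `|a - b| / 2 -> False.
Proof.
move=> h1 h2; have := ler_distD q a b; rewrite (distrC a q) leNgt.
by rewrite [X in _ < X]splitr ltrD.
Qed.

(** Both mixed derivatives are values, at points as near to w as desired, of one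
    second difference quotient of F. The second-order smoothness is asked of
    functions A and B that agree with the partial derivatives in Omega alone; this
    fits a stream function of class C^1 whose derivatives in Omega are velocity
    components. *)
Lemma schwarz_local (Omega : set (R * R)) (F A B : R * R -> R) w : open Omega -> Omega w ->
  (forall x, differentiable F x) -> Ck 1 A -> Ck 1 B ->
  (forall w, Omega w -> dx F w = A w) -> (forall w, Omega w -> dz F w = B w) ->
  dx B w = dz A w.
Proof.
move=> oO Ow dF A1 B1 FA FB.
have cxz := Ck_dx B1; have czx := Ck_dz A1.
have [r r0 rO] := open_box oO Ow.
have key d : 0 < d -> d < r -> exists p p', [/\ `|p.1 - w.1| <= d, `|p.2 - w.2| <= d,
    `|p'.1 - w.1| <= d & `|p'.2 - w.2| <= d] /\ dz A p = dx B p'.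
  move=> d0 dr; have [s1 s2] := dist_self w.1 d0; have [s3 s4] := dist_self w.2 d0.
  have D1 x : is_derive x (1 : R) (fun x => F (x, w.2 + d) - F (x, w.2))
      (dx F (x, w.2 + d) - dx F (x, w.2)).
    by apply: is_deriveB; exact: is_derive_x.
  have D2 z : is_derive z (1 : R) (fun z => F (w.1 + d, z) - F (w.1, z))
      (dz F (w.1 + d, z) - dz F (w.1, z)).
    by apply: is_deriveB; exact: is_derive_z.
  have [x xd ex] := mvt_sym D1 s1 s2; have [z' zd' ez'] := mvt_sym D2 s3 s4.
  have inO x1 z1 : `|x1 - w.1| <= d -> `|z1 - w.2| <= d -> Omega (x1, z1).
    by move=> h1 h2; apply: rO; split; exact: le_lt_trans dr.
  rewrite !FA in ex; [|exact: inO..].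
  rewrite !FB in ez'; [|exact: inO..].
  have [z zd ez] := mvt_sym (fun z => is_derive_z (A1.1 (x, z))) s3 s4.
  have [x' xd' ex'] := mvt_sym (fun x => is_derive_x (B1.1 (x, z'))) s1 s2.
  exists (x, z), (x', z'); split; first by split.
  apply: (mulIf (lt0r_neq0 d0)); apply: (mulIf (lt0r_neq0 d0)).
  have e1 : w.1 + d - w.1 = d by ring.
  have e2 : w.2 + d - w.2 = d by ring.
  move: ex ez' ez ex'; rewrite e1 e2 => ex ez' ez ex'.
  by rewrite -ez -ex' -ex -ez'; ring.
apply/eqP; apply: contrapT => /negP ne.
pose e := `|dx B w - dz A w| / 2.
have e0 : 0 < e by rewrite divr_gt0// normr_gt0 subr_eq0.
have near_w (G : R * R -> R) : continuous G -> exists2 d, 0 < d &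
    forall p, `|p.1 - w.1| <= d -> `|p.2 - w.2| <= d -> `|G p - G w| < e.
  move=> cG; have oU : open [set p | `|G p - G w| < e].
    have -> : [set p | `|G p - G w| < e] = G @^-1` `]G w - e, G w + e[.
      by apply/seteqP; split=> p /=; rewrite in_itv /= ltr_distl.
    by move/continuousP : cG; apply; exact: interval_open.
  have [|d d0 Hd] := open_box oU (_ : _ w); first by rewrite /= subrr normr0.
  have d2 : d / 2 < d by rewrite ltr_pdivrMr// ltr_pMr// ltr1n.
  exists (d / 2); first by rewrite divr_gt0.
  by move=> p h1 h2; apply: Hd; split; exact: le_lt_trans d2.
have [d1 d10 H1] := near_w _ cxz; have [d2 d20 H2] := near_w _ czx.
pose d := Num.min (Num.min d1 d2) (r / 2).
have d0 : 0 < d by rewrite !lt_min d10 d20 divr_gt0.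
have dr : d < r.
  by apply: (@le_lt_trans _ _ (r / 2)); [rewrite /d ge_min lexx orbT|lra].
have [p [p' [[]]]] := key _ d0 dr.
rewrite !le_min => /andP[/andP[_ a1] _] /andP[/andP[_ a2] _] /andP[/andP[b1 _] _].
move=> /andP[/andP[b2 _] _] E.
have := H2 _ a1 a2; rewrite E; exact: not_close_two (H1 _ b1 b2).
Qed.

Lemma schwarz (F : R * R -> R) w : Ck 2 F -> dx (dz F) w = dz (dx F) w.
Proof.
move=> F2; apply: (schwarz_local (F := F) openT) => //; first exact: F2.1.
  exact: Ck_dx.
exact: Ck_dz.
Qed.

End Schwarz.

(** * The fundamental lemma of the calculus of variations *)

Section Fundamental.
Context {R : realType}.
Notation mu := (@lebesgue_measure R).
Variables (Omega : set (R * R)) (n : nat) (c : 'I_n.+1 -> R -> R * R).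
Hypothesis hO : smooth_bounded_domain Omega c.

Let oO := dom_open hO.
Let N := sval (cid2 (dom_box hO)).
Let bO : Omega `<=` box 0 N. Proof. by rewrite /N; case: cid2. Qed.

Lemma itv_gt0 (h : R -> R) a b x : a < x < b -> continuous h ->
  (forall t, a <= t <= b -> 0 <= h t) -> 0 < h x -> 0 < \int[mu]_(t in `[a, b]) h t.
Proof.
move=> /andP[ax xb] ch h0 hx; have [P dP] := primitive ch.
rewrite (FTC2 (ltW (lt_trans ax xb)) ch dP).
have [d d0 Hd] := cont_delta x ch hx.
pose e := Num.min d (Num.min (x - a) (b - x)).
have e0 : 0 < e by rewrite !lt_min d0 !subr_gt0 ax.
have [ed ea eb] : [/\ e <= d, e <= x - a & e <= b - x].
  by split; rewrite /e !ge_min lexx ?orbT.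
have inc u v : a <= u -> u <= v -> v <= b -> P u <= P v.
  move=> au uv vb; have [y] := MVT_segment uv (fun y _ => dP y) (cont_within (is_derive_cont dP)).
  rewrite in_itv /= => /andP[y1 y2] e1; rewrite -subr_ge0 e1 mulr_ge0 ?subr_ge0//.
  by rewrite h0// (le_trans au)//= (le_trans y2).
have [s1 s2 _] := dist_ends x e0 (lexx e).
have [y yd ey] := mvt_sym dP s1 s2.
have hy : 0 < h y.
  have := Hd y (le_trans yd ed); rewrite ltr_distl => /andP[+ _].
  by rewrite subrr.
have : 0 < P (x + e) - P (x - e).
  by rewrite ey mulr_gt0// subr_gt0 ltrD2l gtrN.
have := inc a (x - e) (lexx a); have := inc (x + e) b.
have -> : a <= x - e by lra.
have -> : x - e <= b by lra.
have -> : a <= x + e by lra.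
have -> : x + e <= b by lra.
by rewrite lexx => /(_ isT isT isT) ? /(_ isT isT) ?; lra.
Qed.

Lemma sign_of (x : R) : x != 0 -> exists2 sg, sg = 1 \/ sg = -1 & 0 < sg * x.
Proof.
move=> x0; case: (ltgtP x 0) x0 => // h _.
  by exists (-1); [right|rewrite mulN1r oppr_gt0].
by exists 1; [left|rewrite mul1r].
Qed.

(** If G w is nonzero, a hump around w supported in Omega makes the area term
    nonzero and misses the boundary. Once G is known to vanish, a hump at a boundary
    point, too narrow to reach any but a short arc on which g i keeps its sign, does
    the same for the boundary term. *)
Lemma fundamental_lemma (G : R * R -> R) (g : 'I_n.+1 -> R -> R) : continuous G ->
  (forall i, continuous (g i)) -> (forall i t, g i (t + 1) = g i t) ->
  (forall phi : R * R -> R, Ck 3 phi -> area_integral Omega (fun w => G w * phi w) +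
    \sum_i \int[mu]_(t in `[0, 1]) (phi (c i t) * g i t) = 0) ->
  (forall w, Omega w -> G w = 0) /\ (forall i t, g i t = 0).
Proof.
move=> cG cg pg H.
have G0 w : Omega w -> G w = 0.
  move=> Ow; apply/eqP; apply: contrapT => /negP /sign_of[sg sg1 Gw].
  have cGs : continuous (fun w => sg * G w).
    by apply: (@CkM _ _ 0 (fun=> sg) G); [exact: Ck_cst|exact: cG].
  have oU : open [set p | Omega p /\ 0 < sg * G p].
    apply: openI => //; have /continuousP := cGs => /(_ `]0, +oo[).
    by rewrite preimage_itvoy; apply; exact: interval_open.
  have [//|r r0 rU] := open_box oU (_ : _ w).
  have := H _ (@hump_Ck R 3 w r); rewrite big1 ?addr0 => [e|i _]; last first.
    rewrite (_ : (fun t => _) = fun=> 0) ?Rintegral_cst ?mul0r//.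
    apply/funext => t; rewrite (hump_supp 3 r0) ?mul0r// => /rU[Oc _].
    by have [_] : (closure Omega `\` Omega) (c i t) by apply/(bdryP hO); exists i, t.
  have cb := Ck_cont (@hump_Ck R 3 w r).
  have cGb : continuous (fun w' => G w' * hump 3 w r w') by exact: (@CkM _ _ 0).
  have : 0 < area_integral Omega (fun w' => sg * (G w' * hump 3 w r w')).
    apply: (area_gt0 oO bO (p := w)) => //.
    - by apply: (@CkM _ _ 0 (fun=> sg)); [exact: Ck_cst|exact: cGb].
    - move=> p Op; rewrite mulrA; have [bp|nb] := pselect (box w r p).
        by rewrite mulr_ge0 ?hump_ge0// ltW//; have [] := rU _ bp.
      by rewrite (hump_supp 3 r0 nb) mulr0.
    - by rewrite mulrA mulr_gt0// hump_center.
  by rewrite (areaZ oO bO sg cGb) e mulr0 ltxx.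
split=> // i t0; apply/eqP; apply: contrapT => /negP /sign_of[sg sg1 gt].
have cgs : continuous (fun t => sg * g i t).
  by apply: (@CkM _ _ 0 (fun=> sg) (g i)); [exact: Ck_cst|exact: cg].
have [d1 d10 Hd1] := cont_delta t0 cgs gt.
pose d := Num.min d1 4^-1.
have d0 : 0 < d by rewrite lt_min d10 /= invr_gt0 ltr0n.
have [d1d d4] : d <= d1 /\ d <= 4^-1 by split; rewrite /d ge_min lexx ?orbT.
have [r r0 iso] := isolation hO i t0 d0.
have b3 := @hump_Ck R 3 (c i t0) r; have cb := Ck_cont b3.
have := H _ b3.
rewrite (eq_area (G := fun w => 0 * 0)); last by move=> w Ow; rewrite G0// !mul0r.
rewrite (areaZ oO bO (F := fun=> 0)) ?mul0r ?add0r; last by move=> w; exact: cvg_cst.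
rewrite (bdry_local hO d4 iso cb (hump_supp 3 r0) cg pg) => e.
have cbg : continuous (fun t => hump 3 (c i t0) r (c i t) * g i t).
  exact: (curveF_cont hO).
have : 0 < \int[mu]_(t in `[t0 - d, t0 + d]) (sg * (hump 3 (c i t0) r (c i t) * g i t)).
  apply: (itv_gt0 (x := t0)).
  - by rewrite gtrBl ltrDl d0.
  - by apply: (@CkM R R 0 (fun=> sg)); [exact: Ck_cst|exact: cbg].
  - move=> t; rewrite -ler_distl => td; rewrite mulrCA mulr_ge0 ?hump_ge0//.
    have := Hd1 t (le_trans td d1d); rewrite ltr_distl subrr => /andP[/ltW + _].
    by [].
  - by rewrite mulrCA mulr_gt0// hump_center.
by rewrite Rintegral_itvZ// e mulr0 ltxx.
Qed.

End Fundamental.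

(** * Derivatives and continuity of compound expressions *)

Section Rules.
Context {R : realType}.
Implicit Types F G : R * R -> R.

Lemma derD F G v w : Ck 1 F -> Ck 1 G ->
  'D_v (fun y => F y + G y) w = 'D_v F w + 'D_v G w.
Proof. by move=> F1 G1; exact: (congr1 (fun h => h w) (derive_add v F1 G1)). Qed.

Lemma derM F G v w : Ck 1 F -> Ck 1 G ->
  'D_v (fun y => F y * G y) w = F w * 'D_v G w + G w * 'D_v F w.
Proof. by move=> F1 G1; rewrite deriveM//; apply: diff_derivable; [exact: F1.1|exact: G1.1]. Qed.

Lemma derZ F v a w : Ck 1 F -> 'D_v (fun y => a * F y) w = a * 'D_v F w.
Proof. by move=> F1; apply: deriveZ; apply: diff_derivable; exact: F1.1. Qed.

Lemma derN F v w : Ck 1 F -> 'D_v (fun y => - F y) w = - 'D_v F w.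
Proof. by move=> F1; apply: deriveN; apply: diff_derivable; exact: F1.1. Qed.

Lemma derB F G v w : Ck 1 F -> Ck 1 G ->
  'D_v (fun y => F y - G y) w = 'D_v F w - 'D_v G w.
Proof. by move=> F1 G1; rewrite -(derN v w G1); exact: (derD v w F1 (CkN G1)). Qed.

Lemma dxD F G w : Ck 1 F -> Ck 1 G -> dx (fun y => F y + G y) w = dx F w + dx G w.
Proof. exact: derD. Qed.

Lemma dxB F G w : Ck 1 F -> Ck 1 G -> dx (fun y => F y - G y) w = dx F w - dx G w.
Proof. exact: derB. Qed.

Lemma dxM F G w : Ck 1 F -> Ck 1 G ->
  dx (fun y => F y * G y) w = F w * dx G w + G w * dx F w.
Proof. exact: derM. Qed.

Lemma dxZ F a w : Ck 1 F -> dx (fun y => a * F y) w = a * dx F w.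
Proof. exact: derZ. Qed.

Lemma dzD F G w : Ck 1 F -> Ck 1 G -> dz (fun y => F y + G y) w = dz F w + dz G w.
Proof. exact: derD. Qed.

Lemma dzB F G w : Ck 1 F -> Ck 1 G -> dz (fun y => F y - G y) w = dz F w - dz G w.
Proof. exact: derB. Qed.

Lemma dzM F G w : Ck 1 F -> Ck 1 G ->
  dz (fun y => F y * G y) w = F w * dz G w + G w * dz F w.
Proof. exact: derM. Qed.

Lemma dzZ F a w : Ck 1 F -> dz (fun y => a * F y) w = a * dz F w.
Proof. exact: derZ. Qed.

Lemma CkZr (V : normedModType R) k a (F : V -> R) : Ck k F -> Ck k (fun w => a * F w).
Proof. by move=> Fk; apply: CkM => //; exact: Ck_cst. Qed.

Lemma contD (V : normedModType R) (F G : V -> R) : continuous F -> continuous G ->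
  continuous (fun w => F w + G w).
Proof. exact: (@CkD R V R 0). Qed.

Lemma contM (V : normedModType R) (F G : V -> R) : continuous F -> continuous G ->
  continuous (fun w => F w * G w).
Proof. exact: (@CkM R V 0). Qed.

Lemma contN (V : normedModType R) (F : V -> R) : continuous F -> continuous (fun w => - F w).
Proof. exact: (@CkN R V 0). Qed.

Lemma contC (V : normedModType R) (a : R) : continuous (fun _ : V => a).
Proof. exact: (@Ck_cst R V R 0). Qed.

End Rules.

(** Comparing functions syntactically keeps the search from unfolding derivatives. *)
Ltac cont_atom := match goal with
  | H : continuous ?f |- continuous ?g => constr_eq f g; exact H
  | H : continuous ?f |- continuous (fun w => ?g w) => constr_eq f g; exact H
  | H : continuous (fun t => ?f (?g t)) |- continuous (fun w => ?f' (?g' w)) =>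
    constr_eq f f'; constr_eq g g'; exact H
  end.

Ltac cont := lazymatch goal with
  | |- continuous (fun w => @GRing.add _ (@?F w) (@?G w)) => apply (@contD _ _ F G); cbv beta; cont
  | |- continuous (fun w => @GRing.opp _ (@?F w)) => apply (@contN _ _ F); cbv beta; cont
  | |- continuous (fun w => @GRing.mul _ (@?F w) (@?G w)) => apply (@contM _ _ F G); cbv beta; cont
  | |- continuous (fun _ => ?x) => exact: contC
  | |- _ => cont_atom
  end.

(** * Integration by parts in the first variation *)

Section Variation.
Context {R : realType}.
Notation mu := (@lebesgue_measure R).
Variables (Omega : set (R * R)) (n : nat) (c : 'I_n.+1 -> R -> R * R).
Hypothesis hO : smooth_bounded_domain Omega c.

Let oO := dom_open hO.
Let N := sval (cid2 (dom_box hO)).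
Let bO : Omega `<=` box 0 N. Proof. by rewrite /N; case: cid2. Qed.

Variables (s : R) (a : 'I_n.+1 -> R).
Variables u1 u2 uT gam m psi th du1 du2 dT dth : R * R -> R.
Hypotheses (cu1 : continuous u1) (cu2 : continuous u2) (cuT : continuous uT)
  (cgam : continuous gam).
Hypotheses (m2 : Ck 2 m) (psi1 : Ck 1 psi) (th2 : Ck 2 th) (du11 : Ck 1 du1)
  (du21 : Ck 1 du2) (dT1 : Ck 1 dT) (dth2 : Ck 2 dth).

(** The variation of the potential vorticity for variations du1, du2, dT, dth of the
    state. Throughout this part, m stands for u_T + f x, th for the potential
    temperature, and psi for Phi' o q. *)
Definition dpv w := s * (dz du1 w - dx du2 w) - (dz dT w * dx th w - dx dT w * dz th w)
  - (dz m w * dx dth w - dx m w * dz dth w).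

(** The field (flux1, flux2) is the variation (dv1, dv2) of the circulation velocity
    plus the gradient of m * dth. It has the same curl, but contains no derivative
    of the variations. *)
Definition flux1 w := s * du1 w - dT w * dx th w + dth w * dx m w.
Definition flux2 w := s * du2 w - dT w * dz th w + dth w * dz m w.

Definition dv1 w := s * du1 w - dT w * dx th w - m w * dx dth w.
Definition dv2 w := s * du2 w - dT w * dz th w - m w * dz dth w.

(** The coefficients of the variations are the residuals of the equilibrium
    equations. *)
Definition euler w := (u1 w - s * dz psi w) * du1 w + (u2 w + s * dx psi w) * du2 w
  + (uT w - (- dz psi w * dx th w + dx psi w * dz th w)) * dT w
  + ((- dz psi w * dx m w + dx psi w * dz m w) - gam w) * dth w.

Let m1 : Ck 1 m := CkW m2.
Let dth1 : Ck 1 dth := CkW dth2.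
Let mx1 : Ck 1 (dx m) := Ck_dx m2.
Let mz1 : Ck 1 (dz m) := Ck_dz m2.
Let thx1 : Ck 1 (dx th) := Ck_dx th2.
Let thz1 : Ck 1 (dz th) := Ck_dz th2.
Let cm := Ck_cont m2.
Let cpsi := Ck_cont psi1.
Let cdu1 := Ck_cont du11.
Let cdu2 := Ck_cont du21.
Let cdT := Ck_cont dT1.
Let cdth := Ck_cont dth2.
Let cmx := Ck_cont mx1.
Let cmz := Ck_cont mz1.
Let cthx := Ck_cont thx1.
Let cthz := Ck_cont thz1.
Let cpsix : continuous (dx psi) := Ck_dx psi1.
Let cpsiz : continuous (dz psi) := Ck_dz psi1.
Let cdthx := Ck_cont (Ck_dx dth2).
Let cdthz := Ck_cont (Ck_dz dth2).
Let cdu1z : continuous (dz du1) := Ck_dz du11.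
Let cdu2x : continuous (dx du2) := Ck_dx du21.
Let cdTx : continuous (dx dT) := Ck_dx dT1.
Let cdTz : continuous (dz dT) := Ck_dz dT1.

Let flux1_Ck : Ck 1 flux1.
Proof. by apply: CkD; [apply: CkB; [exact: CkZr|exact: CkM]|exact: CkM]. Qed.

Let flux2_Ck : Ck 1 flux2.
Proof. by apply: CkD; [apply: CkB; [exact: CkZr|exact: CkM]|exact: CkM]. Qed.

Let der_flux1 v w : 'D_v flux1 w = s * 'D_v du1 w -
  (dT w * 'D_v (dx th) w + dx th w * 'D_v dT w) +
  (dth w * 'D_v (dx m) w + dx m w * 'D_v dth w).
Proof.
have A : Ck 1 (fun y => s * du1 y) by exact: CkZr.
have B : Ck 1 (fun y => dT y * dx th y) by exact: CkM.
have C : Ck 1 (fun y => dth y * dx m y) by exact: CkM.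
by rewrite (derD v w (CkB A B) C) (derB v w A B) derZ// !derM.
Qed.

Let der_flux2 v w : 'D_v flux2 w = s * 'D_v du2 w -
  (dT w * 'D_v (dz th) w + dz th w * 'D_v dT w) +
  (dth w * 'D_v (dz m) w + dz m w * 'D_v dth w).
Proof.
have A : Ck 1 (fun y => s * du2 y) by exact: CkZr.
have B : Ck 1 (fun y => dT y * dz th y) by exact: CkM.
have C : Ck 1 (fun y => dth y * dz m y) by exact: CkM.
by rewrite (derD v w (CkB A B) C) (derB v w A B) derZ// !derM.
Qed.

Let P1 : Ck 1 (fun w => psi w * flux1 w). Proof. exact: CkM. Qed.
Let P2 : Ck 1 (fun w => psi w * flux2 w). Proof. exact: CkM. Qed.

(* Keeps unification from comparing derivatives by their definition. *)
#[local] Opaque dx dz.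

(** Since dpv = dz flux1 - dx flux2, moving these derivatives onto psi leaves a term
    in which the variations occur undifferentiated. *)
Lemma variation_divergence w :
  u1 w * du1 w + u2 w * du2 w + uT w * dT w - gam w * dth w + psi w * dpv w =
  euler w + (dz (fun y => psi y * flux1 y) w - dx (fun y => psi y * flux2 y) w).
Proof.
have -> : dz (fun y => psi y * flux1 y) w = psi w * dz flux1 w + flux1 w * dz psi w := derM _ _ psi1 flux1_Ck.
have -> : dx (fun y => psi y * flux2 y) w = psi w * dx flux2 w + flux2 w * dx psi w := derM _ _ psi1 flux2_Ck.
have -> : dz flux1 w = s * dz du1 w - (dT w * dz (dx th) w + dx th w * dz dT w) +
  (dth w * dz (dx m) w + dx m w * dz dth w) := der_flux1 _ w.
have -> : dx flux2 w = s * dx du2 w - (dT w * dx (dz th) w + dz th w * dx dT w) +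
  (dth w * dx (dz m) w + dz m w * dx dth w) := der_flux2 _ w.
rewrite (schwarz w th2) (schwarz w m2) /euler /dpv /flux1 /flux2.
move: (dx psi w) (dz psi w) (dx m w) (dz m w) (dx th w) (dz th w) (dx dth w) (dz dth w)
  (dz du1 w) (dx du2 w) (dx dT w) (dz dT w) (dz (dx th) w) (dz (dx m) w).
by move=> *; ring.
Qed.

Lemma area_variation :
  area_integral Omega (fun w => u1 w * du1 w + u2 w * du2 w + uT w * dT w - gam w * dth w)
  + area_integral Omega (fun w => psi w * dpv w) =
  area_integral Omega euler
  - \sum_i \int[mu]_(t in `[0, 1]) (psi (c i t) * flux1 (c i t) * c1' c i t)
  - \sum_i \int[mu]_(t in `[0, 1]) (psi (c i t) * flux2 (c i t) * c2' c i t).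
Proof.
have [g1 _] := green_theorem hO P1; have [_ g2] := green_theorem hO P2.
have c1 : continuous (dz (fun y => psi y * flux1 y)) := Ck_dz P1.
have c2 : continuous (dx (fun y => psi y * flux2 y)) := Ck_dx P2.
have ce : continuous euler by rewrite /euler; cont.
rewrite -(areaD oO bO); [|cont|rewrite /dpv; cont].
rewrite (eq_area (fun w _ => variation_divergence w)).
rewrite (areaD oO bO ce); last by cont.
rewrite (areaD oO bO c1); last by cont.
rewrite g1 -addrA; congr (_ + (_ + _)).
rewrite -g2 -mulN1r -(areaZ oO bO (-1) c2).
by apply: eq_area => w _; rewrite mulN1r.
Qed.

Let cc (F : R * R -> R) i : continuous F -> continuous (fun t => F (c i t)).
Proof.
move=> cF t; apply: (@continuous_comp _ _ _ (c i) F t); first exact: (curve_cont hO).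
exact: cF.
Qed.

(** The two integrands differ by the derivative of m * dth along a closed curve. *)
Lemma line_variation i :
  \int[mu]_(t in `[0, 1]) (dv1 (c i t) * c1' c i t + dv2 (c i t) * c2' c i t) =
  \int[mu]_(t in `[0, 1]) (flux1 (c i t) * c1' c i t + flux2 (c i t) * c2' c i t).
Proof.
have k1 := curve_cd1 hO (i := i); have k2 := curve_cd2 hO (i := i).
have cd1 : continuous dv1 by rewrite /dv1; cont.
have cd2 : continuous dv2 by rewrite /dv2; cont.
have mth : Ck 1 (fun w => m w * dth w) by exact: CkM.
have D t : is_derive t (1 : R) (fun t => m (c i t) * dth (c i t))
    ((m (c i t) * dx dth (c i t) + dth (c i t) * dx m (c i t)) * c1' c i t +
     (m (c i t) * dz dth (c i t) + dth (c i t) * dz m (c i t)) * c2' c i t).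
  by have := is_derive_curve (mth.1 (c i t)) (curve_diff hO i t); rewrite dxM// dzM.
have H1 := @cc _ i cd1; have H2 := @cc _ i cd2.
have j1 := @cc _ i cm; have j2 := @cc _ i cdth; have j3 := @cc _ i cmx; have j4 := @cc _ i cmz.
have j5 := @cc _ i cdthx; have j6 := @cc _ i cdthz.
pose h t := (m (c i t) * dx dth (c i t) + dth (c i t) * dx m (c i t)) * c1' c i t +
  (m (c i t) * dz dth (c i t) + dth (c i t) * dz m (c i t)) * c2' c i t.
have ch : continuous h by rewrite /h; cont.
have := FTC2 ler01 ch D; rewrite -[in c i 1](add0r 1) (curve_per hO) subrr => E.
transitivity (\int[mu]_(t in `[0, 1]) (dv1 (c i t) * c1' c i t + dv2 (c i t) * c2' c i t) +
  \int[mu]_(t in `[0, 1]) h t); first by rewrite E addr0.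
rewrite -Rintegral_itvD; [|cont|exact: ch].
rewrite /h.
by apply: eq_Rintegral => t _; rewrite /dv1 /dv2 /flux1 /flux2; ring.
Qed.

Lemma variation_identity :
  area_integral Omega (fun w => u1 w * du1 w + u2 w * du2 w + uT w * dT w - gam w * dth w)
  + area_integral Omega (fun w => psi w * dpv w)
  + \sum_i a i * \int[mu]_(t in `[0, 1]) (dv1 (c i t) * c1' c i t + dv2 (c i t) * c2' c i t)
  = area_integral Omega euler +
    \sum_i \int[mu]_(t in `[0, 1]) ((a i - psi (c i t)) *
      (flux1 (c i t) * c1' c i t + flux2 (c i t) * c2' c i t)).
Proof.
rewrite area_variation -!addrA; congr (_ + _).
rewrite -!sumrN -!big_split; apply: eq_bigr => i _ /=; rewrite line_variation.
have k1 := curve_cd1 hO (i := i); have k2 := curve_cd2 hO (i := i).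
have H1 := @cc flux1 i (Ck_cont flux1_Ck); have H2 := @cc flux2 i (Ck_cont flux2_Ck).
have j1 := @cc _ i cpsi.
rewrite -[X in X + _ = _]mulN1r -[X in _ + (X + _) = _]mulN1r.
rewrite -!Rintegral_itvZ; [|cont..].
rewrite -!Rintegral_itvD; [|cont..].
by apply: eq_Rintegral => t _; ring.
Qed.

End Variation.

(** * Perturbed states *)

Section LinearRules.
Context {R : realType}.
Implicit Types F G : R * R -> R.

Lemma dxDZ F G a w : Ck 1 F -> Ck 1 G ->
  dx (fun y => F y + a * G y) w = dx F w + a * dx G w.
Proof. by move=> F1 G1; rewrite (dxD w F1 (CkZr a G1)) (dxZ a w G1). Qed.

Lemma dzDZ F G a w : Ck 1 F -> Ck 1 G ->
  dz (fun y => F y + a * G y) w = dz F w + a * dz G w.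
Proof. by move=> F1 G1; rewrite (dzD w F1 (CkZr a G1)) (dzZ a w G1). Qed.

Lemma is_derive_quad (A B C x : R) :
  is_derive x (1 : R) (fun y => A + y * B + y ^+ 2 * C) (B + 2 * x * C).
Proof.
have H := is_deriveD (@is_derive_cst R R R A x 1)
  (is_deriveM (is_derive_id x (1 : R)) (is_derive_affine B C x)).
have E : cst A + id * (fun y => B + C * y) = fun y => A + y * B + y ^+ 2 * C.
  by apply/funext => y; rewrite -[LHS]/(A + y * (B + C * y)); ring.
by rewrite -E; apply: is_derive_eq H _; rewrite /GRing.scale /=; ring.
Qed.

End LinearRules.

Section PotentialVorticity.
Context {R : realType}.
Variables (f s : R).
Implicit Types e d : state R.

Definition u1 e w := (uS e w).1.
Definition u2 e w := (uS e w).2.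
(** The absolute momentum, which absorbs the Coriolis parameter. *)
Definition mom e (w : R * R) := uT e w + f * w.1.

Lemma u1_Ck e : smooth_state e -> Ck 2 (u1 e).
Proof. by move=> [h _ _]; exact: Ck_fstc. Qed.

Lemma u2_Ck e : smooth_state e -> Ck 2 (u2 e).
Proof. by move=> [h _ _]; exact: Ck_sndc. Qed.

Lemma uT_Ck e : smooth_state e -> Ck 2 (uT e).
Proof. by case. Qed.

Lemma th_Ck e : smooth_state e -> Ck 3 (thS e).
Proof. by case. Qed.

Lemma mom_Ck e : smooth_state e -> Ck 2 (mom e).
Proof. by move=> he; apply: CkD; [exact: uT_Ck|apply: CkZr; exact: Ck_x]. Qed.

(** The second derivatives of the potential temperature cancel in the curl. *)
Lemma pvE e w : smooth_state e -> pv f s e w = s * (dz (u1 e) w - dx (u2 e) w) -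
  (dz (mom e) w * dx (thS e) w - dx (mom e) w * dz (thS e) w).
Proof.
move=> he; have t2 := CkW (th_Ck he); have m1 := CkW (mom_Ck he).
have a1 := CkW (u1_Ck he); have a2 := CkW (u2_Ck he).
have t1x := Ck_dx t2; have t1z := Ck_dz t2.
have -> : pv f s e w = dz (fun y => s * u1 e y - mom e y * dx (thS e) y) w -
  dx (fun y => s * u2 e y - mom e y * dz (thS e) y) w by [].
rewrite dzB ?dxB; [|exact: CkZr|exact: CkM|exact: CkZr|exact: CkM].
rewrite dzZ// dxZ// dzM// dxM// (schwarz w t2).
move: (dz (dx (thS e)) w) (dz (u1 e) w) (dx (u2 e) w) (dz (mom e) w) (dx (mom e) w)
  (dx (thS e) w) (dz (thS e) w) => *; ring.
Qed.

Lemma pv_Ck e : smooth_state e -> Ck 1 (pv f s e).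
Proof.
move=> he; have -> : pv f s e = fun w => s * (dz (u1 e) w - dx (u2 e) w) -
  (dz (mom e) w * dx (thS e) w - dx (mom e) w * dz (thS e) w).
  by apply/funext => w; exact: pvE.
have t2 := CkW (th_Ck he); have m2 := mom_Ck he.
have t1x := Ck_dx t2; have t1z := Ck_dz t2; have m1x := Ck_dx m2; have m1z := Ck_dz m2.
have a1 := Ck_dz (u1_Ck he); have a2 := Ck_dx (u2_Ck he).
by apply: CkB; [apply: CkZr; exact: CkB|apply: CkB; exact: CkM].
Qed.

Lemma perturb_smooth e eps d : smooth_state e -> smooth_state d ->
  smooth_state (perturb e eps d).
Proof.
move=> [h1 h2 h3] [k1 k2 k3]; split.
- exact: (CkD h1 (CkZ eps k1)).
- exact: (CkD h2 (CkZr eps k2)).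
- exact: (CkD h3 (CkZr eps k3)).
Qed.

Definition pv1 e d := dpv s (mom e) (thS e) (u1 d) (u2 d) (uT d) (thS d).
Definition pv2 d w := - (dz (uT d) w * dx (thS d) w - dx (uT d) w * dz (thS d) w).

Lemma pv_perturb e eps d w : smooth_state e -> smooth_state d ->
  pv f s (perturb e eps d) w = pv f s e w + eps * pv1 e d w + eps ^+ 2 * pv2 d w.
Proof.
move=> he hd; rewrite (pvE _ (perturb_smooth eps he hd)) (pvE _ he).
have t1 := CkW (CkW (th_Ck he)); have m1 := CkW (mom_Ck he).
have a1 := CkW (u1_Ck he); have a2 := CkW (u2_Ck he).
have t1' := CkW (CkW (th_Ck hd)); have m1' := CkW (uT_Ck hd).
have a1' := CkW (u1_Ck hd); have a2' := CkW (u2_Ck hd).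
have -> : u1 (perturb e eps d) = fun w => u1 e w + eps * u1 d w by [].
have -> : u2 (perturb e eps d) = fun w => u2 e w + eps * u2 d w by [].
have -> : mom (perturb e eps d) = fun w => mom e w + eps * uT d w.
  by apply/funext => y; rewrite /mom /=; ring.
have -> : thS (perturb e eps d) = fun w => thS e w + eps * thS d w by [].
rewrite (dzDZ eps w a1 a1') (dxDZ eps w a2 a2') (dzDZ eps w m1 m1') (dxDZ eps w m1 m1').
rewrite (dzDZ eps w t1 t1') (dxDZ eps w t1 t1') /pv1 /pv2 /dpv.
move: (dz (u1 e) w) (dx (u2 e) w) (dz (mom e) w) (dx (mom e) w) (dz (uT d) w) (dx (uT d) w)
  (dx (thS e) w) (dz (thS e) w) (dx (thS d) w) (dz (thS d) w) (dz (u1 d) w) (dx (u2 d) w)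
  => *; ring.
Qed.

End PotentialVorticity.

(** * The first variation of the generalised Hamiltonian *)

Section FirstVariation.
Context {R : realType}.
Notation mu := (@lebesgue_measure R).
Variables (g theta0 f s : R) (Omega : set (R * R)) (n : nat) (c : 'I_n.+1 -> R -> R * R).
Variables (Phi : R -> R) (a : 'I_n.+1 -> R) (e : state R).
Hypothesis hO : smooth_bounded_domain Omega c.
Hypothesis hPhi : Ck 2 Phi.
Hypothesis he : smooth_state e.

Let oO := dom_open hO.
Let N := sval (cid2 (dom_box hO)).
Let bO : Omega `<=` box 0 N. Proof. by rewrite /N; case: cid2. Qed.

Let q := pv f s e.
Let psi : R * R -> R := fun w => Phi^`() (q w).
Let m := mom f e.

Lemma psi_Ck : Ck 1 (fun w => Phi^`() (pv f s e w)).
Proof.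
apply: (@Ck_comp _ _ 1 Phi^`()); last exact: pv_Ck.
exact: Ck_derive1.
Qed.

Lemma quad_derive (A B C : R) :
  is_derive (0 : R) (1 : R) (fun x => A + x * B + x ^+ 2 * C) B.
Proof.
by have := is_derive_quad A B C 0; rewrite mulr0 mul0r addr0.
Qed.

Lemma gamma_cont : continuous (gammaS g theta0 : R * R -> R).
Proof. by apply: (@contM _ _ (fun=> g / theta0)); [exact: contC|exact: (@Ck_z R 0)]. Qed.

Variable d : state R.
Hypothesis hd : smooth_state d.

Let q1 := pv1 f s e d.
Let q2 := pv2 d.

Let ce1 : continuous (u1 e) := Ck_cont (u1_Ck he).
Let ce2 : continuous (u2 e) := Ck_cont (u2_Ck he).
Let ceT : continuous (uT e) := Ck_cont (uT_Ck he).
Let ceth : continuous (thS e) := Ck_cont (th_Ck he).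
Let cd1 : continuous (u1 d) := Ck_cont (u1_Ck hd).
Let cd2 : continuous (u2 d) := Ck_cont (u2_Ck hd).
Let cdT : continuous (uT d) := Ck_cont (uT_Ck hd).
Let cdth : continuous (thS d) := Ck_cont (th_Ck hd).
Let cm : continuous m := Ck_cont (mom_Ck f he).
Let cmx : continuous (dx m) := Ck_cont (Ck_dx (mom_Ck f he)).
Let cmz : continuous (dz m) := Ck_cont (Ck_dz (mom_Ck f he)).
Let cethx : continuous (dx (thS e)) := Ck_cont (Ck_dx (th_Ck he)).
Let cethz : continuous (dz (thS e)) := Ck_cont (Ck_dz (th_Ck he)).
Let cdthx : continuous (dx (thS d)) := Ck_cont (Ck_dx (th_Ck hd)).
Let cdthz : continuous (dz (thS d)) := Ck_cont (Ck_dz (th_Ck hd)).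
Let cdTx : continuous (dx (uT d)) := Ck_cont (Ck_dx (uT_Ck hd)).
Let cdTz : continuous (dz (uT d)) := Ck_cont (Ck_dz (uT_Ck hd)).
Let cd1z : continuous (dz (u1 d)) := Ck_cont (Ck_dz (u1_Ck hd)).
Let cd2x : continuous (dx (u2 d)) := Ck_cont (Ck_dx (u2_Ck hd)).
Let cq : continuous q := Ck_cont (pv_Ck f s he).

Let cq1 : continuous q1.
Proof. by rewrite /q1 /pv1 /dpv -/m; cont. Qed.

Let cq2 : continuous q2.
Proof. by rewrite /q2 /pv2; cont. Qed.

Let cgam : continuous (gammaS g theta0 : R * R -> R) := gamma_cont.

Let energy1 w := u1 e w * u1 d w + u2 e w * u2 d w + uT e w * uT d w
  - gammaS g theta0 w * thS d w.

Lemma energy_derive : is_derive (0 : R) (1 : R)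
  (fun eps => area_integral Omega (fun w =>
     2^-1 * (dot (uS (perturb e eps d) w) (uS (perturb e eps d) w) + uT (perturb e eps d) w ^+ 2)
     - gammaS g theta0 w * thS (perturb e eps d) w))
  (area_integral Omega energy1).
Proof.
pose h0 w := 2^-1 * (u1 e w * u1 e w + u2 e w * u2 e w + uT e w * uT e w)
  - gammaS g theta0 w * thS e w.
pose h2 w := 2^-1 * (u1 d w * u1 d w + u2 d w * u2 d w + uT d w * uT d w).
have c0 : continuous h0 by rewrite /h0; cont.
have c1 : continuous energy1 by rewrite /energy1; cont.
have c2 : continuous h2 by rewrite /h2; cont.
have := quad_derive (area_integral Omega h0) (area_integral Omega energy1) (area_integral Omega h2).
congr is_derive; apply/funext => x.
have cc1 : continuous (fun w => x * energy1 w) by cont.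
have cc2 : continuous (fun w => x ^+ 2 * h2 w) by cont.
rewrite -(areaZ oO bO x c1) -(areaZ oO bO (x ^+ 2) c2) -(areaD oO bO c0 cc1).
rewrite -(areaD oO bO _ cc2); last by cont.
apply: eq_area => w _; rewrite /h0 /h2 /energy1 /dot.
have -> : (uS (perturb e x d) w).1 = u1 e w + x * u1 d w by [].
have -> : (uS (perturb e x d) w).2 = u2 e w + x * u2 d w by [].
by rewrite /=; field.
Qed.

(** For |t| <= 1 the perturbed potential vorticities stay in one compact interval,
    on which Phi' is bounded; this bounds the derivative of the integrand uniformly. *)
Lemma enstrophy_derive : is_derive (0 : R) (1 : R)
  (fun eps => area_integral Omega (fun w => Phi (pv f s (perturb e eps d) w)))
  (area_integral Omega (fun w => psi w * q1 w)).
Proof.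
have cPhi : continuous Phi := Ck_cont hPhi.
have cPhi' : continuous Phi^`() := Ck_cont (Ck_derive1 hPhi).
have dPhi x : is_derive x (1 : R) Phi (Phi^`() x).
  by apply: DeriveDef; [exact: Ck1_derivable hPhi|rewrite derive1E].
have [C0 C00 H0] := area_bound bO cq; have [C1 C10 H1] := area_bound bO cq1.
have [C2 C20 H2] := area_bound bO cq2.
have [M M0 HM] := cont_box_bound (C0 + C1 + C2) (fun w : R * R =>
  continuous_comp (@Ck_x R 0 w) (cPhi' w.1)).
pose h t w := Phi (q w + t * q1 w + t ^+ 2 * q2 w).
(* A variable in place of Phi^`(), whose definition as a limit simplification would
   expose. *)
have [dP dPE] : exists dP : R -> R, dP = Phi^`() by exists (Phi^`()).
pose h1 t w := dP (q w + t * q1 w + t ^+ 2 * q2 w) * (q1 w + 2 * t * q2 w).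
have -> : (fun eps => area_integral Omega (fun w => Phi (pv f s (perturb e eps d) w))) =
    (fun eps => area_integral Omega (h eps)).
  by apply/funext => x; apply: eq_area => w _; rewrite pv_perturb.
have -> : (fun w => psi w * q1 w) = h1 0.
  by apply/funext => w; rewrite /h1 dPE expr0n /= !(mulr0, mul0r, addr0).
apply: (is_derive_area oO bO (a := -1) (b := 1) (C := M * (C1 + 2 * C2))).
- by rewrite ltrN10 ltr01.
- move=> t; have ct : continuous (fun w => q w + t * q1 w + t ^+ 2 * q2 w) by cont.
  move=> w; apply: (@continuous_comp _ _ _ _ Phi w); first exact: ct.
  exact: cPhi.
- move=> t w _; rewrite /h1 dPE; apply: (is_derive_compP (c1 := fun t => q1 w + 2 * t * q2 w) dPhi).
  exact: is_derive_quad.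
- move=> t w /andP[t1 t2] Ow; rewrite /h1 normrM dPE.
  have t11 : `|t| <= 1 by rewrite ler_norml !ltW.
  have b1 : `|t * q1 w| <= C1.
    by rewrite normrM -[leRHS]mul1r ler_pM// H1.
  have b2 : `|t ^+ 2 * q2 w| <= C2.
    by rewrite normrM normrX -[leRHS]mul1r ler_pM ?exprn_ge0// ?H2// exprn_ile1.
  have b3 : `|t * q2 w| <= C2 by rewrite normrM -[leRHS]mul1r ler_pM// H2.
  apply: ler_pM => //.
    apply: (HM (_, 0)) => /=; last by rewrite normr0 !addr_ge0.
    by rewrite (le_trans (ler_normD _ _))// lerD// (le_trans (ler_normD _ _))// lerD// H0.
  rewrite (le_trans (ler_normD _ _))// lerD ?H1// -mulrA normrM ger0_norm//.
  by rewrite ler_pM2l// ltr0n.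
Qed.

Let l1 i t := dv1 s m (thS e) (u1 d) (uT d) (thS d) (c i t) * c1' c i t +
  dv2 s m (thS e) (u2 d) (uT d) (thS d) (c i t) * c2' c i t.

Let cc (F : R * R -> R) i : continuous F -> continuous (fun t => F (c i t)).
Proof.
move=> cF t; apply: (@continuous_comp _ _ _ (c i) F t); first exact: (curve_cont hO).
exact: cF.
Qed.

Lemma line_derive i : is_derive (0 : R) (1 : R)
  (fun eps => line_integral (c i) (vS f s (perturb e eps d)))
  (\int[mu]_(t in `[0, 1]) l1 i t).
Proof.
pose A1 w := s * u1 e w - m w * dx (thS e) w.
pose A2 w := s * u2 e w - m w * dz (thS e) w.
pose B1 := dv1 s m (thS e) (u1 d) (uT d) (thS d).
pose B2 := dv2 s m (thS e) (u2 d) (uT d) (thS d).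
pose C1 w := - (uT d w * dx (thS d) w).
pose C2 w := - (uT d w * dz (thS d) w).
have cA1 : continuous A1 by rewrite /A1; cont.
have cA2 : continuous A2 by rewrite /A2; cont.
have cB1 : continuous B1 by rewrite /B1 /dv1; cont.
have cB2 : continuous B2 by rewrite /B2 /dv2; cont.
have cC1 : continuous C1 by rewrite /C1; cont.
have cC2 : continuous C2 by rewrite /C2; cont.
have k1 := curve_cd1 hO (i := i); have k2 := curve_cd2 hO (i := i).
have a1 := @cc _ i cA1; have a2 := @cc _ i cA2; have b1 := @cc _ i cB1.
have b2 := @cc _ i cB2; have d1 := @cc _ i cC1; have d2 := @cc _ i cC2.
pose L0 t := A1 (c i t) * c1' c i t + A2 (c i t) * c2' c i t.
pose L2 t := C1 (c i t) * c1' c i t + C2 (c i t) * c2' c i t.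
have cL0 : continuous L0 by rewrite /L0; cont.
have cL1 : continuous (l1 i) by rewrite /l1 -/B1 -/B2; cont.
have cL2 : continuous L2 by rewrite /L2; cont.
have := quad_derive (\int[mu]_(t in `[0, 1]) L0 t) (\int[mu]_(t in `[0, 1]) l1 i t)
  (\int[mu]_(t in `[0, 1]) L2 t).
congr is_derive; apply/funext => x.
have cx1 : continuous (fun t => x * l1 i t) by cont.
have cx2 : continuous (fun t => x ^+ 2 * L2 t) by cont.
rewrite -(Rintegral_itvZ x _ _ cL1) -(Rintegral_itvZ (x ^+ 2) _ _ cL2).
rewrite -(Rintegral_itvD _ _ cL0 cx1) -(Rintegral_itvD _ _ _ cx2); last by cont.
apply: eq_Rintegral => t _.
have p1 : thS (perturb e x d) = fun w => thS e w + x * thS d w by [].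
have t1 := CkW (CkW (th_Ck he)); have t1' := CkW (CkW (th_Ck hd)).
have gx w : dx (thS (perturb e x d)) w = dx (thS e) w + x * dx (thS d) w.
  by rewrite p1 (dxDZ x w t1 t1').
have gz w : dz (thS (perturb e x d)) w = dz (thS e) w + x * dz (thS d) w.
  by rewrite p1 (dzDZ x w t1 t1').
rewrite /dot -/(c1' c i t) -/(c2' c i t).
have -> : (vS f s (perturb e x d) (c i t)).1 = s * (u1 e (c i t) + x * u1 d (c i t)) -
  (uT e (c i t) + x * uT d (c i t) + f * (c i t).1) * (dx (thS e) (c i t) + x * dx (thS d) (c i t)).
  by rewrite -gx.
have -> : (vS f s (perturb e x d) (c i t)).2 = s * (u2 e (c i t) + x * u2 d (c i t)) -
  (uT e (c i t) + x * uT d (c i t) + f * (c i t).1) * (dz (thS e) (c i t) + x * dz (thS d) (c i t)).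
  by rewrite -gz.
rewrite /L0 /L2 /l1 /dv1 /dv2 /A1 /A2 /C1 /C2 /m /mom.
move: (dx (thS e) (c i t)) (dz (thS e) (c i t)) (dx (thS d) (c i t)) (dz (thS d) (c i t)) => *.
ring.
Qed.

Lemma H_derive : is_derive (0 : R) (1 : R)
  (fun eps => H_Phi g theta0 f s Omega c Phi a (perturb e eps d))
  (area_integral Omega energy1 + area_integral Omega (fun w => psi w * q1 w) +
   \sum_i a i * \int[mu]_(t in `[0, 1]) l1 i t).
Proof.
have A := is_deriveD energy_derive enstrophy_derive.
have B : is_derive (0 : R) (1 : R)
    (fun eps => \sum_(i < n.+1) a i * line_integral (c i) (vS f s (perturb e eps d)))
    (\sum_i a i * \int[mu]_(t in `[0, 1]) l1 i t).
  have H := is_derive_sum (fun i => is_deriveZ (a i) (line_derive i)).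
  by move: H; congr is_derive; apply/funext => x; rewrite fct_sumE.
by have := is_deriveD A B; congr is_derive.
Qed.

(** At a critical point this derivative vanishes for all variations, which enter it
    undifferentiated both in Omega and on the boundary. *)
Lemma H_derive_euler : is_derive (0 : R) (1 : R)
  (fun eps => H_Phi g theta0 f s Omega c Phi a (perturb e eps d))
  (area_integral Omega (euler s (u1 e) (u2 e) (uT e) (gammaS g theta0) m psi (thS e)
     (u1 d) (u2 d) (uT d) (thS d)) +
   \sum_i \int[mu]_(t in `[0, 1]) ((a i - psi (c i t)) *
      (flux1 s m (thS e) (u1 d) (uT d) (thS d) (c i t) * c1' c i t +
       flux2 s m (thS e) (u2 d) (uT d) (thS d) (c i t) * c2' c i t))).
Proof.
rewrite -(variation_identity hO s a ce1 ce2 ceT cgam (mom_Ck f he) psi_Ck (CkW (th_Ck he))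
  (CkW (u1_Ck hd)) (CkW (u2_Ck hd)) (CkW (uT_Ck hd)) (CkW (th_Ck hd))).
exact: H_derive.
Qed.

End FirstVariation.

(** * Critical points and the equilibrium equations *)

Section Equilibrium.
Context {R : realType}.
Notation mu := (@lebesgue_measure R).
Variables (g theta0 f s : R) (Omega : set (R * R)) (n : nat) (c : 'I_n.+1 -> R -> R * R).
Variables (Phi : R -> R) (a : 'I_n.+1 -> R) (e : state R).
Hypothesis htheta0 : theta0 != 0.
Hypothesis hconst : [|| s != 0, f != 0 | g != 0].
Hypothesis hO : smooth_bounded_domain Omega c.
Hypothesis hPhi : Ck 2 Phi.
Hypothesis he : smooth_state e.

Let oO := dom_open hO.
Let N := sval (cid2 (dom_box hO)).
Let bO : Omega `<=` box 0 N. Proof. by rewrite /N; case: cid2. Qed.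

Let q := pv f s e.
Let psi : R * R -> R := fun w => Phi^`() (pv f s e w).
Let m := mom f e.
Let gam : R * R -> R := gammaS g theta0.
Let th := thS e.
Let psi1 : Ck 1 psi := psi_Ck f s hPhi he.
Let m2 : Ck 2 m := mom_Ck f he.

(** The four residuals euler_u1, euler_u2, euler_T, euler_th are the coefficients of
    the components of the variation in the first variation. *)
Definition euler_u1 w := u1 e w - s * dz psi w.
Definition euler_u2 w := u2 e w + s * dx psi w.
Definition euler_T w := uT e w - (- dz psi w * dx th w + dx psi w * dz th w).
Definition euler_th w := (- dz psi w * dx m w + dx psi w * dz m w) - gam w.

Let ce1 : continuous (u1 e) := Ck_cont (u1_Ck he).
Let ce2 : continuous (u2 e) := Ck_cont (u2_Ck he).
Let ceT : continuous (uT e) := Ck_cont (uT_Ck he).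
Let cpsi : continuous psi := Ck_cont psi1.
Let cpx : continuous (dx psi) := Ck_dx psi1.
Let cpz : continuous (dz psi) := Ck_dz psi1.
Let cmx : continuous (dx m) := Ck_cont (Ck_dx m2).
Let cmz : continuous (dz m) := Ck_cont (Ck_dz m2).
Let cthx : continuous (dx th) := Ck_cont (Ck_dx (th_Ck he)).
Let cthz : continuous (dz th) := Ck_cont (Ck_dz (th_Ck he)).
Let cgam : continuous gam := @gamma_cont R g theta0.

Let cE1 : continuous euler_u1. Proof. by rewrite /euler_u1; cont. Qed.
Let cE2 : continuous euler_u2. Proof. by rewrite /euler_u2; cont. Qed.
Let cET : continuous euler_T. Proof. by rewrite /euler_T; cont. Qed.
Let cEth : continuous euler_th. Proof. by rewrite /euler_th; cont. Qed.

Definition euler_equations := forall w, Omega w ->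
  [/\ euler_u1 w = 0, euler_u2 w = 0, euler_T w = 0 & euler_th w = 0].

Lemma dx_mom w : dx m w = dx (uT e) w + f.
Proof.
have -> : dx m w = dx (uT e) w + f * dx (fun w : R * R => w.1) w.
  exact: (dxDZ f w (CkW (uT_Ck he)) (@Ck_x R 1)).
have H := is_derive_x ((@Ck_x R 1).1 (w.1, w.2)).
have [_] := H; rewrite derive_id -surjective_pairing => <-.
by rewrite mulr1.
Qed.

Lemma dz_mom w : dz m w = dz (uT e) w.
Proof.
have -> : dz m w = dz (uT e) w + f * dz (fun w : R * R => w.1) w.
  exact: (dzDZ f w (CkW (uT_Ck he)) (@Ck_x R 1)).
have H := is_derive_z ((@Ck_x R 1).1 (w.1, w.2)).
have [_] := H; rewrite derive_cst -surjective_pairing => <-.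
by rewrite mulr0 addr0.
Qed.

Lemma equilibriumP : equilibrium_conditions g theta0 f s Omega c Phi a e <->
  (forall i t, a i = psi (c i t)) /\ euler_equations.
Proof.
have kE w : curl_yhat psi w = (- dz psi w, dx psi w) by [].
split=> [[h1 h2 h3 h4]|[h1 h2]]; split => // w Ow.
- have U := h2 w Ow; have T := h3 w Ow; have G := h4 w Ow.
  move: U T G; rewrite -/psi kE /dot => U T G.
  have U1 : u1 e w = - s * - dz psi w by rewrite /u1 U.
  have U2 : u2 e w = - s * dx psi w by rewrite /u2 U.
  rewrite /euler_u1 /euler_u2 /euler_T /euler_th U1 U2 dx_mom dz_mom; split.
  + by rewrite mulrNN subrr.
  + by rewrite mulNr addNr.
  + by rewrite T subrr.
  + rewrite [gam w]G /= [f *: (1 : R)]mulr1 [f *: (0 : R)]mulr0 addr0; exact: subrr.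
- have [E1 E2 _ _] := h2 w Ow; rewrite -/psi kE.
  rewrite [uS e w]surjective_pairing; congr pair; rewrite /=.
    by rewrite [- s *: - _]mulrNN; apply/eqP; rewrite -subr_eq0; apply/eqP.
  by rewrite [- s *: _]mulNr; apply/eqP; rewrite -addr_eq0; apply/eqP.
- have [_ _ E3 _] := h2 w Ow; rewrite -/psi kE /dot /=.
  by apply/eqP; rewrite -subr_eq0; apply/eqP.
- have [_ _ _ E4] := h2 w Ow; rewrite -/psi kE /dot /=.
  rewrite [f *: (1 : R)]mulr1 [f *: (0 : R)]mulr0 addr0 -dx_mom -dz_mom.
  by apply/esym/eqP; rewrite -subr_eq0; apply/eqP.
Qed.

Lemma criticalP : critical_point (H_Phi g theta0 f s Omega c Phi a) e <->
  forall d, smooth_state d ->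
    area_integral Omega (fun w => euler_u1 w * u1 d w + euler_u2 w * u2 d w +
      euler_T w * uT d w + euler_th w * thS d w) +
    \sum_i \int[mu]_(t in `[0, 1]) ((a i - psi (c i t)) *
      (flux1 s m th (u1 d) (uT d) (thS d) (c i t) * c1' c i t +
       flux2 s m th (u2 d) (uT d) (thS d) (c i t) * c2' c i t)) = 0.
Proof.
split=> H d hd.
  have [_ E1] := H d hd; have [_ E2] := H_derive_euler g theta0 f s a hO hPhi he hd.
  exact: (etrans (esym E2) E1).
have := H_derive_euler g theta0 f s a hO hPhi he hd.
by move=> h; apply: (is_derive_eq h); exact: H.
Qed.

Let per_psi i t : psi (c i (t + 1)) = psi (c i t). Proof. by rewrite (curve_per hO). Qed.

Let cc (F : R * R -> R) i : continuous F -> continuous (fun t => F (c i t)).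
Proof.
move=> cF t; apply: (@continuous_comp _ _ _ (c i) F t); first exact: (curve_cont hO).
exact: cF.
Qed.

(** Each component of the state is varied alone by an arbitrary scalar function, and
    the fundamental lemma separates the equation in Omega from the one on the
    boundary. *)
Lemma critical_weak : critical_point (H_Phi g theta0 f s Omega c Phi a) e ->
  euler_equations /\ forall i t, [/\ (a i - psi (c i t)) * s * c1' c i t = 0,
    (a i - psi (c i t)) * s * c2' c i t = 0,
    (a i - psi (c i t)) * (dx th (c i t) * c1' c i t + dz th (c i t) * c2' c i t) = 0
  & (a i - psi (c i t)) * (dx m (c i t) * c1' c i t + dz m (c i t) * c2' c i t) = 0].
Proof.
move/criticalP => H.
have k1 := curve_cd1 hO; have k2 := curve_cd2 hO.
have p1 := curve_perd1 hO; have p2 := curve_perd2 hO.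
have cpi i := @cc _ i cpsi.
have z0 (V W : normedModType R) k : Ck k (fun _ : V => 0 : W) := Ck_cst V k 0.
have [F1 G1] : (forall w, Omega w -> euler_u1 w = 0) /\
    (forall i t, (a i - psi (c i t)) * s * c1' c i t = 0).
  apply: (fundamental_lemma hO cE1) => [i|i t|phi phi3].
  - by have h1 := cpi i; have h2 := k1 i; cont.
  - by rewrite per_psi p1.
  pose d := State (fun w => (phi w, 0)) (fun=> 0) (fun=> 0) : state R.
  have hd : smooth_state d.
    split; [exact: (Ck_pair (CkW phi3) (z0 _ _ 2))|exact: z0|exact: z0].
  rewrite -[RHS](H d hd); congr (_ + _).
    by apply: eq_area => w _; rewrite /u1 /u2 /= !mulr0 !addr0.
  apply: eq_bigr => i _; apply: eq_Rintegral => t _.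
  by rewrite /flux1 /flux2 /u1 /u2 /= ; ring.
have [F2 G2] : (forall w, Omega w -> euler_u2 w = 0) /\
    (forall i t, (a i - psi (c i t)) * s * c2' c i t = 0).
  apply: (fundamental_lemma hO cE2) => [i|i t|phi phi3].
  - by have h1 := cpi i; have h2 := k2 i; cont.
  - by rewrite per_psi p2.
  pose d := State (fun w => (0, phi w)) (fun=> 0) (fun=> 0) : state R.
  have hd : smooth_state d.
    split; [exact: (Ck_pair (z0 _ _ 2) (CkW phi3))|exact: z0|exact: z0].
  rewrite -[RHS](H d hd); congr (_ + _).
    by apply: eq_area => w _; rewrite /u1 /u2 /= !mulr0 !addr0 add0r.
  apply: eq_bigr => i _; apply: eq_Rintegral => t _.
  by rewrite /flux1 /flux2 /u1 /u2 /= ; ring.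
have [F3 G3] : (forall w, Omega w -> euler_T w = 0) /\ (forall i t, (a i - psi (c i t)) *
    (- (dx th (c i t) * c1' c i t + dz th (c i t) * c2' c i t)) = 0).
  apply: (fundamental_lemma hO cET) => [i|i t|phi phi3].
  - have h1 := cpi i; have h2 := k1 i; have h3 := k2 i.
    by have h4 := @cc _ i cthx; have h5 := @cc _ i cthz; cont.
  - by rewrite per_psi p1 p2 (curve_per hO).
  pose d := State (fun=> (0, 0)) phi (fun=> 0) : state R.
  have hd : smooth_state d by split; [exact: z0|exact: CkW|exact: z0].
  rewrite -[RHS](H d hd); congr (_ + _).
    by apply: eq_area => w _; rewrite /u1 /u2 /= !mulr0 addr0 !add0r.
  apply: eq_bigr => i _; apply: eq_Rintegral => t _.
  rewrite /flux1 /flux2 /u1 /u2 /=.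
  by move: (dx th (c i t)) (dz th (c i t)) (dx m (c i t)) (dz m (c i t)) => *; ring.
have [F4 G4] : (forall w, Omega w -> euler_th w = 0) /\ (forall i t, (a i - psi (c i t)) *
    (dx m (c i t) * c1' c i t + dz m (c i t) * c2' c i t) = 0).
  apply: (fundamental_lemma hO cEth) => [i|i t|phi phi3].
  - have h1 := cpi i; have h2 := k1 i; have h3 := k2 i.
    by have h4 := @cc _ i cmx; have h5 := @cc _ i cmz; cont.
  - by rewrite per_psi p1 p2 (curve_per hO).
  pose d := State (fun=> (0, 0)) (fun=> 0) phi : state R.
  have hd : smooth_state d by split; [exact: z0|exact: z0|exact: phi3].
  rewrite -[RHS](H d hd); congr (_ + _).
    by apply: eq_area => w _; rewrite /u1 /u2 /= !mulr0 !add0r.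
  apply: eq_bigr => i _; apply: eq_Rintegral => t _.
  rewrite /flux1 /flux2 /u1 /u2 /=.
  by move: (dx th (c i t)) (dz th (c i t)) (dx m (c i t)) (dz m (c i t)) => *; ring.
split=> [w Ow|i t]; split; by [exact: F1|exact: F2|exact: F3|exact: F4|exact: G1|exact: G2|
  move: (G3 i t) => /eqP; rewrite mulrN oppr_eq0 => /eqP|exact: G4].
Qed.

Lemma weak_critical : (forall i t, a i = psi (c i t)) -> euler_equations ->
  critical_point (H_Phi g theta0 f s Omega c Phi a) e.
Proof.
move=> ha hE; apply/criticalP => d hd.
rewrite (eq_area (G := fun w => 0 * 0)); last first.
  by move=> w /hE [-> -> -> ->]; rewrite !mul0r !addr0.
rewrite (areaZ oO bO 0 (F := fun=> 0)) ?mul0r ?add0r; last exact: contC.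
apply: big1 => i _; rewrite (_ : (fun t => _) = fun=> 0).
  by rewrite Rintegral_cst ?mul0r//; exact: measurable_itv.
by apply/funext => t; rewrite -ha subrr mul0r.
Qed.

Lemma bdry_extend (F : R * R -> R) i t : continuous F -> (forall w, Omega w -> F w = 0) ->
  F (c i t) = 0.
Proof.
move=> cF F0.
have clZ : closed [set w | F w = 0].
  have -> : [set w | F w = 0] = F @^-1` [set 0] by [].
  by apply: preimage_closed => [w _|]; [exact: cF|exact: closed_eq].
have [cO _] : (closure Omega `\` Omega) (c i t) by apply/(bdryP hO); exists i, t.
have : closure [set w | F w = 0] (c i t) by apply: closureS cO => w; exact: F0.
by rewrite -(closure_id _).1.
Qed.

Lemma mid_between (x y : R) : Num.min x y <= (x + y) / 2 <= Num.max x y.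
Proof. by rewrite ge_min le_max; have [h|/ltW h] := leP x y; apply/andP; split; lra. Qed.

Lemma mid_neq (x y : R) : x != y -> x - (x + y) / 2 != 0.
Proof. by apply: contra => /eqP h; apply/eqP; lra. Qed.

Lemma det_cancel (x y x' y' u : R) : x * y' - y * x' = 0 ->
  u - (- y * x' + x * y') = 0 -> u = 0.
Proof. lra. Qed.

Lemma det_cancel' (x y x' y' u : R) : x * y' - y * x' = 0 ->
  (- y * x' + x * y') - u = 0 -> u = 0.
Proof. lra. Qed.

Lemma curve_rolle (h d : R -> R) : (forall t, is_derive t (1 : R) h (d t)) -> h 1 = h 0 ->
  exists t, d t = 0.
Proof.
move=> dh e01.
have [t _ et] := MVT_segment ler01 (fun t _ => dh t) (cont_within (is_derive_cont dh)).
by exists t; move: et; rewrite e01 subrr subr0 mulr1.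
Qed.

(** Vectors of the plane orthogonal to a common nonzero vector are parallel. *)
Lemma det_orth (x y x' y' p r : R) : (p != 0) || (r != 0) -> x * p + y * r = 0 ->
  x' * p + y' * r = 0 -> x * y' - y * x' = 0.
Proof.
move=> pr h h'.
have k1 : p * (x * y' - y * x') = 0.
  have -> : p * (x * y' - y * x') = y' * (x * p + y * r) - y * (x' * p + y' * r) by ring.
  by rewrite h h' !mulr0 subrr.
have k2 : r * (x * y' - y * x') = 0.
  have -> : r * (x * y' - y * x') = x * (x' * p + y' * r) - x' * (x * p + y * r) by ring.
  by rewrite h h' !mulr0 subrr.
case/orP: pr => nz.
  by move/eqP: k1; rewrite mulf_eq0 (negbTE nz) => /eqP.
by move/eqP: k2; rewrite mulf_eq0 (negbTE nz) => /eqP.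
Qed.

Let reg i t : (c1' c i t != 0) || (c2' c i t != 0).
Proof.
have := curve_reg hO i t; rewrite /c1' /c2'; case: ((c i)^`() t) => x y /=.
by apply: contraR; rewrite negb_or !negbK => /andP[/eqP -> /eqP ->].
Qed.

Let dpsi i t : is_derive t (1 : R) (fun t => psi (c i t))
  (dx psi (c i t) * c1' c i t + dz psi (c i t) * c2' c i t).
Proof. exact: (is_derive_curve (psi1.1 _) (curve_diff hO i t)). Qed.

Let dm i t : is_derive t (1 : R) (fun t => m (c i t))
  (dx m (c i t) * c1' c i t + dz m (c i t) * c2' c i t).
Proof. exact: (is_derive_curve (m2.1 _) (curve_diff hO i t)). Qed.

(** If s <> 0, the first two boundary identities and the regularity of the curve
    give the claim at once. If s = 0, suppose that psi differs from a i at some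
    point of the curve. At all such points the gradients of th and m are normal to
    the curve, so q = 0 and psi = Phi'(0). By continuity psi cannot jump from this
    value to a i, so psi = Phi'(0) on the whole curve. Then the gradients of psi, th
    and m are parallel there, and the equations in Omega, extended to the boundary,
    give u_T = 0 and gammaS = 0 on the curve, along which m = f x is constant. As f
    or g is nonzero, the curve lies on a line parallel to an axis, and the other
    coordinate has an extremum where the tangent vanishes, against regularity. *)
Lemma psi_bdry : euler_equations ->
  (forall i t, [/\ (a i - psi (c i t)) * s * c1' c i t = 0,
    (a i - psi (c i t)) * s * c2' c i t = 0,
    (a i - psi (c i t)) * (dx th (c i t) * c1' c i t + dz th (c i t) * c2' c i t) = 0
  & (a i - psi (c i t)) * (dx m (c i t) * c1' c i t + dz m (c i t) * c2' c i t) = 0]) ->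
  forall i t, a i = psi (c i t).
Proof.
move=> hE hB i t0; apply/eqP; rewrite -subr_eq0; apply: contrapT => /negP ne.
have s0 : s = 0.
  have [b1 b2 _ _] := hB i t0; apply/eqP; apply: contrapT => /negP sn.
  have := reg i t0; move/eqP: b1; move/eqP: b2.
  by rewrite !mulf_eq0 (negbTE ne) (negbTE sn) /= => -> ->.
pose b : R := Phi^`() 0.
(* With s = 0, the potential vorticity is a determinant of the two gradients that the
   boundary identities make normal to the curve. *)
have qb t : a i - psi (c i t) != 0 -> [/\ psi (c i t) = b,
    dx th (c i t) * c1' c i t + dz th (c i t) * c2' c i t = 0
  & dx m (c i t) * c1' c i t + dz m (c i t) * c2' c i t = 0].
  move=> nt; have [_ _ b3 b4] := hB i t.
  move/eqP: b3; move/eqP: b4; rewrite !mulf_eq0 (negbTE nt) /= => /eqP b4 /eqP b3.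
  split=> //; rewrite /psi /b; congr (Phi^`() _).
  rewrite pvE// s0 mul0r sub0r; apply/eqP; rewrite oppr_eq0; apply/eqP.
  have := det_orth (reg i t) b3 b4; rewrite -/m -/th.
  move: (dx th (c i t)) (dz th (c i t)) (dx m (c i t)) (dz m (c i t)) => A B C D E.
  have -> : D * A - C * B = A * D - B * C by ring.
  by [].
have [bE _ _] := qb _ ne.
have ab : a i != b by rewrite -subr_eq0 -bE.
(* Otherwise psi, whose only other value is b, would pass half-way between. *)
have all t : a i - psi (c i t) != 0.
  apply/negP => /eqP /eqP; rewrite subr_eq0 => /eqP ea.
  have [u uv] : exists u, psi (c i u) = (a i + b) / 2.
    have cpi : continuous (fun t => psi (c i t)) := @cc _ i cpsi.
    have mid := mid_between (a i) b.
    have [tt|tt] := leP t t0.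
      have [|u _ hu] := IVT tt (cont_within cpi) (v := (a i + b) / 2).
        by rewrite -ea bE.
      by exists u.
    have [|u _ hu] := IVT (ltW tt) (cont_within cpi) (v := (a i + b) / 2).
      by rewrite -ea bE minC maxC.
    by exists u.
  have nu : a i - psi (c i u) != 0.
    by rewrite uv mid_neq.
  have [ub _ _] := qb _ nu; move: ab; rewrite eq_sym => /mid_neq.
  by rewrite (addrC b (a i)) -uv ub subrr eqxx.
have dpsi0 t : dx psi (c i t) * c1' c i t + dz psi (c i t) * c2' c i t = 0.
  have [_ <-] := dpsi i t.
  have -> : (fun t => psi (c i t)) = fun=> b.
    by apply/funext => u; have [-> _ _] := qb _ (all u).
  by rewrite derive_cst.
have uT0 t : uT e (c i t) = 0.
  have := bdry_extend i t cET (fun w Ow => let: And4 _ _ h _ := hE w Ow in h).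
  have [_ h1 _] := qb _ (all t).
  have := det_orth (reg i t) (dpsi0 t) h1; rewrite /euler_T.
  by exact: det_cancel.
have gam0 t : gam (c i t) = 0.
  have := bdry_extend i t cEth (fun w Ow => let: And4 _ _ _ h := hE w Ow in h).
  have [_ _ h1] := qb _ (all t).
  have := det_orth (reg i t) (dpsi0 t) h1; rewrite /euler_th.
  by exact: det_cancel'.
have fc t : f * c1' c i t = 0.
  have [_ _ h1] := qb _ (all t); rewrite -h1.
  have [_ <-] := dm i t.
  have -> : (fun t => m (c i t)) = fun t => 0 + f * (c i t).1.
    by apply/funext => u; rewrite /m /mom uT0.
  have D := is_derive_compP (P := fun y => 0 + f * y) (g := fun=> f)
    (fun y => is_derive_affine 0 f y) (curve_d1 hO i t).
  by have [_ ->] := D.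
move: hconst; rewrite s0 eqxx /=; have [f0|f0 _] := eqVneq f 0.
  rewrite /= => g0.
  have z0 t : (c i t).2 = 0.
    have := gam0 t; rewrite /gam /gammaS => /eqP.
    by rewrite !mulf_eq0 invr_eq0 (negbTE g0) (negbTE htheta0) => /eqP.
  have k2 t : c2' c i t = 0.
    have [_ <-] := curve_d2 hO i t.
    have -> : (fun t => (c i t).2) = fun=> 0 by apply/funext.
    by rewrite derive_cst.
  have [|t k1] := curve_rolle (curve_d1 hO i).
    by rewrite -{1}(add0r 1) (curve_per hO).
  by have := reg i t; rewrite k1 k2 eqxx.
have k1 t : c1' c i t = 0.
  by have /eqP := fc t; rewrite mulf_eq0 (negbTE f0) => /eqP.
have [|t k2] := curve_rolle (curve_d2 hO i).
  by rewrite -{1}(add0r 1) (curve_per hO).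
by have := reg i t; rewrite k1 k2 eqxx.
Qed.

Theorem critical_equilibrium : critical_point (H_Phi g theta0 f s Omega c Phi a) e <->
  equilibrium_conditions g theta0 f s Omega c Phi a e.
Proof.
split=> [/critical_weak [hE hB]|/equilibriumP [ha hE]].
  by apply/equilibriumP; split=> //; exact: psi_bdry.
exact: weak_critical.
Qed.

End Equilibrium.

(** * The Bernoulli function *)

Section Bernoulli.
Context {R : realType}.
Variable Phi : R -> R.
Hypothesis hPhi : Ck 2 Phi.

(** This is the Bernoulli function K: the Legendre transform of Phi at the slope
    Phi'(l). *)
Definition legendre (l : R) : R := let slope : R := Phi^`() l in l * slope - Phi l.

Lemma legendre_Ck : Ck 1 legendre.
Proof.
apply: CkB; last exact: CkW.
apply: (@CkM R R 1 id Phi^`()); first exact: Ck_id.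
exact: Ck_derive1.
Qed.

Lemma Phi_derive l : is_derive l (1 : R) Phi (Phi^`() l).
Proof. by apply: DeriveDef; [exact: Ck1_derivable hPhi|rewrite derive1E]. Qed.

(** Dividing by l solves the differential equation l Phi' - Phi = K for Phi. *)
Lemma quotient_derive l : l != 0 ->
  is_derive l (1 : R) (fun x => Phi x * x^-1) (legendre l / l ^+ 2).
Proof.
move=> l0; have D := is_deriveM (Phi_derive l) (is_deriveV (f := id) l0 (is_derive_id l (1 : R))).
apply: (is_derive_eq D); rewrite /legendre /GRing.scale /=.
have [dP ->] : exists dP : R, Phi^`() l = dP by exists (Phi^`() l).
by rewrite mulr1; field.
Qed.

(** On an interval of positive or of negative numbers in L, Phi / l and A have the
    same derivative K / l ^ 2, so they differ by a constant. *)
Lemma bernoulli_on (K : R -> R) (L : set R) : is_interval L ->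
  (forall l, L l -> K l = legendre l) -> Bernoulli_formula K Phi L.
Proof.
move=> iL KL D hD A dA.
have Dn0 l : D l -> l != 0.
  by case: hD => -> /= h; [exact: lt0r_neq0|exact: ltr0_neq0].
have Dc x y z : D x -> D y -> x <= z <= y -> D z.
  case: hD => -> /= hx hy /andP[h1 h2]; first exact: lt_le_trans h1.
  exact: le_lt_trans hy.
have [[l0 [Dl0 Ll0]]|no] := pselect (exists l, D l /\ L l); last first.
  by exists 0 => l Dl Ll; case: no; exists l.
pose h x := Phi x * x^-1 - A x.
have dh x : D x -> is_derive x (1 : R) h (legendre x / x ^+ 2 - K x / x ^+ 2).
  by move=> Dx; apply: is_deriveB; [exact/quotient_derive/Dn0|exact: dA].
have cst_h x y : D x -> L x -> D y -> L y -> x <= y -> h x = h y.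
  move=> Dx Lx Dy Ly xy.
  have inD z (hz : x <= z <= y) : D z := Dc x y z Dx Dy hz.
  have [||z hz e] := @MVT_segment R h (fun x => legendre x / x ^+ 2 - K x / x ^+ 2) x y xy.
  - by move=> z; rewrite in_itv /= => /andP[h1 h2]; apply/dh/inD; rewrite !ltW.
  - apply: derivable_within_continuous => z; rewrite in_itv /= => hz.
    by have [] := dh z (inD z hz).
  have Lz : L z by move: hz; rewrite in_itv /= => hz; exact: (iL x y).
  move: e; rewrite (KL _ Lz) subrr mul0r => /eqP; rewrite subr_eq0 => /eqP ->.
  by [].
exists (h l0) => l Dl Ll.
have -> : h l0 = h l.
  have [le|/ltW le] := leP l0 l; first exact: cst_h.
  by apply/esym; exact: cst_h.
by rewrite /h addrC subrK mulrCA divff ?mulr1// Dn0.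
Qed.

End Bernoulli.

Section Constancy.
Context {R : realType}.

(** By the mean value theorem along the sides of a rectangle, F is constant on each
    box in Omega. The set where F takes the value F w0 is thus open, and it is
    closed in Omega. *)
Lemma grad0_constant (Omega : set (R * R)) (F : R * R -> R) w0 : open Omega ->
  connected Omega -> Ck 1 F -> (forall w, Omega w -> dx F w = 0 /\ dz F w = 0) ->
  Omega w0 -> forall w, Omega w -> F w = F w0.
Proof.
move=> oO cO F1 G0 Ow0.
have loc p r w : box p r `<=` Omega -> box p r w -> F w = F p.
  move=> rO [hx hz]; have r0 : 0 < r by exact: le_lt_trans hx.
  have inO x z : `|x - p.1| <= `|w.1 - p.1| -> `|z - p.2| <= `|w.2 - p.2| -> Omega (x, z).
    by move=> h1 h2; apply: rO; split; [exact: le_lt_trans hx|exact: le_lt_trans hz].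
  have pp (x d : R) : `|x - x| <= `|d| by rewrite subrr normr0.
  have [x xw ex] := mvt_sym (fun x => is_derive_x (F1.1 (x, w.2))) (pp p.1 (w.1 - p.1))
    (lexx `|w.1 - p.1|).
  have [z zw ez] := mvt_sym (fun z => is_derive_z (F1.1 (p.1, z))) (pp p.2 (w.2 - p.2))
    (lexx `|w.2 - p.2|).
  have [k1 _] := G0 _ (inO x w.2 xw (lexx _)).
  have [_ k2] := G0 _ (inO p.1 z (pp _ _) zw).
  move: ex ez; rewrite k1 k2 !mul0r => /eqP; rewrite subr_eq0 => /eqP ex /eqP.
  rewrite subr_eq0 => /eqP ez; move: ex ez.
  by case: w {hx hz inO xw zw k1 k2} => w1 w2; case: p {rO pp} => p1 p2 /= -> ->.
pose B := Omega `&` [set w | F w = F w0].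
suff BO : B = Omega by move=> w; rewrite -BO => -[].
apply: cO; first by exists w0.
- exists B; last by rewrite /B setIA setIid.
  rewrite openE => p [Op Fp]; have [r r0 rO] := open_box oO Op.
  have bp : box p r p by split; rewrite subrr normr0.
  have := open_nbhs_nbhs (conj (@box_open R p r) bp); apply: filterS => w bw.
  by split; [exact: rO|rewrite /= (loc p r w rO bw)].
- exists [set w | F w = F w0] => //.
  have -> : [set w | F w = F w0] = F @^-1` [set F w0] by [].
  by apply: preimage_closed => [w _|]; [exact: (Ck_cont F1)|exact: closed_eq].
Qed.

End Constancy.

(** * Equilibria as stationary solutions *)

Section Stationary.
Context {R : realType}.
Notation mu := (@lebesgue_measure R).
Variables (g theta0 f s : R) (Omega : set (R * R)) (n : nat) (c : 'I_n.+1 -> R -> R * R).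
Variables (Phi : R -> R) (a : 'I_n.+1 -> R) (e : state R).
Hypothesis hO : smooth_bounded_domain Omega c.
Hypothesis hPhi : Ck 2 Phi.
Hypothesis he : smooth_state e.

Let oO := dom_open hO.
Let q := pv f s e.
Let psi : R * R -> R := fun w => Phi^`() (pv f s e w).
Let m := mom f e.
Let gam : R * R -> R := gammaS g theta0.
Let th := thS e.
Let psi1 : Ck 1 psi := psi_Ck f s hPhi he.
Let q_Ck : Ck 1 q := pv_Ck f s he.

Hypothesis ha : forall i t, a i = psi (c i t).
Hypothesis hE : euler_equations g theta0 f s Omega Phi e.

(** The Bernoulli relation solved for the pressure. *)
Definition pressure w := legendre Phi (pv f s e w) - 2^-1 * dot (uS e w) (uS e w)
  - 2^-1 * uT e w ^+ 2 + gammaS g theta0 w * thS e w.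

Let kin w := 2^-1 * (u1 e w * u1 e w) + 2^-1 * (u2 e w * u2 e w) + 2^-1 * (uT e w * uT e w).

Let pressureE : pressure = fun w => (q w * psi w - Phi (q w)) - kin w + gam w * th w.
Proof.
apply/funext => w; have lE : legendre Phi (pv f s e w) = q w * psi w - Phi (q w) by [].
rewrite /pressure lE /kin /dot -/(u1 e w) -/(u2 e w) -/(gam w) -/(th w).
by move: (q w) (psi w) (Phi (q w)) => *; ring.
Qed.

Let a1 := CkW (u1_Ck he).
Let a2 := CkW (u2_Ck he).
Let aT := CkW (uT_Ck he).
Let ath : Ck 1 th := CkW (CkW (th_Ck he)).
Let agam : Ck 1 gam. Proof. by apply: (@CkM _ _ 1 (fun=> g / theta0)); [exact: Ck_cst|exact: Ck_z]. Qed.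
Let aPq : Ck 1 (fun w => Phi (q w)).
Proof. by apply: (@Ck_comp _ _ 1 Phi) => //; exact: CkW. Qed.
Let aqp : Ck 1 (fun w => q w * psi w). Proof. exact: CkM. Qed.
Let a11 : Ck 1 (fun w => u1 e w * u1 e w). Proof. exact: CkM. Qed.
Let a22 : Ck 1 (fun w => u2 e w * u2 e w). Proof. exact: CkM. Qed.
Let aTT : Ck 1 (fun w => uT e w * uT e w). Proof. exact: CkM. Qed.
Let agt : Ck 1 (fun w => gam w * th w). Proof. exact: CkM. Qed.
Let ak : Ck 1 kin.
Proof. exact: (CkD (CkD (CkZr _ a11) (CkZr _ a22)) (CkZr _ aTT)). Qed.

Lemma pressure_Ck : Ck 1 pressure.
Proof. rewrite pressureE; exact: (CkD (CkB (CkB aqp aPq) ak) agt). Qed.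

Let dgamx w : dx gam w = 0.
Proof.
case: w => x z; have [_ <-] := is_derive_x (agam.1 (x, z)).
exact: (derive_cst (g / theta0 * z) x 1).
Qed.

Let dgamz w : dz gam w = g / theta0.
Proof.
case: w => x z; have [_ <-] := is_derive_z (agam.1 (x, z)).
have [_ <-] := is_derive_affine 0 (g / theta0) z.
rewrite (_ : (fun y => gam (x, y)) = fun y => 0 + g / theta0 * y)//.
by apply/funext => y; rewrite add0r.
Qed.

Let dPqx w : dx (fun w => Phi (q w)) w = psi w * dx q w.
Proof.
have := derive_comp1 ((1, 0) : R * R) (q_Ck.1 w) (hPhi.1 (q w)).
by rewrite -derive1E.
Qed.

Let dPqz w : dz (fun w => Phi (q w)) w = psi w * dz q w.
Proof.
have := derive_comp1 ((0, 1) : R * R) (q_Ck.1 w) (hPhi.1 (q w)).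
by rewrite -derive1E.
Qed.

(** The gradient of legendre Phi o q is q times the gradient of psi. *)
Lemma pressure_dx w : dx pressure w = q w * dx psi w -
  (u1 e w * dx (u1 e) w + u2 e w * dx (u2 e) w + uT e w * dx (uT e) w) + gam w * dx th w.
Proof.
rewrite pressureE (dxD w (CkB (CkB aqp aPq) ak) agt) (dxB w (CkB aqp aPq) ak) (dxB w aqp aPq).
rewrite (dxD w (CkD (CkZr _ a11) (CkZr _ a22)) (CkZr _ aTT)) (dxD w (CkZr _ a11) (CkZr _ a22)).
rewrite (dxZ _ w a11) (dxZ _ w a22) (dxZ _ w aTT) (dxM w a1 a1) (dxM w a2 a2) (dxM w aT aT).
rewrite (dxM w agam ath) (dxM w q_Ck psi1) dPqx dgamx.
move: (dx q w) (dx psi w) (dx (u1 e) w) (dx (u2 e) w) (dx (uT e) w) (dx th w) => *.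
by field.
Qed.

Lemma pressure_dz w : dz pressure w = q w * dz psi w -
  (u1 e w * dz (u1 e) w + u2 e w * dz (u2 e) w + uT e w * dz (uT e) w) + gam w * dz th w
  + g / theta0 * th w.
Proof.
rewrite pressureE (dzD w (CkB (CkB aqp aPq) ak) agt) (dzB w (CkB aqp aPq) ak) (dzB w aqp aPq).
rewrite (dzD w (CkD (CkZr _ a11) (CkZr _ a22)) (CkZr _ aTT)) (dzD w (CkZr _ a11) (CkZr _ a22)).
rewrite (dzZ _ w a11) (dzZ _ w a22) (dzZ _ w aTT) (dzM w a1 a1) (dzM w a2 a2) (dzM w aT aT).
rewrite (dzM w agam ath) (dzM w q_Ck psi1) dPqz dgamz.
move: (dz q w) (dz psi w) (dz (u1 e) w) (dz (u2 e) w) (dz (uT e) w) (dz th w) (g / theta0) => *.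
by field.
Qed.

Let eulerE w : Omega w -> [/\ u1 e w = s * dz psi w, u2 e w = - (s * dx psi w),
  uT e w = - dz psi w * dx th w + dx psi w * dz th w
  & gam w = - dz psi w * dx m w + dx psi w * dz m w].
Proof.
move=> /hE [e1 e2 e3 e4]; split; apply/eqP.
- by rewrite -subr_eq0; apply/eqP.
- by rewrite -addr_eq0; apply/eqP.
- by rewrite -subr_eq0; apply/eqP.
- by rewrite eq_sym -subr_eq0; apply/eqP.
Qed.

(** In Omega, s * psi is a stream function for the velocity. It is only of class C^1
    on the plane, but its derivatives in Omega are velocity components, of class
    C^2. *)
Lemma div_free w : Omega w -> div (uS e) w = 0.
Proof.
move=> Ow.
have -> : div (uS e) w = dx (u1 e) w + dz (u2 e) w by [].
have sx y : Omega y -> dx (fun w => s * psi w) y = - u2 e y.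
  by move=> /eulerE [_ -> _ _]; rewrite (dxZ s y psi1) opprK.
have sz y : Omega y -> dz (fun w => s * psi w) y = u1 e y.
  by move=> /eulerE [-> _ _ _]; rewrite (dzZ s y psi1).
rewrite (schwarz_local oO Ow (CkZr s psi1).1 (CkN a2) a1 sx sz).
have -> : dz (fun w => - u2 e w) w = - dz (u2 e) w by exact: (derN (0, 1) w a2).
by rewrite addNr.
Qed.

Let momx w := dx_mom f he w.
Let momz w := dz_mom f he w.

(** The gradient of kinetic energy cancels against a part of the advection; the
    terms left over, among them q times the gradient of psi, balance by the
    equilibrium equations and the formula for q. *)
Lemma momentum_x w : Omega w -> u1 e w * dx (u1 e) w + u2 e w * dz (u1 e) w - f * uT e w =
  - dx pressure w.
Proof.
move=> Ow; have [E1 E2 E3 E4] := eulerE Ow; rewrite pressure_dx.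
have Q : q w = s * (dz (u1 e) w - dx (u2 e) w) - (dz m w * dx th w - dx m w * dz th w) := pvE f s w he.
have mx : dx (uT e) w = dx m w - f by rewrite [dx m w]momx addrK.
rewrite Q mx E2 E4 E3.
move: (dx psi w) (dz psi w) (dx (u1 e) w) (dz (u1 e) w) (dx (u2 e) w) (dx m w) (dz m w)
  (dx th w) (dz th w) => *; ring.
Qed.

Lemma momentum_z w : Omega w -> u1 e w * dx (u2 e) w + u2 e w * dz (u2 e) w =
  - dz pressure w + g / theta0 * th w.
Proof.
move=> Ow; have [E1 E2 E3 E4] := eulerE Ow; rewrite pressure_dz.
have Q : q w = s * (dz (u1 e) w - dx (u2 e) w) - (dz m w * dx th w - dx m w * dz th w) := pvE f s w he.
have mz : dz (uT e) w = dz m w by rewrite [dz m w]momz.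
rewrite Q mz E1 E4 E3.
move: (dx psi w) (dz psi w) (dz (u1 e) w) (dx (u2 e) w) (dz (u2 e) w) (dx m w) (dz m w)
  (dx th w) (dz th w) (g / theta0) => *; ring.
Qed.

(** The velocity is orthogonal to the gradient of psi, which is constant along each
    boundary curve by the boundary conditions. *)
Lemma no_flux i r : dot (uS e (c i r)) (unit_normal (c i) r) = 0.
Proof.
have cpx : continuous (dx psi) := Ck_dx psi1.
have cpz : continuous (dz psi) := Ck_dz psi1.
have c1 := Ck_cont a1; have c2 := Ck_cont a2.
have B1 : euler_u1 f s Phi e (c i r) = 0.
  apply: (bdry_extend hO i r) => [|w Ow]; first by rewrite /euler_u1 -/psi; cont.
  by have [] := hE Ow.
have B2 : euler_u2 f s Phi e (c i r) = 0.
  apply: (bdry_extend hO i r) => [|w Ow]; first by rewrite /euler_u2 -/psi; cont.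
  by have [] := hE Ow.
have D : dx psi (c i r) * c1' c i r + dz psi (c i r) * c2' c i r = 0.
  have [_ <-] := is_derive_curve (psi1.1 (c i r)) (curve_diff hO i r).
  have -> : (fun t => psi (c i t)) = cst (a i) by apply/funext => t; rewrite -ha.
  exact: derive_cst.
have U1 : u1 e (c i r) = s * dz psi (c i r) by apply/eqP; rewrite -subr_eq0; apply/eqP.
have U2 : u2 e (c i r) = - (s * dx psi (c i r)) by apply/eqP; rewrite -addr_eq0; apply/eqP.
rewrite /unit_normal /dot /= -/(u1 e (c i r)) -/(u2 e (c i r)) -/(c1' c i r) -/(c2' c i r).
rewrite U1 U2 /GRing.scale /=; move: (elen _)^-1 => l.
have -> : s * dz psi (c i r) * (l * c2' c i r) + - (s * dx psi (c i r)) * (l * - c1' c i r) =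
  s * l * (dx psi (c i r) * c1' c i r + dz psi (c i r) * c2' c i r).
  by move: (dx psi (c i r)) (dz psi (c i r)) => *; ring.
by rewrite D mulr0.
Qed.

Lemma pressure_stationary : stationary_solution g theta0 f s Omega c e pressure.
Proof.
split.
- by move=> _; split; [exact: he|exact: pressure_Ck].
- by move=> t w _; split; exact: derivable_cst.
- move=> t w Ow; have [E1 E2 E3 E4] := eulerE Ow; split.
  + rewrite derive1_cst add0r; congr pair; rewrite /advectv /advect /dot /=.
      rewrite [_ *: (1 : R)]mulr1 [_ *: (0 : R)]mulr0 addr0; exact: momentum_x.
    rewrite [_ *: (1 : R)]mulr1 [_ *: (0 : R)]mulr0 subr0; exact: momentum_z.
  + rewrite derive1_cst add0r /advect /dot /= mulr1 mulr0 addr0.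
    have mx : dx (uT e) w = dx m w - f by rewrite [dx m w]momx addrK.
    have mz : dz (uT e) w = dz m w by rewrite [dz m w]momz.
    have -> : - (g / theta0) * w.2 * s = - s * gam w by rewrite /gam /gammaS; ring.
    rewrite mx mz E4 -/(u1 e w) -/(u2 e w) E1 E2.
    move: (dx psi w) (dz psi w) (dx m w) (dz m w) => *; ring.
  + rewrite derive1_cst add0r /advect /dot /= -/(u1 e w) -/(u2 e w) E1 E2 E3 -/th.
    move: (dx psi w) (dz psi w) (dx th w) (dz th w) => *; ring.
  + exact: div_free.
- by move=> _ i r; exact: no_flux.
Qed.

(** The momentum equation determines the gradient of the pressure, and Omega is
    connected. *)
Lemma pressure_unique p : stationary_solution g theta0 f s Omega c e p ->
  exists p0, forall w, Omega w -> p w + p0 = pressure w.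
Proof.
move=> hp.
have [w0 Ow0] : exists w, Omega w.
  have [cO _] : (closure Omega `\` Omega) (c ord0 0) by apply/(bdryP hO); exists ord0, 0.
  have [w [Ow _]] := cO setT filterT.
  by exists w.
have p1 : Ck 1 p by have [h _ _ _] := hp; have [] := h 0.
have G w : Omega w -> dx (fun w => pressure w - p w) w = 0 /\ dz (fun w => pressure w - p w) w = 0.
  move=> Ow; rewrite (dxB w pressure_Ck p1) (dzB w pressure_Ck p1).
  have [_ _ /(_ 0 w Ow)[e1 _ _ _] _] := hp.
  have [_ _ /(_ 0 w Ow)[e2 _ _ _] _] := pressure_stationary.
  have := etrans (esym e1) e2 => /(congr1 (fun v : R * R => v - (g / theta0 * thS e w) *: zhat R)).
  rewrite !addrK => -[/oppr_inj h1 /oppr_inj h2].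
  by rewrite h1 h2 !subrr.
have H := grad0_constant oO (dom_connected hO) (CkB pressure_Ck p1) G Ow0.
exists (pressure w0 - p w0) => w Ow.
by rewrite -(H w Ow) addrC subrK.
Qed.

Lemma pressure_bernoulli p p0 : (forall w, Omega w -> p w + p0 = pressure w) ->
  Bernoulli_function g theta0 f s Omega e (fun w => p w + p0) (legendre Phi).
Proof.
move=> hp; split; first by move=> l; apply: diff_derivable; exact: (legendre_Ck hPhi).1.
by move=> w Ow; rewrite hp// /pressure; ring.
Qed.

(** Every Bernoulli function agrees with the Legendre transform on the values of q,
    which form an interval because Omega is connected. *)
Lemma bernoulli_all p p0 : stationary_solution g theta0 f s Omega c e p ->
  (forall w, Omega w -> p w + p0 = pressure w) ->
  forall K, Bernoulli_function g theta0 f s Omega e (fun w => p w + p0) K ->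
    Bernoulli_formula K Phi (pv f s e @` Omega).
Proof.
move=> hp hp0 K [_ HK]; apply: bernoulli_on => //.
  apply/connected_intervalP; apply: connected_continuous_connected.
    exact: (dom_connected hO).
  by apply: continuous_subspaceT; exact: (Ck_cont q_Ck).
move=> _ [w Ow <-]; rewrite -(HK w Ow) hp0// /pressure; ring.
Qed.

End Stationary.

Theorem theorem1p1 (R : realType) (g theta0 f s : R) (Omega : set (R * R))
    (n : nat) (c : 'I_n.+1 -> R -> R * R) (Phi : R -> R) (a : 'I_n.+1 -> R)
    (e : state R)
    (htheta0 : theta0 != 0)
    (hconst : [|| s != 0, f != 0 | g != 0])
    (hO : smooth_bounded_domain Omega c)
    (hPhi : Ck 2 Phi)
    (he : smooth_state e) :
  let critical := critical_point (H_Phi g theta0 f s Omega c Phi a) e in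
  [/\ critical <-> equilibrium_conditions g theta0 f s Omega c Phi a e,
      critical -> exists p, stationary_solution g theta0 f s Omega c e p
    & critical -> forall p, stationary_solution g theta0 f s Omega c e p ->
        exists p0 : R, let p' := (fun w => p w + p0) in
          (exists K, Bernoulli_function g theta0 f s Omega e p' K /\
                     Bernoulli_formula K Phi setT) /\
          (forall K, Bernoulli_function g theta0 f s Omega e p' K ->
                     Bernoulli_formula K Phi (pv f s e @` Omega))].
Proof.
move=> critical.
have critE : critical -> (forall i t, a i = Phi^`() (pv f s e (c i t))) /\
    euler_equations g theta0 f s Omega Phi e.
  move=> /(critical_equilibrium a htheta0 hconst hO hPhi he).
  by move=> /(equilibriumP g theta0 f s Omega c Phi a he).
split.
- exact: critical_equilibrium.
- by move=> /critE [ha hE]; exists (pressure g theta0 f s Phi e); exact: (pressure_stationary hO hPhi he ha hE).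
- move=> /critE [ha hE] p hp.
  have [p0 Hp0] := pressure_unique hO hPhi he ha hE hp.
  exists p0; split.
    exists (legendre Phi); split; first exact: pressure_bernoulli.
    exact: bernoulli_on.
  exact: (bernoulli_all hO hPhi he hp Hp0).
Qed.
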